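(* Let $(M,g)$ be a smooth Lorentzian manifold of dimension $n\ge 2$. Any locally extremal, non-self-conjugate timelike geodesic loop in $(M,g)$ is a closed timelike geodesic.
   Context: The Lorentzian manifold $(M,g)$ is not assumed compact or geodesically complete. A nonzero tangent vector $v$ is timelike if $g(v,v)<0$; a timelike geodesic is a geodesic with timelike velocity. Write $|v|=\sqrt{|g(v,v)|}$. The length of a timelike geodesic segment $\alpha:[a,b]\to M$ is $\mathrm{length}(\alpha)=\int_a^b|\dot\alpha(t)|\,dt$. A timelike geodesic loop is a timelike geodesic segment $\gamma:[a,b]\to M$ with $\gamma(a)=\gamma(b)$ (the velocities at the endpoints need not agree). It is a closed timelike geodesic if in addition $\dot\gamma(a)=c\,\dot\gamma(b)$ for some $c>0$. A timelike geodesic loop $\gamma:[a,b]\to M$ is self-conjugate if $\gamma(b)$ is conjugate to $\gamma(a)=\gamma(b)$ along $\gamma$, and non-self-conjugate otherwise. A timelike geodesic loop $\gamma:[0,1]\to M$ is locally maximizing (resp. locally minimizing) if $\mathrm{length}(\zeta)\le\mathrm{length}(\gamma)$ (resp. $\mathrm{length}(\zeta)\ge\mathrm{length}(\gamma)$) for every timelike geodesic loop $\zeta:[0,1]\to M$ with initial conditions $(\zeta(0),\dot\zeta(0))\in TM$ close enough to $(\gamma(0),\dot\gamma(0))$, i.e. lying in some neighborhood of $(\gamma(0),\dot\gamma(0))$ in $TM$. It is locally extremal if it is either locally maximizing or locally minimizing. *)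

(* Defs.v *)
From HB Require Import structures.
From mathcomp Require Import all_boot all_order all_algebra.
From mathcomp Require Import all_classical all_reals all_analysis.

Set Implicit Arguments.
Unset Strict Implicit.
Unset Printing Implicit Defensive.

Import Order.TTheory GRing.Theory Num.Theory.
Import numFieldNormedType.Exports.

Local Open Scope classical_set_scope.
Local Open Scope ring_scope.

(* Meant for open [A] and finite-dimensional [V], where it is the usual C^k:
   all iterated directional derivatives of order at most [k] exist and are
   continuous on [A]. *)
Fixpoint Ck_on (R : realType) (V W : normedModType R) (k : nat)
    (A : set V) (f : V -> W) : Prop :=
  {in A, continuous f} /\
  if k is k'.+1 then
    forall v : V, {in A, forall x, derivable f x v} /\ Ck_on k' A ('D_v f)
  else True.

Definition smooth_on (R : realType) (V W : normedModType R)
    (A : set V) (f : V -> W) : Prop := forall k, Ck_on k A f.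

(* [chart_map] is meaningful on [chart_dom] only, and [chart_inv] on the image
   of [chart_dom] only. *)
Record chart (R : realType) (n : nat) (T : topologicalType) := Chart {
  chart_dom : set T;
  chart_map : T -> 'rV[R]_n;
  chart_inv : 'rV[R]_n -> T }.

Definition chart_im (R : realType) (n : nat) (T : topologicalType)
    (c : chart R n T) : set 'rV[R]_n := chart_map c @` chart_dom c.

Definition chart_homeo (R : realType) (n : nat) (T : topologicalType)
    (c : chart R n T) : Prop :=
  [/\ open (chart_dom c), open (chart_im c),
      {in chart_dom c, cancel (chart_map c) (chart_inv c)},
      {in chart_dom c, continuous (chart_map c)} &
      {in chart_im c, continuous (chart_inv c)}].

(* The atlas need not be maximal. The choice of a preferred chart around each
   point is auxiliary: it serves to represent tangent vectors (see [tangent]). *)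
Record smoothManifold (R : realType) (n : nat) := SmoothManifold {
  carrier :> topologicalType;
  atlas : set (chart R n carrier);
  chart_at : carrier -> chart R n carrier;
  manifold_hausdorff : hausdorff_space carrier;
  manifold_second_countable : @second_countable carrier;
  atlas_homeo : forall c, atlas c -> chart_homeo c;
  chart_atP : forall p, atlas (chart_at p) /\ chart_dom (chart_at p) p;
  atlas_compatible : forall c d, atlas c -> atlas d ->
        smooth_on (chart_map c @` (chart_dom c `&` chart_dom d))
                  (chart_map d \o chart_inv c) }.

Section LorentzianGeometry.
Variables (R : realType) (n : nat) (M : smoothManifold R n).
Implicit Types (c : chart R n M) (p q : M) (gamma : R -> M) (a b t : R).

(* A tangent vector at [p] is given by its components in the chart
   [chart_at p]. *)
Definition tangent p : Type := 'rV[R]_n.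

Definition tangent_bundle : Type := {p : M & tangent p}.

(* The components in the chart [c] of the tangent vector [v] at [p]. *)
Definition components c p (v : tangent p) : 'rV[R]_n :=
  v *m 'J (chart_map c \o chart_inv (chart_at p)) (chart_map (chart_at p) p).

Definition bundle_chart c (u : tangent_bundle) : 'rV[R]_n * 'rV[R]_n :=
  (chart_map c (tag u), components c (tagged u)).

(* Neighborhoods for the topology of TM making every [bundle_chart c] a
   homeomorphism from the part of TM over [chart_dom c] onto its (open) image. *)
Definition bundle_nbhs (u : tangent_bundle) (U : set tangent_bundle) : Prop :=
  let c := chart_at (tag u) in
  exists2 N, nbhs (bundle_chart c u) N &
    forall w, chart_dom c (tag w) -> N (bundle_chart c w) -> U w.

(* A field of bilinear forms on the tangent spaces, given at each [p] by its
   Gram matrix in the basis of [tangent p]. *)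
Definition bilinear_field : Type := M -> 'M[R]_n.

Implicit Type g : bilinear_field.

Definition metric_form g p (v w : tangent p) : R := (v *m g p *m w^T) 0 0.

(* The matrix (g_ij) of [g] in the chart [c], as a function of coordinates. *)
Definition gram g c (x : 'rV[R]_n) : 'M[R]_n :=
  let p := chart_inv c x in
  let T := 'J (chart_map (chart_at p) \o chart_inv c) x in
  T *m g p *m T^T.

Definition minkowski_mx : 'M[R]_n :=
  diag_mx (\row_(i < n) if i == 0%N :> nat then -1 else 1).

Definition lorentzian_metric g : Prop :=
  [/\ forall p, (g p)^T = g p,
      forall p, exists2 P, P \in unitmx & P *m g p *m P^T = minkowski_mx &
      forall c, atlas c -> smooth_on (chart_im c) (gram g c)].

Definition partial (i : 'I_n) (f : 'rV[R]_n -> R) : 'rV[R]_n -> R :=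
  'D_(delta_mx 0 i) f.

(* The Levi-Civita connection: [christoffel g c k i j] is Gamma^k_ij. *)
Definition christoffel g c (k i j : 'I_n) (x : 'rV[R]_n) : R :=
  2^-1 * \sum_(l < n) invmx (gram g c x) k l *
    (partial i (fun y => gram g c y j l) x
     + partial j (fun y => gram g c y i l) x
     - partial l (fun y => gram g c y i j) x).

(* [riemann g c l i j k] is the component along d_l of R(d_i, d_j) d_k, where
   R(X, Y) Z = D_X D_Y Z - D_Y D_X Z - D_[X, Y] Z. *)
Definition riemann g c (l i j k : 'I_n) (x : 'rV[R]_n) : R :=
  partial i (christoffel g c l j k) x - partial j (christoffel g c l i k) x
  + \sum_(m < n) (christoffel g c m j k x * christoffel g c l i m x
                  - christoffel g c m i k x * christoffel g c l j m x).

Definition velocity gamma t : tangent (gamma t) :=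
  derive1 (chart_map (chart_at (gamma t)) \o gamma) t.

(* The covariant derivative along [gamma], in the chart [c], of the vector field
   along [gamma] with components [Y] in [c]. *)
Definition covariant_derivative g c gamma (Y : R -> 'rV[R]_n) (t : R)
    : 'rV[R]_n :=
  let x := chart_map c \o gamma in
  derive1 Y t + \row_(k < n) \sum_(i < n) \sum_(j < n)
    christoffel g c k i j (x t) * derive1 x t 0 i * Y t 0 j.

Definition geodesic_on g (I : set R) gamma : Prop :=
  {in I, continuous gamma} /\
  forall c, atlas c ->
    let x := chart_map c \o gamma in
    let Ic := I `&` gamma @^-1` chart_dom c in
    smooth_on Ic x /\
    forall t, Ic t -> covariant_derivative g c gamma (derive1 x) t = 0.

Definition jacobi_field_on g (I : set R) gamma
    (J : forall t, tangent (gamma t)) : Prop :=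
  forall c, atlas c ->
    let x := chart_map c \o gamma in
    let Jc := fun t => components c (J t) in
    let Ic := I `&` gamma @^-1` chart_dom c in
    smooth_on Ic Jc /\
    forall t, Ic t ->
      covariant_derivative g c gamma (covariant_derivative g c gamma Jc) t
      + \row_(l < n) \sum_(i < n) \sum_(j < n) \sum_(k < n)
          riemann g c l i j k (x t)
            * Jc t 0 i * derive1 x t 0 j * derive1 x t 0 k = 0.

(* Objects on the closed interval [a, b] are smooth up to the endpoints, that
   is, they extend to an open interval; by the theory of ordinary differential
   equations the extensions below can be taken to satisfy the same equation. The
   values far away from [a, b] of the total functions involved are irrelevant. *)
Definition timelike_geodesic g a b gamma : Prop :=
  [/\ a < b,
      exists2 e, 0 < e & geodesic_on g `]a - e, b + e[ gamma &
      forall t, t \in `[a, b] ->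
        metric_form g (velocity gamma t) (velocity gamma t) < 0].

Definition conjugate_along g a b gamma : Prop :=
  exists J : forall t, tangent (gamma t),
    [/\ exists2 e, 0 < e & jacobi_field_on g `]a - e, b + e[ J,
        J a = 0, J b = 0 & exists2 t, t \in `[a, b] & J t != 0].

Definition arc_length g a b gamma : R :=
  \int[lebesgue_measure]_(t in `[a, b])
    Num.sqrt `|metric_form g (velocity gamma t) (velocity gamma t)|.

Definition timelike_geodesic_loop g a b gamma : Prop :=
  timelike_geodesic g a b gamma /\ gamma a = gamma b.

(* For a loop both velocities are expressed in the same chart, since
   [chart_at (gamma a) = chart_at (gamma b)]. *)
Definition closed_timelike_geodesic g a b gamma : Prop :=
  timelike_geodesic_loop g a b gamma /\
  exists2 k : R, 0 < k & velocity gamma a = k *: velocity gamma b.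

Definition self_conjugate g a b gamma : Prop := conjugate_along g a b gamma.

Definition initial_condition gamma : tangent_bundle :=
  existT tangent (gamma 0) (velocity gamma 0).

Definition locally_maximizing g gamma : Prop :=
  exists2 U, bundle_nbhs (initial_condition gamma) U &
    forall zeta, timelike_geodesic_loop g 0 1 zeta ->
      U (initial_condition zeta) ->
      arc_length g 0 1 zeta <= arc_length g 0 1 gamma.

Definition locally_minimizing g gamma : Prop :=
  exists2 U, bundle_nbhs (initial_condition gamma) U &
    forall zeta, timelike_geodesic_loop g 0 1 zeta ->
      U (initial_condition zeta) ->
      arc_length g 0 1 gamma <= arc_length g 0 1 zeta.

Definition locally_extremal g gamma : Prop :=
  locally_maximizing g gamma \/ locally_minimizing g gamma.

End LorentzianGeometry.

(* Main.v *)
(* In charts, geodesics are the integral curves of the spray, a vector field on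
   pairs (position, velocity), and Jacobi fields are the solutions of the
   linearized equation. Hence the time-one geodesic flow [E] is differentiable
   at the initial condition [(p, v0)] of [gamma], its differential being read
   off Jacobi fields. Non-self-conjugacy says that the positions of [E] have an
   invertible partial differential in the velocities, so for every tangent
   vector [w] at [p] there is, up to [o(s)], a family of loops with initial
   conditions [(p, v0) + s (w, v')]. A geodesic has constant energy, so its
   length is the square root of minus its initial energy, and extremality makes
   the energy critical in the direction [(w, v')]. Let [J] be the Jacobi field
   with these initial data; then [J 0 = J 1 = w]. The derivative of
   [g(gamma', J)] is half the variation of the energy along [J], which is
   constant, hence [0]. Therefore [g(gamma' 0, w) = g(gamma' 1, w)] for all [w],
   and [gamma' 0 = gamma' 1] since [g] is nondegenerate. *)
From HB Require Import structures.
From mathcomp Require Import all_boot all_order all_algebra.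
From mathcomp Require Import all_classical all_reals all_analysis.
From mathcomp Require Import perm ring lra.
Require Import Defs.

Set Implicit Arguments.
Unset Strict Implicit.
Unset Printing Implicit Defensive.

Import Order.TTheory GRing.Theory Num.Theory.
Import numFieldNormedType.Exports.
Local Open Scope classical_set_scope.
Local Open Scope ring_scope.

(** * Differentiability and smoothness between matrix spaces *)

Section MatrixNorm.
Variables (R : realType).

(** A geodesic segment may leave every single chart, so its flow is not globally a map between
    coordinate spaces. It is built one chart at a time and composed along [[0, 1]]. For this,
    geodesics and Jacobi fields are treated as germs in arbitrary charts, and the spray and its
    linearization are shown compatible with changes of chart. Completeness is not assumed: nearby
    geodesics are deviations from [gamma] solving an equation cut off outside a tube around it, and
    small initial deviations never feel the cutoff.

    The differentiability of the flow is strict and at one point: increments between any two points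
    near the initial condition are linear up to a small multiple of their distance. This two-point
    estimate is stable under composition and is exactly what turns the chord iteration into a
    contraction. The loops found in a direction [h] need not form a differentiable curve: for each
    small [s] of either sign there is one whose initial condition is within [e * |s|] of the
    first-order prediction, which already excludes a nonzero derivative of the energy. *)

Lemma mx_norm_leP m n (A : 'M[R]_(m, n)) e : 0 <= e ->
  (`|A| <= e) <-> (forall i j, `|A i j| <= e).
Proof.
move=> e0; rewrite /Num.Def.normr /= mx_normrE; split => [H i j|H].
  by apply: le_trans H; apply: (le_bigmax _ (fun ij => `|A ij.1 ij.2|) (i, j)).
by apply: bigmax_le => // -[i j] _; exact: H.
Qed.

Lemma ler_mx_norm m n (A : 'M[R]_(m, n)) i j : `|A i j| <= `|A|.
Proof. exact: (mx_norm_leP A (normr_ge0 A)).1. Qed.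

Lemma ler_norm_mulmx m n p (A : 'M[R]_(m, n)) (B : 'M[R]_(n, p)) :
  `|A *m B| <= n%:R * `|A| * `|B|.
Proof.
apply/mx_norm_leP => [|i k]; first by rewrite !mulr_ge0.
rewrite mxE (le_trans (ler_norm_sum _ _ _))//.
have -> : n%:R * `|A| * `|B| = \sum_(j < n) `|A| * `|B|.
  by rewrite sumr_const card_ord -[RHS]mulr_natl mulrA.
by apply: ler_sum => j _; rewrite normrM ler_pM// ler_mx_norm.
Qed.

End MatrixNorm.

(** * Directional derivatives of matrix-valued maps *)

Section Derivatives.
Variables (R : realType).
Implicit Types (V W : normedModType R).

Lemma is_derive_mxP V m n (M : V -> 'M[R]_(m, n)) dM t v :
  is_derive t v M dM <-> forall i j, is_derive t v (fun x => M x i j) (dM i j).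
Proof.
split=> [[dMt <-] i j|H].
  rewrite derive_mx// mxE; apply: derivableP.
  exact: (derivable_mxP _ _ _).1.
have D : derivable M t v by apply/derivable_mxP => i j; case: (H i j).
apply: DeriveDef => //; rewrite derive_mx//; apply/matrixP => i j.
by rewrite mxE; case: (H i j).
Qed.

Lemma is_derive_lineP V W (f : V -> W) (x v : V) df :
  is_derive x v f df <-> is_derive (0 : R) 1 (fun h => f (h *: v + x)) df.
Proof.
have E : 'D_v f x = 'D_1 (fun h : R => f (h *: v + x)) 0.
  rewrite /derive; set g1 := fun h => h^-1 *: _; set g2 := fun h => h^-1 *: _.
  suff -> : g1 = g2 by [].
  by apply/funext => h; rewrite /g1 /g2 /= addr0 scale0r add0r [_%:A]mulr1.
split=> -[d e].
  by split; [apply: (derivable1P f x v).1|rewrite -E].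
by split; [apply: (derivable1P f x v).2|rewrite E].
Qed.

(** Only derivability of [f] in the direction [v] is assumed. Restricted to the line, [f] depends on
    one real variable, where derivability is differentiability, and the usual chain rule applies. *)
Lemma is_derive_comp V W (X : normedModType R) (f : V -> W) (g : W -> X) x v df :
  is_derive x v f df -> differentiable g (f x) ->
  is_derive x v (g \o f) ('d g (f x) df).
Proof.
move=> /is_derive_lineP [df1 dfE] dg; apply/is_derive_lineP.
set h := fun h : R => f (h *: v + x) in df1 dfE *.
have h0 : h 0 = f x by rewrite /h scale0r add0r.
rewrite -h0 in dg *; have dh : differentiable h 0 by exact/derivable1_diffP.
rewrite -[X in is_derive _ _ X]/(g \o h).
split; first exact/derivable1_diffP/differentiable_comp.
rewrite deriveE; last exact: differentiable_comp.
by rewrite diff_comp//= -dfE deriveE.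
Qed.

Lemma is_derive_mulmx V m n p (A : V -> 'M[R]_(m, n)) (B : V -> 'M[R]_(n, p))
  x v dA dB : is_derive x v A dA -> is_derive x v B dB ->
  is_derive x v (fun y => A y *m B y) (dA *m B x + A x *m dB).
Proof.
move=> /is_derive_mxP hA /is_derive_mxP hB; apply/is_derive_mxP => i k.
have -> : (fun y => (A y *m B y) i k) =
    \sum_(j < n) (fun y => A y i j * B y j k).
  by apply/funext => y; rewrite mxE fct_sumE.
have -> : (dA *m B x + A x *m dB) i k =
    \sum_(j < n) (A x i j *: dB j k + B x j k *: dA i j).
  rewrite !mxE -big_split; apply: eq_bigr => j _ /=.
  by rewrite addrC /GRing.scale/= [dA i j * _]mulrC.
apply: is_derive_sum => j; exact: is_deriveM.
Qed.

Lemma is_derive_trmx V m n (A : V -> 'M[R]_(m, n)) x v dA :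
  is_derive x v A dA -> is_derive x v (fun y => (A y)^T) dA^T.
Proof.
move=> /is_derive_mxP h; apply/is_derive_mxP => i j; rewrite mxE.
by under eq_fun do rewrite mxE; exact: h.
Qed.

Lemma is_derive_row_mx V m n p (A : V -> 'M[R]_(m, n)) (B : V -> 'M[R]_(m, p))
  x v dA dB : is_derive x v A dA -> is_derive x v B dB ->
  is_derive x v (fun y => row_mx (A y) (B y)) (row_mx dA dB).
Proof.
move=> /is_derive_mxP hA /is_derive_mxP hB; apply/is_derive_mxP => i k.
rewrite mxE; under eq_fun do rewrite mxE.
by case: (fintype.split k) => j.
Qed.

Lemma is_derive_lsubmx V m n p (A : V -> 'M[R]_(m, n + p)) x v dA :
  is_derive x v A dA -> is_derive x v (fun y => lsubmx (A y)) (lsubmx dA).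
Proof.
move=> /is_derive_mxP h; apply/is_derive_mxP => i j; rewrite mxE.
by under eq_fun do rewrite mxE; exact: h.
Qed.

Lemma is_derive_rsubmx V m n p (A : V -> 'M[R]_(m, n + p)) x v dA :
  is_derive x v A dA -> is_derive x v (fun y => rsubmx (A y)) (rsubmx dA).
Proof.
move=> /is_derive_mxP h; apply/is_derive_mxP => i j; rewrite mxE.
by under eq_fun do rewrite mxE; exact: h.
Qed.

Lemma is_derive_ext V W (f g : V -> W) x v df :
  (\near x, f x = g x) -> is_derive x v f df -> is_derive x v g df.
Proof. exact: near_eq_is_derive. Qed.

Lemma is_derive_unique V W (f : V -> W) x v d1 d2 :
  is_derive x v f d1 -> is_derive x v f d2 -> d1 = d2.
Proof. by move=> [_ <-] [_ <-]. Qed.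

Lemma is_derive1_continuous W (f : R -> W) (x : R) df :
  is_derive x 1 f df -> {for x, continuous f}.
Proof. by move=> [d _]; apply/differentiable_continuous/derivable1_diffP. Qed.

Lemma continuous_mxP (T : topologicalType) m n (M : T -> 'M[R]_(m, n)) (t : T) :
  {for t, continuous M} <-> forall i j, {for t, continuous (fun x => M x i j)}.
Proof.
split=> [H i j|H].
  apply: (@continuous_comp _ _ _ M (fun A : 'M[R]_(m,n) => A i j)) => //.
  exact: coord_continuous.
apply/cvgrPdist_le => /= e e0.
have : \forall s \near t, forall i j, `|M t i j - M s i j| <= e.
  apply: filter_forall => i; apply: filter_forall => j.
  by move: (H i j) => /cvgrPdist_le; exact.
apply: filterS => s Hs; apply/mx_norm_leP; first exact: ltW.
by move=> i j; rewrite !mxE.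
Qed.

End Derivatives.

(* Completeness and the norm of matrices are declared separately in the library:
   this joins them into a [completeNormedModType]. *)
HB.instance Definition _ (R : realType) (m n : nat) :=
  Uniform_isComplete.Build 'M[R]_(m, n) cauchy_cvg.

(** * Maps of class C^k on open sets *)

Section Smoothness.
Variables (R : realType).
Implicit Types (V W : normedModType R) (k : nat).

Lemma near_normP V (x : V) (P : V -> Prop) :
  (\forall y \near x, P y) <-> exists2 d, 0 < d & forall y, `|y - x| < d -> P y.
Proof.
split=> [/nbhs_normP [d d0 H]|[d d0 H]]; first exists d => // y yx.
  by apply: H; rewrite /ball_ /= distrC.
by apply/nbhs_normP; exists d => // y; rewrite /ball_ /= distrC; exact: H.
Qed.

Lemma Ck_on_continuous V W k (A : set V) (f : V -> W) x :
  Ck_on k A f -> A x -> {for x, continuous f}.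
Proof. by case: k => [|k] [fc _] Ax; apply: fc; exact: mem_set. Qed.

Lemma Ck_on_derivable V W k (A : set V) (f : V -> W) x v :
  Ck_on k.+1 A f -> A x -> is_derive x v f ('D_v f x).
Proof. by move=> [_ /(_ v) [fd _]] Ax; apply/derivableP/fd/mem_set. Qed.

Lemma Ck_on_derive V W k (A : set V) (f : V -> W) v :
  Ck_on k.+1 A f -> Ck_on k A ('D_v f).
Proof. by move=> [_ /(_ v) []]. Qed.

Lemma Ck_onW V W k (A : set V) (f : V -> W) : Ck_on k.+1 A f -> Ck_on k A f.
Proof.
elim: k f => [|k IH] f; first by case.
move=> [fc fd]; split=> // v; have [d1 d2] := fd v; split => //; exact: IH.
Qed.

Lemma Ck_on_sub V W k (A B : set V) (f : V -> W) :
  A `<=` B -> Ck_on k B f -> Ck_on k A f.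
Proof.
move=> AB; elim: k f => [|k IH] f [fc fd]; split=> //.
- by move=> x /set_mem/AB Bx; apply: fc; exact: mem_set.
- by move=> x /set_mem/AB Bx; apply: fc; exact: mem_set.
- move=> v; have [d1 d2] := fd v; split; last exact: IH.
  by move=> x /set_mem/AB Bx; apply: d1; exact: mem_set.
Qed.

Lemma near_continuous (T U : topologicalType) (f g : T -> U) x :
  (\near x, f x = g x) -> {for x, continuous f} -> {for x, continuous g}.
Proof.
move=> fg fc; rewrite /prop_for /continuous_at -(nbhs_singleton fg).
by apply: cvg_trans fc; apply: near_eq_cvg; apply: filterS fg => y ->.
Qed.

Lemma Ck_on_ext V W k (A : set V) (f g : V -> W) : open A ->
  (forall x, A x -> f x = g x) -> Ck_on k A f -> Ck_on k A g.
Proof.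
move=> oA; elim: k f g => [|k IH] f g fg fk.
  split=> // x /set_mem Ax; apply: (@near_continuous _ _ f).
    by near=> y; apply: fg; near: y; exact: open_nbhs_nbhs.
  exact: Ck_on_continuous fk Ax.
have nfg x : A x -> \near x, f x = g x.
  by move=> Ax; near=> y; apply: fg; near: y; exact: open_nbhs_nbhs.
split=> [x /set_mem Ax|v].
  apply: (near_continuous (nfg x Ax)); exact: Ck_on_continuous fk Ax.
split=> [x /set_mem Ax|].
  apply: (near_eq_derivable (nfg x Ax)).
  by have [] := Ck_on_derivable v fk Ax.
apply: IH (Ck_on_derive v fk) => x Ax; exact: near_eq_derive (nfg x Ax).
Unshelve. all: by end_near. Qed.

(** The derivative may be given by any formula [df] valid on [A]: since [A] is open, equality on [A]
    is equality of germs and persists under further differentiation. *)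
Lemma Ck_onS V W k (A : set V) (f : V -> W) : open A ->
  (forall x, A x -> {for x, continuous f}) ->
  (forall v, exists2 df, forall x, A x -> is_derive x v f (df x) & Ck_on k A df) ->
  Ck_on k.+1 A f.
Proof.
move=> oA fc fd; split=> [x /set_mem|v]; first exact: fc.
have [df dfE dfC] := fd v; split=> [x /set_mem Ax|]; first by case: (dfE x Ax).
by apply: Ck_on_ext dfC => // x Ax; case: (dfE x Ax).
Qed.

Lemma Ck_on_cst V W k (A : set V) (c : W) : open A -> Ck_on k A (cst c : V -> W).
Proof.
move=> oA; elim: k c => [|k IH] c; first by split=> // x _; exact: cst_continuous.
apply: Ck_onS => //; first by move=> x _; exact: cst_continuous.
by move=> v; exists (cst 0) => // x _; exact: is_derive_cst.
Qed.

Lemma Ck_on_mxP V k m n (A : set V) (M : V -> 'M[R]_(m, n)) : open A ->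
  Ck_on k A M <-> forall i j, Ck_on k A (fun x => M x i j : R).
Proof.
move=> oA; elim: k M => [|k IH] M; split => [Mk i j|Mk].
- split=> // x /set_mem Ax.
  exact: ((continuous_mxP M x).1 (Ck_on_continuous Mk Ax)).
- split=> // x /set_mem Ax; apply/continuous_mxP => i j.
  exact: Ck_on_continuous (Mk i j) Ax.
- apply: Ck_onS => // [x Ax|v].
    exact: ((continuous_mxP M x).1 (Ck_on_continuous Mk Ax)).
  exists (fun x => 'D_v M x i j) => [x Ax|].
    exact: ((is_derive_mxP M _ x v).1 (Ck_on_derivable v Mk Ax)).
  exact: ((IH _).1 (Ck_on_derive v Mk)).
- apply: Ck_onS => // [x Ax|v].
    by apply/continuous_mxP => i j; exact: Ck_on_continuous (Mk i j) Ax.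
  exists (fun x => \matrix_(i, j) 'D_v (fun x => M x i j : R) x) => [x Ax|].
    by apply/is_derive_mxP => i j; rewrite mxE; exact: Ck_on_derivable (Mk i j) Ax.
  apply/IH => i j; apply: Ck_on_ext (Ck_on_derive v (Mk i j)) => // x _.
  by rewrite mxE.
Qed.

Lemma Ck_onD V W k (A : set V) (f g : V -> W) : open A ->
  Ck_on k A f -> Ck_on k A g -> Ck_on k A (f + g).
Proof.
move=> oA; elim: k f g => [|k IH] f g fk gk.
  split=> // x /set_mem Ax.
  by apply: continuousD; [exact: Ck_on_continuous fk Ax|exact: Ck_on_continuous gk Ax].
apply: Ck_onS => // [x Ax|v].
  by apply: continuousD; [exact: Ck_on_continuous fk Ax|exact: Ck_on_continuous gk Ax].
exists ('D_v f + 'D_v g); last by apply: IH; exact: Ck_on_derive.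
by move=> x Ax; apply: is_deriveD; apply: Ck_on_derivable; eassumption.
Qed.

Lemma Ck_onM V k (A : set V) (f g : V -> R) : open A ->
  Ck_on k A f -> Ck_on k A g -> Ck_on k A (f * g).
Proof.
move=> oA; elim: k f g => [|k IH] f g fk gk.
  split=> // x /set_mem Ax.
  by apply: continuousM; [exact: Ck_on_continuous fk Ax|exact: Ck_on_continuous gk Ax].
apply: Ck_onS => // [x Ax|v].
  by apply: continuousM; [exact: Ck_on_continuous fk Ax|exact: Ck_on_continuous gk Ax].
exists (f * 'D_v g + g * 'D_v f).
  by move=> x Ax; apply: is_deriveM; apply: Ck_on_derivable; eassumption.
by apply: Ck_onD => //; apply: IH => //; by [exact: Ck_onW|exact: Ck_on_derive].
Qed.

Lemma Ck_on_sum V W k (A : set V) (I : Type) (r : seq I) (P : pred I)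
    (F : I -> V -> W) : open A ->
  (forall i, P i -> Ck_on k A (F i)) -> Ck_on k A (\sum_(i <- r | P i) F i).
Proof.
move=> oA H; apply: (big_ind (@Ck_on _ _ _ k A)) => //; first exact: Ck_on_cst.
by move=> f g fk gk; exact: Ck_onD.
Qed.

Lemma Ck_on_prod V k (A : set V) (I : Type) (r : seq I) (P : pred I)
    (F : I -> V -> R) : open A ->
  (forall i, P i -> Ck_on k A (F i)) -> Ck_on k A (\prod_(i <- r | P i) F i).
Proof.
move=> oA H; apply: (big_ind (@Ck_on _ _ _ k A)) => //; first exact: Ck_on_cst.
by move=> f g fk gk; exact: Ck_onM.
Qed.

Lemma Ck_onV V k (A : set V) (f : V -> R) : open A ->
  (forall x, A x -> f x != 0) ->
  Ck_on k A f -> Ck_on k A (fun x => (f x)^-1).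
Proof.
move=> oA f0; elim: k f f0 => [|k IH] f f0 fk.
  split=> // x /set_mem Ax.
  by apply: continuousV; [exact: f0|exact: Ck_on_continuous fk Ax].
apply: Ck_onS => // [x Ax|v].
  by apply: continuousV; [exact: f0|exact: Ck_on_continuous fk Ax].
have fVk := IH f f0 (Ck_onW fk).
(* The derivative of [1/f] is [- f' / f^2], again a product in which [1/f] occurs, so the induction
   closes on [1/f] itself. *)
exists (cst (-1) * ((fun x => (f x)^-1) * (fun x => (f x)^-1)) * 'D_v f).
  move=> x Ax; have fd := Ck_on_derivable v fk Ax; split.
    by apply: derivableV; [exact: f0|case: fd].
  rewrite deriveV; [|exact: f0|by case: fd].
  by rewrite /GRing.scale /= /GRing.mul /= mulN1r -exprVn expr2.
apply: Ck_onM => //; last exact: Ck_on_derive.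
by apply: Ck_onM; [|exact: Ck_on_cst|exact: Ck_onM].
Qed.

Lemma Ck_on_mulmx V k m n p (A : set V) (M : V -> 'M[R]_(m, n))
    (N : V -> 'M[R]_(n, p)) : open A ->
  Ck_on k A M -> Ck_on k A N -> Ck_on k A (fun x => M x *m N x).
Proof.
move=> oA /Ck_on_mxP Mk /Ck_on_mxP Nk; apply/Ck_on_mxP => // i j.
apply: (@Ck_on_ext _ _ _ _ (\sum_l ((fun x => M x i l) * (fun x => N x l j)))) => //.
  by move=> x _; rewrite mxE fct_sumE.
by apply: Ck_on_sum => // l _; apply: Ck_onM => //; [exact: Mk|exact: Nk].
Qed.

Lemma Ck_on_det V k n (A : set V) (M : V -> 'M[R]_n) : open A ->
  Ck_on k A M -> Ck_on k A (fun x => \det (M x) : R).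
Proof.
move=> oA /Ck_on_mxP Mk.
pose F : V -> R :=
  \sum_(s : 'S_n) (cst ((-1) ^+ s) * \prod_i (fun x => M x i (s i))).
have E x : F x = \det (M x).
  rewrite /F fct_sumE; apply: eq_bigr => s _.
  by rewrite /GRing.mul /= /cst fct_prodE.
suff Fk : Ck_on k A F by apply: (Ck_on_ext oA) Fk => x _; exact: E.
apply: Ck_on_sum => // s _; apply: Ck_onM => //; first exact: Ck_on_cst.
by apply: Ck_on_prod => // i _; exact: Mk.
Qed.

(** Cramer's rule: the entries of the inverse are cofactors divided by the determinant. *)
Lemma Ck_on_invmx V k n (A : set V) (M : V -> 'M[R]_n) : open A ->
  (forall x, A x -> M x \in unitmx) ->
  Ck_on k A M -> Ck_on k A (fun x => invmx (M x)).
Proof.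
move=> oA Mu Mk; apply/Ck_on_mxP => // i j.
apply: (@Ck_on_ext _ _ _ _ ((fun x => (\det (M x))^-1) *
   (cst ((-1) ^+ (j + i)) * (fun x => \det (row' j (col' i (M x))))))) => //.
  by move=> x Ax; rewrite /invmx Mu// !mxE /cofactor.
apply: Ck_onM => //.
  apply: Ck_onV => //; last exact: Ck_on_det.
  by move=> x /Mu; rewrite unitmxE unitfE.
apply: Ck_onM => //; first exact: Ck_on_cst.
apply: Ck_on_det => //; apply/Ck_on_mxP => // a b.
apply: Ck_on_ext (((Ck_on_mxP _ _ oA).1 Mk) (lift j a) (lift i b)) => // x _.
by rewrite !mxE.
Qed.

End Smoothness.

(** * Linear approximation of C^1 maps, chain rule, symmetry of second derivatives *)

Section StrictDerivative.
Variables (R : realType).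
Implicit Types (V W : normedModType R).

Lemma near_forall (T : topologicalType) (I : finType) (P : I -> T -> Prop)
    (x : T) :
  (forall i, \forall y \near x, P i y) -> \forall y \near x, forall i, P i y.
Proof. exact: filter_forall. Qed.

Lemma is_derive_line V W (f : V -> W) (y v : V) (s : R) df :
  is_derive (s *: v + y) v f df ->
  is_derive s (1 : R) (fun s => f (s *: v + y)) df.
Proof.
move=> /is_derive_lineP h; apply/is_derive_lineP.
have -> // : (fun h : R => f ((h *: (1 : R) + s) *: v + y)) =
  fun h => f (h *: v + (s *: v + y)).
by apply/funext => a; rewrite addrA -scalerDl [a *: (1 : R)]mulr1.
Qed.

Lemma is_derive_dirZ V W (f : V -> W) (x v : V) (a : R) df :
  is_derive x v f df -> is_derive x (a *: v) f (a *: df).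
Proof.
move=> /is_derive_lineP h; apply/is_derive_lineP.
have -> : (fun h : R => f (h *: (a *: v) + x)) =
   (fun h => f (h *: v + x)) \o (fun h : R => h * a).
  by apply/funext => b /=; rewrite scalerA.
have D : is_derive (0 : R) (1 : R) (fun h : R => h * a) a.
  have := @is_deriveM _ _ (@id R) (cst a) (0 : R) (1 : R) 1 0 _ _.
  by move=> /(_ _ _)/is_derive_eq; apply; rewrite scaler0 add0r /= [_ *: _]mulr1.
have h' : is_derive (0 * a) (1 : R) (fun h : R => f (h *: v + x)) df.
  by rewrite mul0r.
have dh : differentiable (fun h : R => f (h *: v + x)) (0 * a).
  by apply/derivable1_diffP; case: h'.
have := is_derive_comp D dh.
have -> // : 'd (fun h : R => f (h *: v + x)) (0 * a) a = a *: df.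
rewrite -[X in 'd _ _ X = _]mulr1 [LHS]linearZ -deriveE//; congr (_ *: _).
by case: h'.
Qed.

Lemma line_MVT V (f : V -> R) (y v : V) (df : V -> R) :
  (forall s : R, 0 <= s <= 1 -> is_derive (s *: v + y) v f (df (s *: v + y))) ->
  exists2 s : R, 0 <= s <= 1 & f (v + y) - f y = df (s *: v + y).
Proof.
move=> H; pose phi (s : R) := f (s *: v + y).
have D (s : R) : 0 <= s <= 1 -> is_derive s (1 : R) phi (df (s *: v + y)).
  by move=> /H /is_derive_line.
have [||s sI E] := @MVT_segment R phi (fun s => df (s *: v + y)) 0 1 ler01.
- by move=> s; rewrite in_itv /= => /andP[s0 s1]; apply: D; rewrite !ltW.
- by apply: derivable_within_continuous => s; rewrite in_itv /= => /D [].
exists s; first by rewrite in_itv in sI.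
by move: E; rewrite /phi scale1r scale0r add0r subr0 mulr1.
Qed.

(** The points [w] and [u] are joined by a staircase [p] that changes one coordinate at a time. On
    each step the mean value theorem brings in one partial derivative, close to its value at [x] by
    continuity. The staircase stays in the ball around [x] because balls of the sup norm are
    cubes. *)
Lemma C1_strict_scalar m (B : set 'rV[R]_m) (f : 'rV[R]_m -> R) x (e : R) :
  open B -> Ck_on 1 B f -> B x -> 0 < e ->
  exists2 d : R, 0 < d & forall u w : 'rV[R]_m, `|u - x| < d -> `|w - x| < d ->
    `|f u - f w - \sum_(i < m) (u - w) 0 i *: 'D_(delta_mx 0 i) f x|
      <= e * `|u - w|.
Proof.
(* There are [m] steps, each with an error of at most [e' * |u - w|]; the successor keeps the
   denominator nonzero when [m = 0]. *)
move=> oB fC Bx e0; pose e' := e / m.+1%:R.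
have e'0 : 0 < e' by rewrite divr_gt0.
have [d d0 Hd] : exists2 d : R, 0 < d & forall y : 'rV[R]_m, `|y - x| < d -> B y /\
    forall i : 'I_m, `|'D_(delta_mx 0 i) f x - 'D_(delta_mx 0 i) f y| <= e'.
  have near_le : \forall y \near x, forall i : 'I_m,
      `|'D_(delta_mx 0 i) f x - 'D_(delta_mx 0 i) f y| <= e'.
    apply: near_forall => i.
    have := Ck_on_continuous (Ck_on_derive (delta_mx 0 i) fC) Bx.
    by move=> /cvgrPdist_le; exact.
  by apply/near_normP; apply: filterI near_le; exact: open_nbhs_nbhs.
exists d => // u w ux wx.
pose p k : 'rV[R]_m := \row_j (if (j < k)%N then u 0 j else w 0 j).
have p0 : p 0%N = w by apply/rowP => j; rewrite mxE.
have pm : p m = u by apply/rowP => j; rewrite mxE ltn_ord.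
have pS (i : 'I_m) : p i.+1 = (u - w) 0 i *: delta_mx 0 i + p i.
  apply/rowP => j; rewrite !mxE eqxx /= ltnS leq_eqVlt.
  have [-> |ji] := eqVneq j i; first by rewrite eqxx ltnn /= mulr1 subrK.
  by rewrite (negbTE (ji : (j : nat) != i)) mulr0 add0r.
have pB (i : 'I_m) (s : R) : 0 <= s <= 1 ->
    `|s *: ((u - w) 0 i *: delta_mx 0 i) + p i - x| < d.
  move=> s01; apply: (@le_lt_trans _ _ (Num.max `|u - x| `|w - x|)); last first.
    by rewrite gt_max ux.
  apply/mx_norm_leP => [|a j]; first by rewrite le_max normr_ge0.
  rewrite (ord1 a) !mxE eqxx /=.
  have uj : `|u 0 j - x 0 j| <= `|u - x|.
    by have := ler_mx_norm (u - x) 0 j; rewrite !mxE.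
  have wj : `|w 0 j - x 0 j| <= `|w - x|.
    by have := ler_mx_norm (w - x) 0 j; rewrite !mxE.
  have [ji|ji] := eqVneq j i; last first.
    by rewrite !mulr0 add0r; case: ifP => _; rewrite le_max ?uj ?wj ?orbT.
  rewrite {j}ji in uj wj *; rewrite ltnn mulr1.
  have -> : s * (u 0 i - w 0 i) + w 0 i - x 0 i =
    s * (u 0 i - x 0 i) + (1 - s) * (w 0 i - x 0 i) by ring.
  case/andP: s01 => s0 s1.
  apply: (le_trans (ler_normD _ _)).
  rewrite !normrM (ger0_norm s0) (ger0_norm (_ : 0 <= 1 - s)) ?subr_ge0//.
  set M := Num.max _ _.
  have uM : `|u 0 i - x 0 i| <= M by rewrite le_max uj.
  have wM : `|w 0 i - x 0 i| <= M by rewrite le_max wj orbT.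
  nra.
have -> : f u - f w = \sum_(i < m) (f (p i.+1) - f (p i)).
  rewrite -(big_mkord xpredT (fun i => f (p i.+1) - f (p i))).
  by rewrite telescope_sumr// p0 pm.
rewrite -sumrB (le_trans (ler_norm_sum _ _ _))//.
apply: (@le_trans _ _ (\sum_(i < m) e' * `|u - w|)); last first.
  rewrite sumr_const card_ord -mulr_natl mulrA ler_wpM2r//.
  rewrite /e' mulrCA ger_pMr// ler_pdivrMr// mul1r ler_nat; exact: leqnSn.
apply: ler_sum => i _.
have [s s01 E] := @line_MVT _ f (p i) ((u - w) 0 i *: delta_mx 0 i)
  (fun y => (u - w) 0 i *: 'D_(delta_mx 0 i) f y)
  (fun s s01 => is_derive_dirZ _ (Ck_on_derivable _ fC (Hd _ (pB i s s01)).1)).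
rewrite pS E -scalerBr normrZ mulrC.
apply: ler_pM => //; last exact: ler_mx_norm.
by rewrite distrC; have [_] := Hd _ (pB i s s01); exact.
Qed.

(** Each condition holds for all small enough positive radii by monotonicity, and finitely many such
    conditions hold together near [0] on the right. *)
Lemma common_radius (I : finType) (P : I -> R -> Prop) :
  (forall i (d d' : R), 0 < d' <= d -> P i d -> P i d') ->
  (forall i, exists2 d : R, 0 < d & P i d) ->
  exists2 d : R, 0 < d & forall i, P i d.
Proof.
move=> mono H.
have H1 : \forall d \near 0^'+, forall i, P i d.
  apply: filter_forall => i; have [d d0 Pd] := H i; near=> e.
  apply: (mono _ d) => //; apply/andP; split; near: e.
    exact: nbhs_right_gt.
  exact: nbhs_right_le.
near (0 : R)^'+ => d; exists d; near: d.
  exact: nbhs_right_gt.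
exact: H1.
Unshelve. all: by end_near. Qed.

Lemma C1_strict m p q (B : set 'rV[R]_m) (f : 'rV[R]_m -> 'M[R]_(p, q)) x (e : R) :
  open B -> Ck_on 1 B f -> B x -> 0 < e ->
  exists2 d : R, 0 < d & forall u w : 'rV[R]_m, `|u - x| < d -> `|w - x| < d ->
    `|f u - f w - \sum_(i < m) (u - w) 0 i *: 'D_(delta_mx 0 i) f x|
      <= e * `|u - w|.
Proof.
move=> oB fC Bx e0.
have [|ij|d d0 H] := @common_radius _ (fun (ij : 'I_p * 'I_q) d =>
    forall u w : 'rV[R]_m, `|u - x| < d -> `|w - x| < d ->
    `|f u ij.1 ij.2 - f w ij.1 ij.2 - \sum_(i < m) (u - w) 0 i *:
      'D_(delta_mx 0 i) (fun y => f y ij.1 ij.2 : R) x| <= e * `|u - w|).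
- move=> ij d d' /andP[_ dd'] H u w ux wx.
  by apply: H; [exact: lt_le_trans dd'|exact: lt_le_trans dd'].
- by apply: (C1_strict_scalar oB) => //; exact: ((Ck_on_mxP _ _ oB).1 fC).
exists d => // u w ux wx; apply/mx_norm_leP => [|i j].
  by rewrite mulr_ge0// ltW.
apply: le_trans (H (i, j) u w ux wx) => /=.
rewrite !mxE summxE le_eqVlt; apply/orP; left; apply/eqP.
congr (`|_ - _|); apply: eq_bigr => l _; rewrite mxE; congr (_ * _).
rewrite derive_mx ?mxE//.
by have [] := Ck_on_derivable (delta_mx 0 l) fC Bx.
Qed.

Lemma diff_of_bound V W (f : V -> W) (L : {linear V -> W}) x : continuous L ->
  (forall e : R, 0 < e -> exists2 d : R, 0 < d & forall h, `|h| < d ->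
    `|f (h + x) - f x - L h| <= e * `|h|) ->
  differentiable f x.
Proof.
move=> Lc H.
have E : f \o shift x = cst (f x) + L +o_ 0 id.
  apply/eqaddoP => e e0; have [d d0 {}H] := H e e0.
  apply/near_normP; exists d => // h; rewrite subr0 => hd /=.
  by have := H h hd; rewrite /= opprD addrA.
by apply/diff_locallyP; rewrite (diff_unique Lc E).
Qed.

(** [Ck_on] speaks of directional derivatives only; their continuity upgrades them to a total
    differential, the linear map [L] assembled from the partial derivatives. *)
Lemma C1_diff m p q (B : set 'rV[R]_m) (f : 'rV[R]_m -> 'M[R]_(p, q)) x :
  open B -> Ck_on 1 B f -> B x -> differentiable f x.
Proof.
move=> oB fC Bx.
pose L (h : 'rV[R]_m) := \sum_(i < m) h 0 i *: 'D_(delta_mx 0 i) f x.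
have L_lin : linear L.
  move=> a u v; rewrite /L scaler_sumr -big_split; apply: eq_bigr => i _ /=.
  by rewrite !mxE scalerA scalerDl.
pose LM := GRing.isLinear.Build _ _ _ _ _ L_lin.
pose LL : {linear _ -> _} := HB.pack L LM.
have Lc : continuous LL.
  move=> y; apply/continuous_mxP => i j; rewrite /= /L.
  have -> : (fun h : 'rV[R]_m =>
     (\sum_(l < m) h 0 l *: 'D_(delta_mx 0 l) f x) i j) =
     \sum_(l < m) (fun h : 'rV[R]_m => h 0 l * 'D_(delta_mx 0 l) f x i j).
    apply/funext => h; rewrite fct_sumE summxE.
    by apply: eq_bigr => l _; rewrite mxE.
  apply: (@Ck_on_continuous _ _ _ 0 setT) => //.
  apply: Ck_on_sum; first exact: openT.
  move=> l _; apply: Ck_onM; first exact: openT.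
    by split=> // z _; exact: coord_continuous.
  by apply: Ck_on_cst; exact: openT.
apply: (diff_of_bound Lc) => e e0.
have [d d0 H] := C1_strict oB fC Bx e0.
exists d => // h hd; have := H (h + x) x; rewrite addrK subrr normr0.
exact.
Qed.

Lemma C1_chain V m p q (B : set 'rV[R]_m) (g : 'rV[R]_m -> 'M[R]_(p, q))
    (f : V -> 'rV[R]_m) x v df :
  open B -> Ck_on 1 B g -> B (f x) -> is_derive x v f df ->
  is_derive x v (g \o f) ('D_df g (f x)).
Proof.
move=> oB gC Bx fd; have gd := C1_diff oB gC Bx.
by rewrite deriveE//; exact: is_derive_comp.
Qed.

Lemma Ck_on_comp V k m p q (A : set V) (B : set 'rV[R]_m)
    (g : 'rV[R]_m -> 'M[R]_(p, q)) (f : V -> 'rV[R]_m) :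
  open A -> open B -> (forall x, A x -> B (f x)) ->
  Ck_on k A f -> Ck_on k B g -> Ck_on k A (g \o f).
Proof.
move=> oA oB AB; elim: k p q g => [|k IH] p q g fC gC.
  split=> // x /set_mem Ax; apply: continuous_comp.
    exact: Ck_on_continuous fC Ax.
  exact: Ck_on_continuous gC (AB x Ax).
have g1 : Ck_on 1 B g.
  by elim: {IH fC} k gC => // k IH /Ck_onW/IH.
apply: Ck_onS; first exact: oA.
  move=> x Ax; apply: continuous_comp; first exact: Ck_on_continuous fC Ax.
  exact: Ck_on_continuous gC (AB x Ax).
(* The derivative of the composite is a sum of products of derivatives of [f] with composites of
   first derivatives of [g]; to the latter the induction hypothesis applies, which is why it
   quantifies over [g]. *)
move=> v; exists (\sum_(i < m) (fun x => 'D_v f x 0 i *: 'D_(delta_mx 0 i) g (f x))).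
  move=> x Ax; have := C1_chain oB g1 (AB x Ax) (Ck_on_derivable v fC Ax).
  rewrite deriveE; last exact: C1_diff g1 (AB x Ax).
  rewrite {1}(row_sum_delta ('D_v f x)) linear_sum fct_sumE.
  move=> /is_derive_eq; apply; apply: eq_bigr => i _.
  rewrite [X in _ = _ *: X]deriveE; last exact: (C1_diff oB g1 (AB x Ax)).
  exact: linearZ.
apply: Ck_on_sum => // i _; apply/Ck_on_mxP => // a b.
have Dg := IH _ _ _ (Ck_onW fC) (Ck_on_derive (delta_mx 0 i) gC).
apply: (@Ck_on_ext _ _ _ _ _ ((fun x => 'D_v f x 0 i) *
   (fun x => 'D_(delta_mx 0 i) g (f x) a b))) => //.
  by move=> x _; rewrite mxE.
apply: Ck_onM => //; last exact: ((Ck_on_mxP _ _ oA).1 Dg).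
exact: ((Ck_on_mxP _ _ oA).1 (Ck_on_derive v fC)).
Qed.

Lemma near_corner V (x u v : V) (P : V -> Prop) : (\forall y \near x, P y) ->
  exists2 d : R, 0 < d & forall s t : R, 0 <= s <= d -> 0 <= t <= d ->
    P (s *: u + (t *: v + x)).
Proof.
move=> /near_normP [r r0 H].
have n0 : 0 < `|u| + `|v| + 1 by rewrite ltr_wpDl// addr_ge0.
exists (r / (`|u| + `|v| + 1)); first by rewrite divr_gt0.
move=> s t /andP[s0 sd] /andP[t0 td]; apply: H.
rewrite addrA addrK (le_lt_trans (ler_normD _ _))// !normrZ !ger0_norm//.
apply: (@le_lt_trans _ _ (r / (`|u| + `|v| + 1) * (`|u| + `|v|))).
  by rewrite mulrDr lerD// ler_wpM2r.
by rewrite mulrAC ltr_pdivrMr// ltr_pM2l// ltrDl.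
Qed.

(** Two successive uses of the mean value theorem, first along [u] on the increment [phi] in the
    direction [v], then along [v]. *)
Lemma second_difference V (A : set V) (f : V -> R) u v x (t : R) :
  open A -> Ck_on 2 A f -> 0 < t ->
  (forall s r : R, 0 <= s <= t -> 0 <= r <= t -> A (s *: u + (r *: v + x))) ->
  exists sr : R * R, [/\ 0 <= sr.1 <= t, 0 <= sr.2 <= t &
    f (t *: u + (t *: v + x)) - f (t *: v + x) - (f (t *: u + x) - f x) =
    t ^+ 2 * 'D_v ('D_u f) (sr.1 *: u + (sr.2 *: v + x))].
Proof.
move=> oA fC t0 HA.
have inI s : 0 <= s <= 1 -> 0 <= s * t <= t.
  by move=> /andP[s0 s1]; rewrite mulr_ge0 ?ger_pMl// ltW.
have tI : 0 <= t <= t by rewrite lexx ltW.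
have zI : 0 <= (0 : R) <= t by rewrite lexx ltW.
have fC1 := Ck_onW fC.
pose phi y := f (t *: v + y) - f y.
have [s sI E1] : exists2 s : R, 0 <= s <= 1 & phi (t *: u + x) - phi x =
    t *: ('D_u f (t *: v + (s *: (t *: u) + x)) - 'D_u f (s *: (t *: u) + x)).
  apply: (@line_MVT _ phi x (t *: u)
    (fun y => t *: ('D_u f (t *: v + y) - 'D_u f y))) => s sI.
  apply: is_derive_dirZ; apply: is_deriveB.
    have := HA _ _ (inI s sI) tI; rewrite addrCA -scalerA => /(Ck_on_derivable u fC1).
    move=> /is_derive_lineP h; apply/is_derive_lineP.
    by under eq_fun do rewrite addrCA.
  apply: (Ck_on_derivable _ fC1).
  by have := HA _ _ (inI s sI) zI; rewrite scale0r add0r -scalerA.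
have [r rI E2] : exists2 r : R, 0 <= r <= 1 &
    'D_u f (t *: v + (s *: (t *: u) + x)) - 'D_u f (s *: (t *: u) + x) =
    t *: 'D_v ('D_u f) (r *: (t *: v) + (s *: (t *: u) + x)).
  apply: (@line_MVT _ ('D_u f) (s *: (t *: u) + x) (t *: v)
    (fun y => t *: 'D_v ('D_u f) y)) => r rI.
  apply: is_derive_dirZ; apply: (Ck_on_derivable _ (Ck_on_derive u fC)).
  by have := HA _ _ (inI s sI) (inI r rI); rewrite addrCA -!scalerA.
have gen (p q w : R) : p = t * q -> q = t * w -> p = t ^+ 2 * w.
  by move=> -> ->; rewrite mulrA.
exists (s * t, r * t); split; [exact: inI|exact: inI|].
have -> : (s * t, r * t).1 *: u + ((s * t, r * t).2 *: v + x) =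
  r *: (t *: v) + (s *: (t *: u) + x) by rewrite /= addrCA !scalerA.
have -> : t *: u + (t *: v + x) = t *: v + (t *: u + x) by exact: addrCA.
have gen2 (a b c d : R) : a - b - (c - d) = a - c - (b - d) by ring.
rewrite -(gen _ _ _ E1 E2) /phi; exact: gen2.
Qed.

Lemma dist_half (a b c e : R) :
  `|a - c| <= e / 2 -> `|b - c| <= e / 2 -> `|a - b| <= e.
Proof.
move=> ac bc; rewrite -(subrKA c) (splitr e) (le_trans (ler_normD _ _))//.
by rewrite lerD// distrC.
Qed.

(** The second difference is symmetric in [u] and [v], so the two mixed derivatives coincide at two
    points of an arbitrarily small corner at [x]; continuity moves both points to [x]. *)
Lemma Schwarz_scalar V (A : set V) (f : V -> R) u v x :
  open A -> Ck_on 2 A f -> A x -> 'D_u ('D_v f) x = 'D_v ('D_u f) x.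
Proof.
move=> oA fC Ax.
apply/subr0_eq/normr0_eq0/le_anti; rewrite normr_ge0 andbT.
apply/ler_addgt0Pr => e e0; rewrite add0r.
have c1 := Ck_on_continuous (Ck_on_derive u (Ck_on_derive v fC)) Ax.
have c2 := Ck_on_continuous (Ck_on_derive v (Ck_on_derive u fC)) Ax.
have e2 : 0 < e / 2 by rewrite divr_gt0.
have n1 : \forall y \near x, A y /\
    (`|'D_u ('D_v f) x - 'D_u ('D_v f) y| <= e / 2 /\
     `|'D_v ('D_u f) x - 'D_v ('D_u f) y| <= e / 2).
  apply: filterI; first exact: open_nbhs_nbhs.
  by apply: filterI; [move/cvgrPdist_le : c1|move/cvgrPdist_le : c2]; exact.
have [d d0 Hd] := near_corner u v n1.
have [|[s r] [sI rI E1]] := second_difference oA fC d0 (u := u) (v := v) (x := x).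
  by move=> s r sI rI; have [] := Hd s r sI rI.
have [|[s' r'] [sI' rI' E2]] := second_difference oA fC d0 (u := v) (v := u) (x := x).
  by move=> s' r' sI' rI'; have [] := Hd r' s' rI' sI'; rewrite addrCA.
rewrite /= in sI rI E1 sI' rI' E2.
have Ep : s' *: v + (r' *: u + x) = r' *: u + (s' *: v + x) by exact: addrCA.
have E0 : d *: v + (d *: u + x) = d *: u + (d *: v + x) by exact: addrCA.
rewrite Ep E0 in E2.
have E : 'D_v ('D_u f) (s *: u + (r *: v + x)) =
         'D_u ('D_v f) (r' *: u + (s' *: v + x)).
  have d2 : d ^+ 2 != 0 by rewrite expf_neq0// gt_eqF.
  have gen (k a b p q w z : R) : k != 0 -> p - q - (w - z) = k * a ->
      p - w - (q - z) = k * b -> a = b.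
    by move=> k0 Ea Eb; apply: (mulfI k0); rewrite -Ea -Eb; ring.
  exact: gen d2 E1 E2.
have [_ [_ H2]] := Hd s r sI rI.
have [_ [H1 _]] := Hd r' s' rI' sI'.
by apply: dist_half H1 _; rewrite -E.
Qed.

End StrictDerivative.

(** * Jacobian matrices and strict differentiability at a point *)

Section StrictDifferentiability.
Variables (R : realType).
Implicit Types (V W : normedModType R).

Lemma Schwarz V m n (A : set V) (f : V -> 'M[R]_(m, n)) u v x :
  open A -> Ck_on 2 A f -> A x -> 'D_u ('D_v f) x = 'D_v ('D_u f) x.
Proof.
move=> oA fC Ax; apply/matrixP => i j.
have fij := (Ck_on_mxP _ _ oA).1 fC i j.
have H a b : ('D_a ('D_b f) x) i j = 'D_a ('D_b (fun y => f y i j : R)) x.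
  have D := Ck_on_derivable a (Ck_on_derive b fC) Ax.
  have := (is_derive_mxP _ _ _ _).1 D i j.
  have nE : \near x, ('D_b f x) i j = 'D_b (fun y => f y i j : R) x.
    near=> y; have Ay : A y by near: y; exact: open_nbhs_nbhs.
    rewrite derive_mx ?mxE//.
    by have [] := Ck_on_derivable b (Ck_onW fC) Ay.
  by move=> /(is_derive_ext nE) [_ <-].
apply: (etrans (H u v)); apply: (etrans _ (esym (H v u))).
exact: (@Schwarz_scalar _ V A (fun y => f y i j) u v x oA fij Ax).
Unshelve. all: by end_near. Qed.

Lemma Ck_on_id V k (A : set V) : open A -> Ck_on k A (id : V -> V).
Proof.
move=> oA; case: k => [|k]; first by split=> // x _.
apply: Ck_onS => // [x _|v]; first by [].
by exists (cst v); [move=> x _; exact: is_derive_id|exact: Ck_on_cst].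
Qed.

Lemma Ck_on_le V W k l (A : set V) (f : V -> W) : (l <= k)%N ->
  Ck_on k A f -> Ck_on l A f.
Proof.
by elim: k => [|k IH]; rewrite leq_eqVlt ?ltnS => /orP[/eqP->|lk]// /Ck_onW; exact: IH.
Qed.

Lemma Ck_on_row_mx V k m n p (A : set V) (M : V -> 'M[R]_(m, n))
    (N : V -> 'M[R]_(m, p)) : open A ->
  Ck_on k A M -> Ck_on k A N -> Ck_on k A (fun x => row_mx (M x) (N x)).
Proof.
move=> oA /Ck_on_mxP Mk /Ck_on_mxP Nk; apply/Ck_on_mxP => // i j.
have [l|l] := fintype.splitP j => jE.
  have -> : j = lshift p l by apply/val_inj.
  by apply: Ck_on_ext (Mk oA i l) => // x _; rewrite row_mxEl.
have -> : j = rshift n l by apply/val_inj.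
by apply: Ck_on_ext (Nk oA i l) => // x _; rewrite row_mxEr.
Qed.

Lemma Ck_on_lsubmx V k m n p (A : set V) (M : V -> 'M[R]_(m, n + p)) : open A ->
  Ck_on k A M -> Ck_on k A (fun x => lsubmx (M x)).
Proof.
move=> oA /Ck_on_mxP Mk; apply/Ck_on_mxP => // i j.
by apply: Ck_on_ext (Mk oA i (lshift p j)) => // x _; rewrite mxE.
Qed.

Lemma Ck_on_rsubmx V k m n p (A : set V) (M : V -> 'M[R]_(m, n + p)) : open A ->
  Ck_on k A M -> Ck_on k A (fun x => rsubmx (M x)).
Proof.
move=> oA /Ck_on_mxP Mk; apply/Ck_on_mxP => // i j.
by apply: Ck_on_ext (Mk oA i (rshift n j)) => // x _; rewrite mxE.
Qed.

Lemma Ck_on_trmx V k m n (A : set V) (M : V -> 'M[R]_(m, n)) : open A ->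
  Ck_on k A M -> Ck_on k A (fun x => (M x)^T).
Proof.
move=> oA /Ck_on_mxP Mk; apply/Ck_on_mxP => // i j.
by apply: Ck_on_ext (Mk oA j i) => // x _; rewrite mxE.
Qed.

Lemma C1_deriveE m p (B : set 'rV[R]_m) (f : 'rV[R]_m -> 'rV[R]_p) x v :
  open B -> Ck_on 1 B f -> B x -> 'D_v f x = v *m 'J f x.
Proof. by move=> oB fC Bx; apply: deriveEjacobian; exact: C1_diff fC Bx. Qed.

Lemma jacobian_entry m p (B : set 'rV[R]_m) (f : 'rV[R]_m -> 'rV[R]_p) x i j :
  open B -> Ck_on 1 B f -> B x -> 'J f x i j = ('D_(delta_mx 0 i) f x) 0 j.
Proof. move=> oB fC Bx; rewrite (C1_deriveE _ oB fC Bx) -rowE.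
by rewrite [RHS]mxE. Qed.

Lemma Ck_on_jacobian k m p (B : set 'rV[R]_m) (f : 'rV[R]_m -> 'rV[R]_p) :
  open B -> Ck_on k.+1 B f -> Ck_on k B (jacobian f).
Proof.
move=> oB fC; have f1 : Ck_on 1 B f by apply: Ck_on_le fC.
apply/Ck_on_mxP => // i j.
apply: Ck_on_ext ((Ck_on_mxP _ _ oB).1 (Ck_on_derive (delta_mx 0 i) fC) 0 j) => //.
by move=> x Bx; rewrite (jacobian_entry _ _ oB f1).
Qed.

(** Schwarz's theorem in matrix form: both sides are second directional derivatives of [f] along [u]
    and [v]. *)
Lemma derive_jacobianC m p (B : set 'rV[R]_m) (f : 'rV[R]_m -> 'rV[R]_p) x u v :
  open B -> Ck_on 2 B f -> B x ->
  u *m 'D_v (jacobian f) x = v *m 'D_u (jacobian f) x.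
Proof.
move=> oB fC Bx.
have H a b : a *m 'D_b (jacobian f) x = 'D_b ('D_a f) x.
  have D := Ck_on_derivable b (Ck_on_jacobian oB fC) Bx.
  have := is_derive_mulmx (is_derive_cst a x b) D.
  rewrite mul0mx add0r.
  have nE : \near x, a *m 'J f x = 'D_a f x.
    near=> y; have By : B y by near: y; exact: open_nbhs_nbhs.
    by rewrite (C1_deriveE _ oB (Ck_onW fC) By).
  by move=> /(is_derive_ext nE) [_ <-].
by rewrite !H; exact: Schwarz oB fC Bx.
Unshelve. all: by end_near. Qed.

(** Strict differentiability: both [u] and [w] vary, unlike in the ordinary differential where one
    of them is [x]. It makes [f] Lipschitz near [x]. Matrices act on row vectors from the right, so
    differentials compose from left to right. *)
Definition strict_diff m p (f : 'rV[R]_m -> 'rV[R]_p) (x : 'rV[R]_m)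
    (L : 'M[R]_(m, p)) : Prop :=
  forall e : R, 0 < e -> exists2 d : R, 0 < d & forall u w : 'rV[R]_m,
    `|u - x| < d -> `|w - x| < d ->
    `|f u - f w - (u - w) *m L| <= e * `|u - w|.

Lemma C1_strict_diff m p (B : set 'rV[R]_m) (f : 'rV[R]_m -> 'rV[R]_p) x :
  open B -> Ck_on 1 B f -> B x -> strict_diff f x ('J f x).
Proof.
move=> oB fC Bx e e0; have [d d0 H] := C1_strict oB fC Bx e0.
exists d => // u w ux wx; have := H u w ux wx.
have -> // : \sum_(i < m) (u - w) 0 i *: 'D_(delta_mx 0 i) f x = (u - w) *m 'J f x.
rewrite [in RHS](row_sum_delta (u - w)) mulmx_suml; apply: eq_bigr => i _.
by rewrite -scalemxAl (C1_deriveE _ oB fC Bx).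
Qed.

Lemma strict_diff_lipschitz m p (f : 'rV[R]_m -> 'rV[R]_p) x L :
  strict_diff f x L -> exists d c : R, [/\ 0 < d, 0 < c &
    forall u w : 'rV[R]_m, `|u - x| < d -> `|w - x| < d ->
    `|f u - f w| <= c * `|u - w|].
Proof.
move=> /(_ 1 ltr01) [d d0 H]; have c0 : 0 < 1 + m%:R * `|L| by rewrite ltr_pwDl// mulr_ge0.
exists d, (1 + m%:R * `|L|); split=> //.
move=> u w ux wx; have := H u w ux wx; rewrite mul1r => H1.
rewrite -(subrK ((u - w) *m L) (f u - f w)) (le_trans (ler_normD _ _))//.
by rewrite mulrDl mul1r lerD// (le_trans (ler_norm_mulmx _ _))// mulrAC.
Qed.

Lemma strict_diff_comp m p q (f : 'rV[R]_m -> 'rV[R]_p)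
    (g : 'rV[R]_p -> 'rV[R]_q) x L K :
  strict_diff f x L -> strict_diff g (f x) K -> strict_diff (g \o f) x (L *m K).
Proof.
move=> fL gK e e0.
have e2 : 0 < e / 2 by rewrite divr_gt0.
have [d [c [d0 c0 Hf]]] := strict_diff_lipschitz fL.
have [d1 d10 Hg] := gK (e / 2 / c) (divr_gt0 e2 c0).
have n0 : 0 < p%:R * `|K| + 1 by rewrite ltr_wpDl// mulr_ge0.
have [d2 d20 Hf2] := fL (e / 2 / (p%:R * `|K| + 1)) (divr_gt0 e2 n0).
exists (Num.min d (Num.min d2 (d1 / c))) => [|u w].
  by rewrite !lt_min d0 d20 divr_gt0.
rewrite !lt_min => /and3P[ud ud2 ud1] /and3P[wd wd2 wd1].
have fd y : `|y - x| < d -> `|y - x| < d1 / c -> `|f y - f x| < d1.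
  move=> yd yd1; apply: le_lt_trans (Hf y x yd _) _; first by rewrite subrr normr0.
  by rewrite mulrC -ltr_pdivlMr.
have H1 := Hg _ _ (fd u ud ud1) (fd w wd wd1).
have H2 := Hf2 u w ud2 wd2.
have -> : (g \o f) u - (g \o f) w - (u - w) *m (L *m K) =
  (g (f u) - g (f w) - (f u - f w) *m K) + (f u - f w - (u - w) *m L) *m K.
  by rewrite /= mulmxA [(f u - f w - _) *m K]mulmxBl subrKA.
rewrite (splitr e) mulrDl (le_trans (ler_normD _ _))// lerD//.
  apply: (le_trans H1); rewrite -mulrA ler_wpM2l ?(ltW e2)//.
  by rewrite ler_pdivrMl// Hf.
apply: (le_trans (ler_norm_mulmx _ _)).
apply: (@le_trans _ _ ((p%:R * `|K| + 1) * (e / 2 / (p%:R * `|K| + 1) * `|u - w|))).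
  rewrite [leLHS]mulrAC; apply: ler_pM => //; rewrite ?mulr_ge0//.
  by rewrite lerDl.
by rewrite mulrA [X in X * _]mulrC divfK ?gt_eqF.
Qed.

End StrictDifferentiability.

(** * Ordinary differential equations *)

Section MeanValue.
Variables (R : realType).

(** For the sup norm it suffices to treat one coordinate [f_j]: the functions [h - f_j] and
    [h + f_j] have nonnegative derivatives, hence are nondecreasing. *)
Lemma mean_value_ineq m (f df : R -> 'rV[R]_m) (h dh : R -> R) (a b : R) : a <= b ->
  (forall t, a <= t <= b -> is_derive t (1 : R) f (df t)) ->
  (forall t, a <= t <= b -> is_derive t (1 : R) h (dh t)) ->
  (forall t, a <= t <= b -> `|df t| <= dh t) ->
  `|f b - f a| <= h b - h a.
Proof.
move=> ab fd hd dfh.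
have scalar (g dg : R -> R) : (forall t, a <= t <= b -> is_derive t (1 : R) g (dg t)) ->
    (forall t, a <= t <= b -> 0 <= dg t) -> g a <= g b.
  move=> gd dg0.
  have [||c] := @MVT_segment R g dg a b ab.
  - by move=> t; rewrite in_itv /= => /andP[at_ tb]; apply: gd; rewrite !ltW.
  - by apply: derivable_within_continuous => t; rewrite in_itv /= => /gd [].
  rewrite in_itv /= => /dg0 c0 E; rewrite -subr_ge0 E mulr_ge0// subr_ge0//.
have h0 : 0 <= h b - h a.
  rewrite subr_ge0; apply: (scalar _ _ hd) => t tab.
  exact: le_trans (normr_ge0 _) (dfh t tab).
apply/mx_norm_leP => // i j; rewrite (ord1 i) !mxE.
have fdj t : a <= t <= b -> is_derive t (1 : R) (fun s => f s 0 j : R) (df t 0 j).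
  by move=> /fd /is_derive_mxP; exact.
have dfj t : a <= t <= b -> `|df t 0 j| <= dh t.
  by move=> /dfh; apply: le_trans; exact: ler_mx_norm.
have key (p q r s : R) : r - q <= s - p -> r + q <= s + p -> `|p - q| <= s - r.
  by move=> H1 H2; rewrite ler_norml; lra.
have := scalar (h - (fun s => f s 0 j : R)) (fun t => dh t - df t 0 j).
move=> /(_ (fun t tab => is_deriveB (hd t tab) (fdj t tab))) H1.
have := scalar (h + (fun s => f s 0 j : R)) (fun t => dh t + df t 0 j).
move=> /(_ (fun t tab => is_deriveD (hd t tab) (fdj t tab))) H2.
apply: key.
  apply: H1 => t tab; rewrite subr_ge0 (le_trans _ (dfj t tab))//.
  exact: ler_norm.
apply: H2 => t tab; rewrite -lerBlDr sub0r (le_trans _ (dfj t tab))//.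
by rewrite -normrN ler_norm.
Qed.

Lemma is_derive_expR_comp (c l a t : R) :
  is_derive t (1 : R) (fun s => c * expR (l * (s - a))) (c * l * expR (l * (t - a))).
Proof.
have lin : is_derive t (1 : R) (fun s : R => l * (s - a)) l.
  have -> : (fun s : R => l * (s - a)) = (cst l : R -> R) * (id - cst a) by [].
  apply: is_derive_eq; rewrite /= /cst scaler0 addr0 subr0 /GRing.scale /=.
  by rewrite mulr1.
have de : derivable (expR : R -> R) (l * (t - a)) 1 by [].
have -> : (fun s => c * expR (l * (s - a))) = (cst c : R -> R) * (expR \o (fun s : R => l * (s - a))).
  by [].
have comp : is_derive t (1 : R) (expR \o (fun s : R => l * (s - a)))
    (l * expR (l * (t - a))).
  rewrite mulrC; exact: (@is_derive1_comp R expR _ t _ _ (is_derive_expR _) lin).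
apply: is_derive_eq; rewrite /= /cst scaler0 addr0 /GRing.scale /=.
by rewrite mulrA.
Qed.

(** The bound is integrated against an exponential weight centred at [a]. The weight is not
    differentiable at [a], so the two sides of [a] are treated separately. Dividing by [l] is the
    gain on which the later contraction arguments rest. *)
Lemma exp_mean_value m (f df : R -> 'rV[R]_m) (al be a c l t : R) :
  0 < l -> al <= a <= be -> al <= t <= be ->
  (forall s, al <= s <= be -> is_derive s (1 : R) f (df s)) ->
  (forall s, al <= s <= be -> `|df s| <= c * expR (l * `|s - a|)) ->
  `|f t - f a| <= c / l * expR (l * `|t - a|).
Proof.
move=> l0 /andP[ala abe] /andP[alt tbe] fd dfb.
have l00 : l != 0 by rewrite gt_eqF.
have c0 : 0 <= c.
  have := dfb a; rewrite ala abe subrr normr0 mulr0 expR0 mulr1.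
  by move=> /(_ isT); exact: le_trans.
have cl0 : 0 <= c / l by rewrite divr_ge0// ltW.
have [at_|/ltW ta] := leP a t.
  have H := @mean_value_ineq _ f df (fun s => c / l * expR (l * (s - a)))
    (fun s => c / l * l * expR (l * (s - a))) a t at_.
  rewrite ger0_norm ?subr_ge0//.
  apply: le_trans (H _ _ _) _ => [s /andP[as_ st]|s _|s /andP[as_ st]|].
  - by apply: fd; rewrite (le_trans ala as_) (le_trans st tbe).
  - exact: is_derive_expR_comp.
  - rewrite divfK//; have := dfb s.
    by rewrite (le_trans ala as_) (le_trans st tbe) ger0_norm ?subr_ge0// => /(_ isT).
  by rewrite lerBlDr lerDl mulr_ge0// expR_ge0.
have H := @mean_value_ineq _ f df (fun s => - (c / l) * expR (- l * (s - a)))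
    (fun s => - (c / l) * (- l) * expR (- l * (s - a))) t a ta.
rewrite distrC ler0_norm ?subr_le0//.
apply: le_trans (H _ _ _) _ => [s /andP[ts sa]|s _|s /andP[ts sa]|].
- by apply: fd; rewrite (le_trans alt ts) (le_trans sa abe).
- exact: is_derive_expR_comp.
- rewrite mulrNN divfK//; have := dfb s.
  rewrite (le_trans alt ts) (le_trans sa abe) ler0_norm ?subr_le0// => /(_ isT).
  by rewrite mulrN mulNr.
have -> : l * - (t - a) = - l * (t - a) by ring.
by rewrite subrr mulr0 expR0 mulr1 [X in _ - X]mulNr opprK gerDr oppr_le0.
Qed.

(** Let [N] be the maximum of [(|u| + eta / l) / E] over the interval. The weight [E] grows at the
    rate [2 * l], so integrating the hypothesis returns only half of [N], which is absorbed on the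
    left; this is the origin of both factors [2] in the conclusion. The time [t] may lie on either
    side of [a]. *)
Lemma gronwall m (u du : R -> 'rV[R]_m) (al be a l eta t : R) :
  0 < l -> 0 <= eta -> al <= a <= be -> al <= t <= be ->
  (forall s, al <= s <= be -> is_derive s (1 : R) u (du s)) ->
  (forall s, al <= s <= be -> `|du s| <= l * `|u s| + eta) ->
  `|u t| <= 2 * (`|u a| + eta / l) * expR (2 * l * `|t - a|).
Proof.
move=> l0 eta0 aI tI ud dub.
have albe : al <= be by case/andP: aI; exact: le_trans.
have L0 : 0 < 2 * l by rewrite mulr_gt0.
pose E s := expR (2 * l * `|s - a|).
have E1 s : 1 <= E s by rewrite /E -[leLHS]expR0 ler_expR mulr_ge0 ?(ltW L0).
have E0 s : 0 < E s by rewrite /E expR_gt0.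
pose psi (s : R) : R := (`|u s| + eta / l) / E s.
have [|s0 s0I sup] := @EVT_max R psi al be albe.
  apply: continuous_in_subspaceT => s /set_mem /=; rewrite in_itv /= => sI.
  apply: cvgM.
    apply: cvgD; last exact: cvg_cst.
    by apply: cvg_norm; exact: is_derive1_continuous (ud s sI).
  apply: cvgV; first by rewrite gt_eqF.
  apply: (@cvg_comp _ _ _ (fun s => 2 * l * `|s - a|) expR); last first.
    exact: continuous_expR.
  apply: cvgM; first exact: cvg_cst.
  by apply: cvg_norm; apply: cvgB; [exact: cvg_id|exact: cvg_cst].
set N := psi s0 in sup.
rewrite in_itv /= in s0I.
have uN s : al <= s <= be -> `|u s| + eta / l <= N * E s.
  by move=> sI; rewrite -ler_pdivrMr//; apply: sup; rewrite in_itv.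
have eq : l * (eta / l) = eta by rewrite mulrC divfK// gt_eqF.
have step s : al <= s <= be -> `|u s - u a| <= l * N / (2 * l) * E s.
  move=> sI; apply: (exp_mean_value L0 aI sI ud) => r rI.
  apply: (le_trans (dub r rI)); rewrite -[leLHS]/(_ + eta) -eq -mulrDr -mulrA.
  by rewrite ler_wpM2l ?uN// ltW.
have eq2 : l * N / (2 * l) = N / 2.
  by rewrite invfM mulrA mulrAC [l * N]mulrC mulfK ?gt_eqF// mulrC.
have NE : N * E s0 = `|u s0| + eta / l by rewrite /N /psi divfK// gt_eqF.
have N2 : N <= 2 * (`|u a| + eta / l).
  have Hs := step s0 s0I; rewrite eq2 in Hs.
  have Hu : `|u s0| <= `|u a| + N / 2 * E s0.
    by rewrite -(subrK (u a) (u s0)) (le_trans (ler_normD _ _))// addrC lerD2l.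
  have : N * E s0 <= 2 * (`|u a| + eta / l) by lra.
  apply: le_trans; rewrite ler_peMr// /N /psi divr_ge0 ?(ltW (E0 _))//.
  by rewrite addr_ge0// divr_ge0// ltW.
apply: le_trans (_ : N * E t <= _); last by rewrite ler_wpM2r// ltW.
by apply: le_trans (uN t tI); rewrite lerDl divr_ge0// ltW.
Qed.

End MeanValue.

(** * Primitives and global solutions of Lipschitz equations *)

Section Picard.
Variables (R : realType).

Lemma near_RP (x : R) (P : R -> Prop) :
  (\forall y \near x, P y) <-> exists2 d : R, 0 < d & forall y : R, `|y - x| < d -> P y.
Proof. exact: (@near_normP R R x P). Qed.

Lemma near_dist (t d : R) : 0 < d -> \forall s \near t, `|s - t| < d.
Proof. by move=> d0; apply/near_RP; exists d. Qed.

Lemma primitive_scalar (f : R -> R) : continuous f ->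
  exists P : R -> R, forall t, is_derive t (1 : R) P (f t).
Proof.
move=> fc.
(* Integration starts at [- N] so that the fundamental theorem applies at every [t] in between.
   Normalizing at [0] makes the values for different [N] agree, their difference having zero
   derivative; hence a cutoff depending on [t] gives a single primitive. *)
pose Q (N t : R) : R := \int[lebesgue_measure]_(s in `[(- N), t]) f s -
  \int[lebesgue_measure]_(s in `[(- N), 0]) f s.
have Qd (N t : R) : - N < t < N -> is_derive t (1 : R) (Q N) (f t).
  move=> /andP[Nt tN].
  have fi : lebesgue_measure.-integrable `[(- N), N] (EFin \o f).
    apply: continuous_compact_integrable; first exact: segment_compact.
    exact: continuous_subspaceT.
  have [d dE] := continuous_FTC1_closed tN fi Nt (fc t).
  rewrite -[f t]subr0; apply: is_deriveB; split; first exact: d.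
  by rewrite -derive1E dE.
have Q0 N : Q N 0 = 0 by rewrite /Q subrr.
have uniq (N N' t : R) : - N < t < N -> N <= N' -> Q N t = Q N' t.
  move=> tN NN'.
  have N0 : 0 < N by case/andP: tN => h1 h2; lra.
  pose D (s : R) : 'rV[R]_1 := const_mx (Q N s - Q N' s).
  have H : `|D t - D 0| <= 0 / 1 * expR (1 * `|t - 0|).
    apply: (@exp_mean_value _ _ D (fun=> 0) (Num.min t 0) (Num.max t 0)) => //.
    - by rewrite ge_min lexx orbT le_max lexx orbT.
    - by rewrite ge_min lexx le_max lexx.
    - move=> s; rewrite ge_min le_max => /andP[s1 s2].
      have sN : - N < s < N.
        case/andP: tN => n1 n2; apply/andP; split.
          by case/orP: s1; [exact: lt_le_trans n1|apply: lt_le_trans; rewrite oppr_lt0].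
        by case/orP: s2 => h; [exact: le_lt_trans n2|exact: le_lt_trans N0].
      have sN' : - N' < s < N'.
        case/andP: sN => n1 n2; rewrite (lt_le_trans n2 NN') andbT.
        by apply: le_lt_trans n1; rewrite lerN2.
      apply/is_derive_mxP => i j; rewrite mxE.
      under eq_fun do rewrite mxE.
      by have := is_deriveB (Qd N s sN) (Qd N' s sN'); rewrite subrr.
    - by move=> s _; rewrite normr0 mul0r.
  rewrite !mul0r in H; have := le_trans (ler_mx_norm (D t - D 0) 0 0) H.
  rewrite !mxE !Q0 subrr subr0 normr_le0 subr_eq0 => /eqP; exact.
exists (fun t => Q (`|t| + 1) t) => t.
have t1 : `|t| < `|t| + 1 by rewrite ltrDl.
have t2 : - (`|t| + 2) < t < `|t| + 2.
  by rewrite -ltr_norml (lt_le_trans t1)// lerD2l ler1n.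
apply: is_derive_ext (Qd _ t t2).
near=> s; apply/esym/uniq.
  by rewrite -ltr_norml ltrDl.
have : `|s - t| <= 1.
  by apply/ltW; near: s; exact: near_dist.
have : `|s| <= `|t| + `|s - t|.
  by rewrite -{1}(subrK t s) (le_trans (ler_normD _ _))// addrC.
by lra.
Unshelve. all: by end_near. Qed.

Lemma primitive m (f : R -> 'rV[R]_m) (a : R) (c : 'rV[R]_m) : continuous f ->
  exists P : R -> 'rV[R]_m, P a = c /\ forall t, is_derive t (1 : R) P (f t).
Proof.
move=> fc.
have H (j : 'I_m) : exists P : R -> R, forall t, is_derive t (1 : R) P (f t 0 j).
  by apply: primitive_scalar => t; exact: ((continuous_mxP f t).1 (fc t)).
pose P t : 'rV[R]_m := \row_j (projT1 (cid (H j)) t - projT1 (cid (H j)) a + c 0 j).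
exists P; split; first by apply/rowP => j; rewrite mxE subrr add0r.
move=> t; apply/is_derive_mxP => i j; rewrite (ord1 i).
under eq_fun do rewrite mxE.
case: (cid (H j)) => Q Qd /=.
have -> : (fun x => Q x - Q a + c 0 j) = Q - cst (Q a) + cst (c 0 j) by [].
rewrite -[f t 0 j]addr0 -[f t 0 j]subr0.
by apply: is_deriveD; apply: is_deriveB; exact: Qd.
Qed.

Lemma half_pow_small (c e : R) : 0 < e -> exists k : nat, c * 2^-1 ^+ k <= e.
Proof.
move=> e0.
have h1 : `|2^-1 : R| < 1 by rewrite ger0_norm// invf_lt1// ltr1n.
have /cvgrPdist_le /(_ e e0) [N _ H] := cvg_geometric c h1.
exists N; have := H N (leqnn N); rewrite /= sub0r normrN.
exact: le_trans (ler_norm _).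
Qed.

Lemma geometric_limit m (x : nat -> 'rV[R]_m) (C : R) : 0 <= C ->
  (forall k, `|x k.+1 - x k| <= C * 2^-1 ^+ k) ->
  exists y, forall k, `|y - x k| <= 2 * C * 2^-1 ^+ k.
Proof.
move=> C0 H.
have h1 : `|2^-1 : R| < 1 by rewrite ger0_norm// invf_lt1// ltr1n.
have cv : cvgn x.
  have -> : x = (fun n => x 0%N + series (telescope x) n).
    by apply/funext => n; rewrite -eq_sum_telescope.
  apply: is_cvgD; first exact: is_cvg_cst.
  apply: normed_cvg; apply: (@series_le_cvg R _ (geometric C 2^-1)).
  - by move=> n; exact: normr_ge0.
  - by move=> n; rewrite /= mulr_ge0.
  - exact: H.
  - exact: is_cvg_geometric_series.
exists (limn x) => k.
have bound n : `|x (k + n)%N - x k| <= 2 * C * 2^-1 ^+ k - 2 * C * 2^-1 ^+ (k + n).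
  elim: n => [|n IH]; first by rewrite addn0 !subrr normr0.
  rewrite addnS -(subrKA (x (k + n)%N)) (le_trans (ler_normD _ _))//.
  have := H (k + n)%N; rewrite exprS; lra.
apply/ler_addgt0Pr => e e0.
have /cvgrPdist_le /(_ e e0) [N _ HN] := cv.
have := HN (k + N)%N (leq_addl k N) => H1.
rewrite -(subrKA (x (k + N)%N)) (le_trans (ler_normD _ _))// addrC lerD//.
apply: le_trans (bound N) _.
by rewrite gerBl mulr_ge0// mulr_ge0.
Qed.

(** Picard iteration measured with the weight [E] of rate [2 * l]: one integration halves the
    distance between iterates, so they converge at every time without cutting the line into short
    intervals. The bound [B] controls the first step. *)
Lemma picard m (G : R -> 'rV[R]_m -> 'rV[R]_m) (l B a : R) (w0 : 'rV[R]_m) :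
  0 < l ->
  (forall w : R -> 'rV[R]_m, continuous w -> continuous (fun t => G t (w t))) ->
  (forall t u w, `|G t u - G t w| <= l * `|u - w|) ->
  (forall t, `|G t w0| <= B) ->
  exists w : R -> 'rV[R]_m, w a = w0 /\ forall t, is_derive t (1 : R) w (G t (w t)).
Proof.
move=> l0 Gc Gl GB.
have B0 : 0 <= B by exact: le_trans (normr_ge0 _) (GB 0).
have L0 : 0 < 2 * l by rewrite mulr_gt0.
have C0 : 0 <= B / (2 * l) by rewrite divr_ge0// ltW.
(* A primitive is chosen for every [f], with an arbitrary value when [f] is not continuous, so that
   the iteration [W] can be defined before its continuity is proved. *)
have prE (f : R -> 'rV[R]_m) : exists P : R -> 'rV[R]_m, continuous f ->
    P a = w0 /\ forall t, is_derive t (1 : R) P (f t).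
  have [fc|nfc] := pselect (continuous f); last by exists 0.
  by have [P HP] := primitive a w0 fc; exists P.
pose pr f := projT1 (cid (prE f)).
have prP f : continuous f -> pr f a = w0 /\ forall t, is_derive t (1 : R) (pr f) (f t).
  by rewrite /pr; case: (cid (prE f)).
pose W := fix W k : R -> 'rV[R]_m := if k is k'.+1 then pr (fun t => G t (W k' t)) else cst w0.
have Wc k : continuous (W k).
  elim: k => [|k IH] t; first exact: cst_continuous.
  by apply: is_derive1_continuous; exact: ((prP _ (Gc _ IH)).2 t).
have Wa k : W k a = w0 by case: k => [//|k]; exact: ((prP _ (Gc _ (Wc k))).1).
have Wd k t : is_derive t (1 : R) (W k.+1) (G t (W k t)).
  exact: ((prP _ (Gc _ (Wc k))).2 t).
pose E t := expR (2 * l * `|t - a|).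
have E0 t : 0 < E t by rewrite /E expR_gt0.
have E1 s : 1 <= E s by rewrite /E -[leLHS]expR0 ler_expR mulr_ge0 ?(ltW L0).
have integ (f df : R -> 'rV[R]_m) (c t : R) : (forall s, is_derive s (1 : R) f (df s)) ->
    (forall s, `|df s| <= c * E s) -> `|f t - f a| <= c / (2 * l) * E t.
  move=> fd fb; apply: (@exp_mean_value _ _ f df (Num.min t a) (Num.max t a)) => //.
  - by rewrite ge_min lexx orbT le_max lexx orbT.
  - by rewrite ge_min lexx le_max lexx.
have integ2 (f g df dg : R -> 'rV[R]_m) (c t : R) : f a = g a ->
    (forall s, is_derive s (1 : R) f (df s)) -> (forall s, is_derive s (1 : R) g (dg s)) ->
    (forall s, `|df s - dg s| <= c * E s) -> `|f t - g t| <= c / (2 * l) * E t.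
  move=> fga fd gd fgb.
  have := @integ (fun s => f s - g s) (fun s => df s - dg s) c t.
  rewrite fga subrr subr0; apply => // s; exact: is_deriveB.
have lhalf c : l * c / (2 * l) = c / 2.
  by rewrite invfM mulrA mulrAC [l * c]mulrC mulfK ?gt_eqF// mulrC.
have step k t : `|W k.+1 t - W k t| <= B / (2 * l) * E t * 2^-1 ^+ k.
  elim: k t => [|k IH] t.
    rewrite expr0 mulr1 -[W 0 t](Wa 1%N).
    apply: integ (Wd 0%N) _ => s.
    by apply: (le_trans (GB s)); rewrite ler_peMr.
  have := @integ2 (W k.+2) (W k.+1) _ _ (l * (B / (2 * l) * 2^-1 ^+ k)) t _ (Wd k.+1) (Wd k).
  rewrite lhalf exprS.
  have -> : B / (2 * l) * 2^-1 ^+ k / 2 * E t = B / (2 * l) * E t * (2^-1 * 2^-1 ^+ k).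
    by ring.
  apply; first by rewrite !Wa.
  move=> s; apply: (le_trans (Gl _ _ _)).
  by rewrite -[X in _ <= X]mulrA ler_wpM2l ?(ltW l0)// mulrAC; exact: IH.
have lim_ex t : exists y, forall k, `|y - W k t| <= 2 * (B / (2 * l) * E t) * 2^-1 ^+ k.
  by apply: geometric_limit => [|k]; [rewrite mulr_ge0// ltW|exact: step].
pose w t := projT1 (cid (lim_ex t)).
have wP t k : `|w t - W k t| <= 2 * (B / (2 * l) * E t) * 2^-1 ^+ k.
  by rewrite /w; case: (cid (lim_ex t)).
have wc : continuous w.
  move=> t; apply/cvgrPdist_le => e e0.
  pose K := 2 * (B / (2 * l) * expR (2 * l * (`|t - a| + 1))).
  have EK s : `|s - t| <= 1 -> 2 * (B / (2 * l) * E s) <= K.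
    move=> st; rewrite ler_wpM2l// ler_wpM2l// ler_expR ler_wpM2l ?(ltW L0)//.
    rewrite -(subrKA t) (le_trans (ler_normD _ _))// addrC lerD2l//.
  have e3 : 0 < e / 3 by rewrite divr_gt0.
  have [k Kk] := half_pow_small K e3.
  have /cvgrPdist_le /(_ _ e3) := Wc k t; move=> Wk.
  near=> s.
  have s1 : `|s - t| <= 1.
    by apply/ltW; near: s; exact: near_dist.
  have b1 : `|w t - W k t| <= e / 3.
    apply: le_trans (wP t k) (le_trans _ Kk); rewrite ler_wpM2r//.
    by apply: EK; rewrite subrr normr0.
  have b2 : `|w s - W k s| <= e / 3.
    by apply: le_trans (wP s k) (le_trans _ Kk); rewrite ler_wpM2r//; exact: EK.
  have b3 : `|W k t - W k s| <= e / 3 by near: s.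
  rewrite -(subrKA (W k t)) -(subrKA (W k s) (W k t)).
  rewrite (le_trans (ler_normD _ _))//; rewrite distrC in b2.
  have := ler_normD (W k t - W k s) (W k s - w s); lra.
have [Wia Wid] := prP _ (Gc _ wc).
(* The limit must be the primitive of its own right-hand side. That primitive and [w] are both
   within a multiple of [2^-1 ^+ k] of [W k.+1]. *)
suff wE : pr (fun t => G t (w t)) = w by rewrite wE in Wia Wid; exists w.
apply/funext => t; apply/subr0_eq/normr0_eq0/le_anti; rewrite normr_ge0 andbT.
apply/ler_addgt0Pr => e e0; rewrite add0r.
have [k Hk] := half_pow_small (2 * (B / (2 * l) * E t)) e0.
apply: le_trans Hk.
have H := @integ2 (pr (fun t => G t (w t))) (W k.+1) _ _
  (l * (2 * (B / (2 * l)) * 2^-1 ^+ k)) t _ Wid (Wd k).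
rewrite lhalf in H.
rewrite -(subrKA (W k.+1 t)) (le_trans (ler_normD _ _))//.
have := wP t k.+1; rewrite exprS distrC => H1.
apply: le_trans (lerD (H _ _) H1) _; [by rewrite Wa Wia| |by lra].
move=> s; apply: (le_trans (Gl _ _ _)).
by rewrite -[X in _ <= X]mulrA ler_wpM2l ?(ltW l0)// mulrAC -[2 * _ * _]mulrA; exact: wP.
Unshelve. all: by end_near. Qed.

End Picard.

(** * Regularity and uniqueness of solutions, cutoffs, uniform estimates along a curve *)

Section ODE.
Variables (R : realType).

Lemma continuous_dist (T : topologicalType) (V : normedModType R) (f : T -> V)
    (t : T) (d : R) : {for t, continuous f} -> 0 < d ->
  \forall s \near t, `|f s - f t| < d.
Proof.
move=> /cvgrPdist_lt fc d0.
by have := fc d d0; rewrite near_simpl; apply: filterS => s; rewrite distrC.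
Qed.

Lemma dist_continuous (T : topologicalType) (V : normedModType R) (f : T -> V)
    (t : T) : (forall d : R, 0 < d -> \forall s \near t, `|f s - f t| < d) ->
  {for t, continuous f}.
Proof.
move=> H; apply/cvgrPdist_lt => d d0; rewrite near_simpl.
by apply: filterS (H d d0) => s; rewrite distrC.
Qed.

(** An equation expresses [dw] through [w], so each degree of regularity of [w] passes to its
    derivative and yields one more. *)
Lemma bootstrap m (A : set R) (w dw : R -> 'rV[R]_m) : open A ->
  (forall t, A t -> is_derive t (1 : R) w (dw t)) ->
  (forall k, Ck_on k A w -> Ck_on k A dw) -> smooth_on A w.
Proof.
move=> oA wd H; elim=> [|k IH].
  by split=> // t /set_mem At; exact: is_derive1_continuous (wd t At).
apply: Ck_onS => // [t At|v]; first exact: is_derive1_continuous (wd t At).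
exists (fun t => v *: dw t) => [t At|].
  by have := is_derive_dirZ v (wd t At); rewrite [v *: (1 : R)]mulr1.
have dwk := (Ck_on_mxP _ _ oA).1 (H k IH).
apply/Ck_on_mxP => // i j.
apply: (@Ck_on_ext R R R k A ((cst v : R -> R) * (fun t => dw t i j))) => //.
  by move=> t _; rewrite mxE.
by apply: Ck_onM => //; exact: Ck_on_cst.
Qed.

Lemma near_unique_lipschitz m (w1 w2 d1 d2 : R -> 'rV[R]_m) (c t0 : R) :
  0 < c -> w1 t0 = w2 t0 ->
  (\forall t \near t0, is_derive t (1 : R) w1 (d1 t)) ->
  (\forall t \near t0, is_derive t (1 : R) w2 (d2 t)) ->
  (\forall t \near t0, `|d1 t - d2 t| <= c * `|w1 t - w2 t|) ->
  \forall t \near t0, w1 t = w2 t.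
Proof.
move=> c0 E n1 n2 n3.
have [d d0 H] := (near_RP _ _).1 (filterI n1 (filterI n2 n3)).
apply/near_RP; exists d => // t td.
have sd s : Num.min t0 t <= s <= Num.max t0 t -> `|s - t0| < d.
  rewrite ge_min le_max => /andP[/orP s1 /orP s2]; apply: le_lt_trans td.
  have N1 := ler_norm (t - t0).
  have N2 := ler_norm (t0 - t); rewrite distrC in N2.
  by case: s1; case: s2 => h1 h2; rewrite ler_norml; lra.
have := @gronwall R m (fun s => w1 s - w2 s) (fun s => d1 s - d2 s)
   (Num.min t0 t) (Num.max t0 t) t0 c 0 t c0 (lexx _).
rewrite E subrr normr0 mul0r addr0 mulr0 mul0r normr_le0 subr_eq0.
have I1 : Num.min t0 t <= t0 <= Num.max t0 t by rewrite ge_min lexx le_max lexx.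
have I2 : Num.min t0 t <= t <= Num.max t0 t by rewrite ge_min lexx orbT le_max lexx orbT.
move=> /(_ I1 I2) K; apply/eqP; apply: K => s /sd /H [h1 [h2 h3]].
  exact: is_deriveB.
by rewrite addr0.
Qed.

Lemma ode_unique m (O : set 'rV[R]_m) (F : 'rV[R]_m -> 'rV[R]_m)
    (z1 z2 : R -> 'rV[R]_m) (t0 : R) :
  open O -> Ck_on 1 O F -> O (z1 t0) -> z1 t0 = z2 t0 ->
  (\forall t \near t0, is_derive t (1 : R) z1 (F (z1 t))) ->
  (\forall t \near t0, is_derive t (1 : R) z2 (F (z2 t))) ->
  \forall t \near t0, z1 t = z2 t.
Proof.
move=> oO FC Oz E n1 n2.
have [d [c [d0 c0 H]]] := strict_diff_lipschitz (C1_strict_diff oO FC Oz).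
apply: (near_unique_lipschitz c0 E n1 n2).
have nd (z : R -> 'rV[R]_m) : z t0 = z1 t0 ->
    (\forall t \near t0, is_derive t (1 : R) z (F (z t))) ->
    \forall t \near t0, `|z t - z1 t0| < d.
  move=> zE /nbhs_singleton /is_derive1_continuous zc; rewrite -zE.
  exact: continuous_dist zc d0.
by apply: filterS2 (nd z1 erefl n1) (nd z2 (esym E) n2) => t h1 h2; exact: H.
Qed.

(** The nearest-point retraction onto [[a, b]], for [a <= b]. Being 1-Lipschitz, it extends fields
    known only near a compact piece of curve to all times and all positions without increasing
    Lipschitz constants. *)
Definition clamp (a b x : R) : R := Num.max a (Num.min x b).

Lemma clamp_id a b x : a <= x <= b -> clamp a b x = x.
Proof. by move=> /andP[ax xb]; rewrite /clamp (min_idPl _)// (max_idPr _). Qed.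

Lemma clamp_itv a b x : a <= b -> a <= clamp a b x <= b.
Proof. by move=> ab; rewrite /clamp le_max lexx/= ge_max ab/= ge_min lexx orbT. Qed.

Lemma clamp_lip a b x y : `|clamp a b x - clamp a b y| <= `|x - y|.
Proof.
rewrite /clamp.
have maxl (u v : R) : `|Num.max a u - Num.max a v| <= `|u - v|.
  have N1 := ler_norm (u - v); have N2 := ler_norm (v - u); rewrite distrC in N2.
  by case: (leP a u) => h1; case: (leP a v) => h2; rewrite ler_norml; lra.
have minl (u v : R) : `|Num.min u b - Num.min v b| <= `|u - v|.
  have N1 := ler_norm (u - v); have N2 := ler_norm (v - u); rewrite distrC in N2.
  by case: (leP u b) => h1; case: (leP v b) => h2; rewrite ler_norml; lra.
exact: le_trans (maxl _ _) (minl _ _).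
Qed.

Lemma clamp_continuous a b : continuous (clamp a b).
Proof.
move=> x; apply: dist_continuous => e e0; near=> y.
by apply: le_lt_trans (clamp_lip _ _ _ _) _; near: y; exact: near_dist.
Unshelve. all: by end_near. Qed.

Definition clamp_row m (r : R) (u : 'rV[R]_m) : 'rV[R]_m := map_mx (clamp (- r) r) u.

Lemma clamp_row_id m r (u : 'rV[R]_m) : `|u| <= r -> clamp_row r u = u.
Proof.
move=> ur; apply/rowP => j; rewrite mxE clamp_id// -ler_norml.
by apply: le_trans ur; exact: ler_mx_norm.
Qed.

Lemma clamp_row_le m r (u : 'rV[R]_m) : 0 <= r -> `|clamp_row r u| <= r.
Proof.
move=> r0; apply/mx_norm_leP => // i j; rewrite mxE ler_norml.
by apply: clamp_itv; rewrite ge0_cp.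
Qed.

Lemma clamp_row_lip m r (u w : 'rV[R]_m) :
  `|clamp_row r u - clamp_row r w| <= `|u - w|.
Proof.
apply/mx_norm_leP => // i j; rewrite !mxE (le_trans (clamp_lip _ _ _ _))//.
by have := ler_mx_norm (u - w) i j; rewrite !mxE.
Qed.

Lemma clamp_row_continuous m r : continuous (@clamp_row m r).
Proof.
move=> x; apply: (dist_continuous (f := @clamp_row m r)) => e e0.
apply/near_normP; exists e => // y ye.
exact: le_lt_trans (clamp_row_lip _ _ _) ye.
Qed.

(** Strict differentiability at each [z t] gives a local radius, and compactness of the interval a
    common one. The linear part is taken at the moving point [z t]: half of [e] is spent on the
    estimate at the centre of the covering set, half on the variation of the Jacobian there. *)
Lemma tube m (O : set 'rV[R]_m) (F : 'rV[R]_m -> 'rV[R]_m) (z : R -> 'rV[R]_m)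
    (al be e : R) :
  open O -> Ck_on 1 O F -> (forall t, al <= t <= be -> O (z t)) ->
  (forall t, al <= t <= be -> {for t, continuous z}) -> 0 < e ->
  exists2 r : R, 0 < r & forall t, al <= t <= be -> forall u w : 'rV[R]_m,
    `|u| <= r -> `|w| <= r -> O (z t + u) /\
    `|F (z t + u) - F (z t + w) - (u - w) *m 'J F (z t)| <= e * `|u - w|.
Proof.
move=> oO FC zO zc e0.
pose P (r t : R) := forall u w : 'rV[R]_m, `|u| <= r -> `|w| <= r -> O (z t + u) /\
  `|F (z t + u) - F (z t + w) - (u - w) *m 'J F (z t)| <= e * `|u - w|.
suff H : \forall r \near 0^'+, `[al, be]%classic `<=` P r.
  near (0 : R)^'+ => r; exists r => //.
  move=> t tI; have Hr : `[al, be]%classic `<=` P r by near: r.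
  by apply: Hr; rewrite /= in_itv.
apply: (compact_near_coveringP _).1; first exact: segment_compact.
move=> t; rewrite /= in_itv /= => tI.
have e2 : 0 < e / 2 by rewrite divr_gt0.
have e3 : 0 < e / 2 / m.+1%:R by rewrite divr_gt0.
have [d1 d10 Od] := (near_normP _ _).1 (open_nbhs_nbhs (conj oO (zO t tI))).
have [d d0 Hd] := C1_strict_diff oO FC (zO t tI) e2.
have Jc : {for z t, continuous (jacobian F)}.
  exact: Ck_on_continuous (Ck_on_jacobian (k := 0) oO FC) (zO t tI).
have nJ : \forall s \near t, `|'J F (z s) - 'J F (z t)| < e / 2 / m.+1%:R.
  exact: continuous_dist (continuous_comp (zc t tI) Jc) e3.
have dd0 : 0 < Num.min d d1 / 2 by rewrite divr_gt0// lt_min d0.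
have nz : \forall s \near t, `|z s - z t| < Num.min d d1 / 2.
  exact: continuous_dist (zc t tI) dd0.
exists ([set s | `|'J F (z s) - 'J F (z t)| < e / 2 / m.+1%:R /\
                `|z s - z t| < Num.min d d1 / 2],
        [set r | r <= Num.min d d1 / 2]).
  by split; [exact: filterI|exact: nbhs_right_le].
move=> [s r] /= [[sJ sz] rd] u w ur wr.
have near_z v : `|v| <= r -> `|z s + v - z t| < Num.min d d1.
  move=> vr; rewrite addrAC (le_lt_trans (ler_normD _ _))//.
  rewrite [X in _ < X]splitr ltr_leD// (le_trans vr)//.
split.
  by apply: Od; have := near_z u ur; rewrite lt_min => /andP[].
have Hs := Hd (z s + u) (z s + w).
have uw : z s + u - (z s + w) = u - w by rewrite opprD addrACA subrr add0r.
rewrite uw in Hs.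
have := near_z u ur; have := near_z w wr; rewrite !lt_min => /andP[wd _] /andP[ud _].
have {}Hs := Hs ud wd.
have -> : F (z s + u) - F (z s + w) - (u - w) *m 'J F (z s) =
   (F (z s + u) - F (z s + w) - (u - w) *m 'J F (z t)) -
   (u - w) *m ('J F (z s) - 'J F (z t)).
  by rewrite mulmxBr opprB addrA subrK.
rewrite (le_trans (ler_normB _ _))// [X in X * _]splitr mulrDl lerD//.
rewrite (le_trans (ler_norm_mulmx _ _))// mulrAC ler_wpM2r//.
apply: (@le_trans _ _ (m.+1%:R * (e / 2 / m.+1%:R))).
  by apply: ler_pM => //; [rewrite ler_nat|exact: ltW].
by rewrite mulrC divfK.
Unshelve. all: by end_near. Qed.

End ODE.

(** * The flow near a given solution and its differential *)

Section Flow.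
Variables (R : realType).

Lemma ler_mulmx_norm m n (A : 'M[R]_(m, n)) (u : 'rV[R]_m) (C : R) :
  `|A| <= C -> `|u *m A| <= m%:R * C * `|u|.
Proof.
move=> AC; apply: (le_trans (ler_norm_mulmx _ _)).
by rewrite mulrAC ler_wpM2r// ler_wpM2l.
Qed.

Lemma continuous_mulmx (T : topologicalType) m n p (M : T -> 'M[R]_(m, n))
    (N : T -> 'M[R]_(n, p)) (t : T) : {for t, continuous M} ->
  {for t, continuous N} -> {for t, continuous (fun s => M s *m N s)}.
Proof.
move=> Mc Nc; apply/continuous_mxP => i j.
have -> : (fun x => (M x *m N x) i j) = \sum_k (fun x => M x i k * N x k j).
  by apply/funext => x; rewrite mxE fct_sumE.
elim/big_ind : _ => [|f g fc gc|k _]; first exact: cst_continuous.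
  exact: continuousD.
by apply: continuousM; [exact: ((continuous_mxP M t).1 Mc)|exact: ((continuous_mxP N t).1 Nc)].
Qed.

(** The rows of the fundamental matrix are the solutions starting at the basis vectors. Freezing [A]
    outside [[al, be]] makes it bounded, so these solutions exist for all times. *)
Lemma linear_flow m (A : R -> 'M[R]_m) (al be a : R) : al <= be ->
  (forall t, al <= t <= be -> {for t, continuous A}) ->
  exists Phi : R -> 'M[R]_m, Phi a = 1%:M /\
    forall t, al <= t <= be -> is_derive t (1 : R) Phi (Phi t *m A t).
Proof.
move=> albe Ac.
have clc t : {for t, continuous (fun s => A (clamp al be s))}.
  apply: continuous_comp; first exact: clamp_continuous.
  by apply: Ac; exact: clamp_itv.
have [|c cI cmax] := @EVT_max R (fun t => `|A t|) al be albe.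
  apply: continuous_in_subspaceT => s /set_mem /=; rewrite in_itv /= => sI.
  by apply: cvg_norm; exact: Ac.
pose C := `|A c|.
have AC t : `|A (clamp al be t)| <= C by apply: cmax; rewrite in_itv /=; exact: clamp_itv.
have C0 : 0 <= C by exact: normr_ge0.
have l0 : 0 < 1 + m%:R * C by rewrite ltr_pwDl// mulr_ge0.
have GL (t : R) (u : 'rV[R]_m) : `|u *m A (clamp al be t)| <= (1 + m%:R * C) * `|u|.
  apply: (le_trans (ler_mulmx_norm _ (AC t))).
  by rewrite ler_wpM2r// lerDr.
have sol (i : 'I_m) : exists w : R -> 'rV[R]_m, w a = delta_mx 0 i /\
    forall t, is_derive t (1 : R) w (w t *m A (clamp al be t)).
  apply: (@picard R m (fun t u => u *m A (clamp al be t)) (1 + m%:R * C)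
     ((1 + m%:R * C) * `|delta_mx 0 i : 'rV[R]_m|)) => //.
  - by move=> w wc t; apply: continuous_mulmx; [exact: wc|exact: clc].
  - by move=> t u w; rewrite -mulmxBl.
pose W i := projT1 (cid (sol i)).
have W0 i : W i a = delta_mx 0 i by rewrite /W; case: (cid (sol i)) => ? [].
have Wd i t : is_derive t (1 : R) (W i) (W i t *m A (clamp al be t)).
  by rewrite /W; case: (cid (sol i)) => ? [].
exists (fun t => \matrix_(i, j) W i t 0 j); split.
  by apply/matrixP => i j; rewrite !mxE W0 mxE eqxx /= eq_sym.
move=> t tI; apply/is_derive_mxP => i j; under eq_fun do rewrite mxE.
have := (is_derive_mxP _ _ _ _).1 (Wd i t) 0 j; rewrite clamp_id// => /is_derive_eq.
by apply; rewrite !mxE; apply: eq_bigr => k _; rewrite !mxE.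
Qed.

(** The unknown is the deviation [u y] from [z]. Its equation, cut off at radius [r], is globally
    Lipschitz and has [0] as a solution; Gronwall's inequality keeps small deviations below [r],
    where the cutoff is the identity. A second use of it, on [u y - u y' - (y - y') *m Phi], gives
    strict differentiability. The times [a] and [b] may come in any order. *)
Lemma flow_along m (O : set 'rV[R]_m) (F : 'rV[R]_m -> 'rV[R]_m)
    (z : R -> 'rV[R]_m) (al a b be : R) :
  open O -> Ck_on 1 O F -> al <= a <= be -> al <= b <= be ->
  (forall t, al <= t <= be -> O (z t)) ->
  (forall t, al <= t <= be -> is_derive t (1 : R) z (F (z t))) ->
  exists (Phi : R -> 'M[R]_m) (S : 'rV[R]_m -> R -> 'rV[R]_m), [/\ Phi a = 1%:M,
    forall t, al <= t <= be -> is_derive t (1 : R) Phi (Phi t *m 'J F (z t)),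
    exists2 r : R, 0 < r & forall y : 'rV[R]_m, `|y - z a| < r -> S y a = y /\
      forall t, al <= t <= be -> O (S y t) /\ is_derive t (1 : R) (S y) (F (S y t)),
    S (z a) b = z b &
    strict_diff (fun y => S y b) (z a) (Phi b)].
Proof.
move=> oO FC aI bI zO zd.
have albe : al <= be by case/andP: aI; exact: le_trans.
have zc t : al <= t <= be -> {for t, continuous z}.
  by move=> tI; exact: is_derive1_continuous (zd t tI).
have Jc t : al <= t <= be -> {for t, continuous (jacobian F \o z)}.
  move=> tI; apply: continuous_comp; first exact: zc.
  exact: Ck_on_continuous (Ck_on_jacobian (k := 0) oO FC) (zO t tI).
have [Phi [Phia Phid]] := linear_flow a albe Jc.
have [|c cI cmax] := @EVT_max R (fun t => `|'J F (z t)|) al be albe.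
  apply: continuous_in_subspaceT => s /set_mem /=; rewrite in_itv /= => sI.
  by apply: cvg_norm; exact: Jc.
pose C := `|'J F (z c)|.
have JC t : al <= t <= be -> `|'J F (z t)| <= C by move=> tI; apply: cmax; rewrite in_itv.
have C0 : 0 <= C by exact: normr_ge0.
pose l : R := 1 + m%:R * C.
have l0 : 0 < l by rewrite ltr_pwDl// mulr_ge0.
have JL (t : R) (u : 'rV[R]_m) : al <= t <= be -> `|u *m 'J F (z t)| <= m%:R * C * `|u|.
  by move=> tI; apply: ler_mulmx_norm; exact: JC.
(* The tolerance [1] of this tube is the summand [1] in the Lipschitz constant [l]. *)
have [r r0 Hr] := tube oO FC zO zc (ltr01).
have Or t (u : 'rV[R]_m) : al <= t <= be -> `|u| <= r -> O (z t + u).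
  by move=> tI ur; have [] := Hr t tI u u ur ur.
have FL t (u w : 'rV[R]_m) : al <= t <= be -> `|u| <= r -> `|w| <= r ->
    `|F (z t + u) - F (z t + w)| <= l * `|u - w|.
  move=> tI ur wr; have [_ H1] := Hr t tI u w ur wr.
  rewrite -(subrK ((u - w) *m 'J F (z t)) (F (z t + u) - F (z t + w))).
  by rewrite (le_trans (ler_normD _ _))// mulrDl lerD// JL.
pose cl := clamp al be.
have clI t : al <= cl t <= be by exact: clamp_itv.
pose G t (u : 'rV[R]_m) := F (z (cl t) + clamp_row r u) - F (z (cl t)).
have cr u : `|clamp_row r u : 'rV[R]_m| <= r by apply: clamp_row_le; exact: ltW.
have GL t (u w : 'rV[R]_m) : `|G t u - G t w| <= l * `|u - w|.
  rewrite /G opprB addrA subrK (le_trans (FL _ _ _ (clI t) (cr u) (cr w)))//.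
  by rewrite ler_wpM2l ?(ltW l0)// clamp_row_lip.
have G0 t : G t 0 = 0.
  by rewrite /G clamp_row_id ?normr0 ?(ltW r0)// addr0 subrr.
have GL0 t (u : 'rV[R]_m) : `|G t u| <= l * `|u|.
  by rewrite -{2}(subr0 u) -[G t u]subr0 -{1}(G0 t).
have Gc (w : R -> 'rV[R]_m) : continuous w -> continuous (fun t => G t (w t)).
  move=> wc t.
  have zclc : {for t, continuous (z \o cl)}.
    by apply: continuous_comp; [exact: clamp_continuous|exact: zc].
  have Fc v : O v -> {for v, continuous F} by exact: Ck_on_continuous FC.
  apply: cvgB.
    apply: (@continuous_comp _ _ _ (fun s => z (cl s) + clamp_row r (w s)) F).
      apply: cvgD; first exact: zclc.
      by apply: (@continuous_comp _ _ _ w); [exact: wc|exact: clamp_row_continuous].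
    by apply: Fc; exact: Or (clI t) (cr _).
  by apply: (@continuous_comp _ _ _ (z \o cl) F) => //; apply: Fc; exact: zO.
have sol (y : 'rV[R]_m) : exists w : R -> 'rV[R]_m, w a = y - z a /\
    forall t, is_derive t (1 : R) w (G t (w t)).
  exact: (@picard R m G l (l * `|y - z a|)).
pose u y := projT1 (cid (sol y)).
have ua y : u y a = y - z a by rewrite /u; case: (cid (sol y)) => ? [].
have ud y t : is_derive t (1 : R) (u y) (G t (u y t)).
  by rewrite /u; case: (cid (sol y)) => ? [].
pose E : R := 2 * expR (2 * l * (be - al)).
have E0 : 0 < E by rewrite mulr_gt0// expR_gt0.
have Et t : al <= t <= be -> 2 * expR (2 * l * `|t - a|) <= E.
  move=> tI; rewrite ler_pM2l// ler_expR ler_pM2l ?mulr_gt0//.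
  by case/andP: tI => ? ?; case/andP: aI => ? ?; rewrite ler_norml; lra.
have udist y y' t : al <= t <= be -> `|u y t - u y' t| <= E * `|y - y'|.
  move=> tI.
  have := @gronwall R m (fun t => u y t - u y' t) (fun t => G t (u y t) - G t (u y' t))
    al be a l 0 t l0 (lexx _) aI tI.
  rewrite !ua opprB addrA subrK mul0r addr0 mulrAC => H.
  apply: le_trans (H (fun s _ => is_deriveB (ud y s) (ud y' s)) _) _.
    by move=> s sI; rewrite addr0.
  by rewrite ler_wpM2r// Et.
have ub y t : al <= t <= be -> `|u y t| <= E * `|y - z a|.
  move=> tI.
  have := @gronwall R m (u y) (fun t => G t (u y t)) al be a l 0 t l0 (lexx _) aI tI.
  rewrite !ua mul0r addr0 mulrAC => H.
  apply: le_trans (H (fun s _ => ud y s) _) _.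
    by move=> s sI; rewrite addr0.
  by rewrite ler_wpM2r// Et.
have small y e t : al <= t <= be -> `|y - z a| < e / E -> `|u y t| <= e.
  move=> tI ye; apply: (le_trans (ub y t tI)).
  by rewrite mulrC -ler_pdivlMr// ltW.
have GE y t : al <= t <= be -> `|u y t| <= r -> G t (u y t) = F (z t + u y t) - F (z t).
  by move=> tI ur; rewrite /G /cl clamp_id// clamp_row_id.
exists Phi, (fun y t => z t + u y t); split => //.
- exists (r / E); first by rewrite divr_gt0.
  move=> y yr; split; first by rewrite ua addrC subrK.
  move=> t tI; have ur := small y r t tI yr.
  split; first exact: Or.
  have := is_deriveD (zd t tI) (ud y t).
  by rewrite (GE y t tI ur) [F (z t) + _]addrC subrK.
- have := ub (z a) b bI; rewrite subrr normr0 mulr0 normr_le0 => /eqP ->.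
  by rewrite addr0.
(* One factor [E] is lost in the Lipschitz dependence of [u y] on [y], another in the final Gronwall
   estimate, which also divides by [l]. *)
- move=> e e0; pose e' : R := e * l / (E * E).
  have e'0 : 0 < e' by apply: divr_gt0; exact: mulr_gt0.
  have [r' r'0 Hr'] := tube oO FC zO zc e'0.
  exists (Num.min r r' / E); first by rewrite divr_gt0// lt_min r0.
  move=> y y' yd y'd.
  have rho0 : 0 < Num.min r r' by rewrite lt_min r0.
  have Phi_y t : al <= t <= be -> is_derive t (1 : R) (fun t => (y - y') *m Phi t)
      ((y - y') *m (Phi t *m 'J F (z t))).
    move=> tI; have := is_derive_mulmx (is_derive_cst (y - y') t (1 : R)) (Phid t tI).
    by rewrite mul0mx add0r.
  have H := @gronwall R m (fun t => u y t - u y' t - (y - y') *m Phi t)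
    (fun t => G t (u y t) - G t (u y' t) - (y - y') *m (Phi t *m 'J F (z t)))
    al be a l (e' * (E * `|y - y'|)) b l0 _ aI bI.
  have -> : z b + u y b - (z b + u y' b) = u y b - u y' b.
    by rewrite opprD addrACA subrr add0r.
  have {}H := H _ (fun t tI => is_deriveB (is_deriveB (ud y t) (ud y' t))
    (Phi_y t tI)).
  apply: le_trans (H _ _) _.
  + by apply: mulr_ge0; [exact: ltW|apply: mulr_ge0; [exact: ltW|]].
  + move=> t tI.
    have := small y _ t tI yd; rewrite le_min => /andP[ur ur'].
    have := small y' _ t tI y'd; rewrite le_min => /andP[wr wr'].
    rewrite !GE//.
    have [_ H1] := Hr' t tI (u y t) (u y' t) ur' wr'.
    set A := 'J F (z t) in H1 *; set U := u y t in H1 *; set W := u y' t in H1 *.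
    have -> : F (z t + U) - F (z t) - (F (z t + W) - F (z t)) - (y - y') *m (Phi t *m A) =
      (U - W - (y - y') *m Phi t) *m A + (F (z t + U) - F (z t + W) - (U - W) *m A).
      rewrite opprB addrA subrK mulmxA [(U - W - _) *m A]mulmxBl.
      by rewrite [RHS]addrC subrKA.
    rewrite (le_trans (ler_normD _ _))// lerD//.
      by apply: (le_trans (JL _ _ tI)); rewrite ler_wpM2r// /l lerDr.
    apply: (le_trans H1); rewrite ler_wpM2l ?(ltW e'0)//; exact: udist.
  rewrite !ua opprB addrA subrK Phia mulmx1 subrr normr0 add0r mulrAC.
  apply: (@le_trans _ _ (E * (e' * (E * `|y - y'|) / l))).
    apply: ler_wpM2r; last exact: Et.
    apply: divr_ge0; last exact: ltW.
    by apply: mulr_ge0; [exact: ltW|apply: mulr_ge0; [exact: ltW|]].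
  rewrite le_eqVlt; apply/orP; left; apply/eqP; rewrite /e'.
  have l1 : l != 0 by rewrite gt_eqF.
  have E1 : E != 0 by rewrite gt_eqF.
  by field; rewrite l1 E1.
Qed.

End Flow.

(** * Charts, metric and geodesic spray *)

Section Bilinear.
Variables (R : realType) (n : nat).
Implicit Types (G : 'M[R]_n) (u v w : 'rV[R]_n).

Definition bil G u v : R := (u *m G *m v^T) 0 0.

Lemma bilDl G u w v : bil G (u + w) v = bil G u v + bil G w v.
Proof. by rewrite /bil !mulmxDl mxE. Qed.

Lemma bilNl G u v : bil G (- u) v = - bil G u v.
Proof. by rewrite /bil !mulNmx mxE. Qed.

Lemma bilM G (S T : 'M[R]_n) u v : bil (S *m G *m T^T) u v = bil G (u *m S) (v *m T).
Proof. by rewrite /bil trmx_mul !mulmxA. Qed.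

Lemma bilC G u v : G^T = G -> bil G u v = bil G v u.
Proof.
move=> GT; rewrite /bil.
have -> : (u *m G *m v^T) 0 0 = ((u *m G *m v^T)^T) 0 0 by rewrite [RHS]mxE.
by rewrite !trmx_mul trmxK GT mulmxA.
Qed.

Lemma bil_sum G u v : bil G u v = \sum_i \sum_j u 0 i * G i j * v 0 j.
Proof.
rewrite /bil mxE exchange_big; apply: eq_bigr => j _.
by rewrite !mxE mulr_suml.
Qed.

Lemma bil_inj G u w : G \in unitmx -> (forall v, bil G u v = bil G w v) -> u = w.
Proof.
move=> Gu H; apply: (can_inj (mulmxK Gu)); apply/rowP => j.
have := H (delta_mx 0 j); rewrite /bil trmx_delta -!colE.
by rewrite [LHS]mxE [RHS]mxE.
Qed.

Lemma is_derive_bil (V : normedModType R) (G : V -> 'M[R]_n) (u v : V -> 'rV[R]_n)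
    (x h : V) dG du dv :
  is_derive x h G dG -> is_derive x h u du -> is_derive x h v dv ->
  is_derive x h (fun y => bil (G y) (u y) (v y))
    (bil (G x) du (v x) + bil dG (u x) (v x) + bil (G x) (u x) dv).
Proof.
move=> Gd ud vd.
have := is_derive_mulmx (is_derive_mulmx ud Gd) (is_derive_trmx vd).
move=> /is_derive_mxP /(_ 0 0) /is_derive_eq; apply.
by rewrite mxE mulmxDl mxE.
Qed.

End Bilinear.

Section ChainRules.
Variables (R : realType).

Lemma derive_sum_delta m p q (B : set 'rV[R]_m) (f : 'rV[R]_m -> 'M[R]_(p, q)) x v :
  open B -> Ck_on 1 B f -> B x ->
  'D_v f x = \sum_(i < m) v 0 i *: 'D_(delta_mx 0 i) f x.
Proof.
move=> oB fC Bx; have fd := C1_diff oB fC Bx.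
rewrite deriveE// {1}(row_sum_delta v) linear_sum; apply: eq_bigr => i _.
by rewrite deriveE//; exact: linearZ.
Qed.

Lemma Ck_on_comp_scalar (V : normedModType R) k m (A : set V) (B : set 'rV[R]_m)
    (g : 'rV[R]_m -> R) (f : V -> 'rV[R]_m) :
  open A -> open B -> (forall x, A x -> B (f x)) ->
  Ck_on k A f -> Ck_on k B g -> Ck_on k A (fun x => g (f x)).
Proof.
move=> oA oB AB fC gC.
have gC' : Ck_on k B (fun y => (g y)%:M : 'M[R]_1).
  apply/Ck_on_mxP => // i j; apply: Ck_on_ext gC => // y _.
  by rewrite (ord1 i) (ord1 j) mxE eqxx.
apply: Ck_on_ext ((Ck_on_mxP _ _ oA).1 (Ck_on_comp oA oB AB fC gC') 0 0) => //.
by move=> x _; rewrite /= mxE eqxx.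
Qed.

Lemma jacobian_comp m p q (A : set 'rV[R]_m) (B : set 'rV[R]_p)
    (C : set 'rV[R]_m) (f : 'rV[R]_m -> 'rV[R]_p) (g : 'rV[R]_p -> 'rV[R]_q)
    (h : 'rV[R]_m -> 'rV[R]_q) x :
  open A -> open B -> open C -> Ck_on 1 A f -> Ck_on 1 B g -> Ck_on 1 C h ->
  A x -> B (f x) -> C x -> (\forall y \near x, g (f y) = h y) ->
  'J f x *m 'J g (f x) = 'J h x.
Proof.
move=> oA oB oC fC gC hC Ax Bx Cx E; apply/row_matrixP => i; rewrite !rowE mulmxA.
set v := delta_mx 0 i.
rewrite -(C1_deriveE v oA fC Ax) -(C1_deriveE ('D_v f x) oB gC Bx).
rewrite -(C1_deriveE v oC hC Cx).
by have /(is_derive_ext E) [_ <-] := C1_chain oB gC Bx (Ck_on_derivable v fC Ax).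
Qed.

Lemma jacobian_near_id m (C : set 'rV[R]_m) (h : 'rV[R]_m -> 'rV[R]_m) x :
  open C -> Ck_on 1 C h -> C x -> (\forall y \near x, y = h y) ->
  'J h x = 1%:M.
Proof.
move=> oC hC Cx E; apply/row_matrixP => i; rewrite !rowE mulmx1.
rewrite -(C1_deriveE (delta_mx 0 i) oC hC Cx).
have D : is_derive x (delta_mx 0 i) h (delta_mx 0 i).
  exact: is_derive_ext E (is_derive_id x (delta_mx 0 i)).
by case: D.
Qed.

Lemma open_preimage_lsubmx m p (B : set 'rV[R]_m) :
  open B -> open [set z : 'rV[R]_(m + p) | B (lsubmx z)].
Proof.
move=> oB; apply: (open_comp (f := fun z : 'rV[R]_(m + p) => lsubmx z)) => // z _.
by apply: differentiable_continuous; exact: differentiable_lsubmx.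
Qed.

End ChainRules.

(** * Transition maps and their Jacobians *)

Section Transition.
Variables (R : realType) (n : nat) (M : smoothManifold R n).
Implicit Types (c d e : chart R n M) (p : M) (x y v : 'rV[R]_n).

Definition trans c d : 'rV[R]_n -> 'rV[R]_n := chart_map d \o chart_inv c.

Definition overlap c d : set 'rV[R]_n := chart_map c @` (chart_dom c `&` chart_dom d).

Lemma chart_mapK c p : atlas c -> chart_dom c p -> chart_inv c (chart_map c p) = p.
Proof. by move=> /atlas_homeo [_ _ K _ _] cp; apply: K; exact: mem_set. Qed.

Lemma chart_dom_open c : atlas c -> open (chart_dom c).
Proof. by case/atlas_homeo. Qed.

Lemma chart_im_open c : atlas c -> open (chart_im c).
Proof. by case/atlas_homeo. Qed.

Lemma chart_inv_continuous c x : atlas c -> chart_im c x ->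
  {for x, continuous (chart_inv c)}.
Proof. by move=> /atlas_homeo [_ _ _ _ K] cx; apply: K; exact: mem_set. Qed.

Lemma chart_invK c x : atlas c -> chart_im c x -> chart_map c (chart_inv c x) = x.
Proof. by move=> ac [p cp <-]; rewrite chart_mapK. Qed.

Lemma chart_im_inv c x : atlas c -> chart_im c x -> chart_dom c (chart_inv c x).
Proof. by move=> ac [p cp <-]; rewrite chart_mapK. Qed.

Lemma chart_im_map c p : chart_dom c p -> chart_im c (chart_map c p).
Proof. by exists p. Qed.

Lemma overlapP c d x : atlas c ->
  overlap c d x <-> chart_im c x /\ chart_dom d (chart_inv c x).
Proof.
move=> ac; split=> [[p [cp dp] <-]|[cx dx]]; first by rewrite chart_mapK//; split => //; exists p.
by exists (chart_inv c x); [split => //; exact: chart_im_inv|exact: chart_invK].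
Qed.

Lemma overlap_map c d p : chart_dom c p -> chart_dom d p -> overlap c d (chart_map c p).
Proof. by exists p. Qed.

Lemma overlap_open c d : atlas c -> atlas d -> open (overlap c d).
Proof.
move=> ac ad; rewrite openE => x /(overlapP _ _ ac) [cx dx].
have n1 : nbhs x (chart_im c) by apply: open_nbhs_nbhs; split => //; exact: chart_im_open.
have n2 : nbhs x (chart_inv c @^-1` chart_dom d).
  by apply: chart_inv_continuous => //; apply: open_nbhs_nbhs; split => //; exact: chart_dom_open.
by apply: filterS (filterI n1 n2) => y ?; exact/overlapP.
Qed.

Lemma trans_smooth c d : atlas c -> atlas d -> smooth_on (overlap c d) (trans c d).
Proof. exact: atlas_compatible. Qed.

Lemma trans_map c d p : atlas c -> chart_dom c p ->
  trans c d (chart_map c p) = chart_map d p.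
Proof. by move=> ac cp; rewrite /trans /= chart_mapK. Qed.

Lemma trans_overlap c d x : atlas c -> overlap c d x -> overlap d c (trans c d x).
Proof. by move=> ac [p [cp dp] <-]; rewrite trans_map//; exists p. Qed.

Lemma near_overlap c d p : atlas c -> atlas d -> chart_dom c p -> chart_dom d p ->
  \forall x \near chart_map c p, overlap c d x.
Proof.
by move=> ac ad cp dp; apply: open_nbhs_nbhs; split; [exact: overlap_open|exact: overlap_map].
Qed.

(** The identity between transition maps holds only where the charts overlap; this is a neighborhood
    of the point, which is enough for the chain rule. *)
Lemma jacobian_cocycle c d e p : atlas c -> atlas d -> atlas e ->
  chart_dom c p -> chart_dom d p -> chart_dom e p ->
  'J (trans c d) (chart_map c p) *m 'J (trans d e) (chart_map d p) =
  'J (trans c e) (chart_map c p).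
Proof.
move=> ac ad ae cp dp ep.
have := @jacobian_comp R n n n _ _ _ _ _ _ _ (overlap_open ac ad)
  (overlap_open ad ae) (overlap_open ac ae) (trans_smooth ac ad 1)
  (trans_smooth ad ae 1) (trans_smooth ac ae 1) (overlap_map cp dp).
rewrite trans_map//; apply; [exact: overlap_map|exact: overlap_map|].
apply: filterS (near_overlap ac ad cp dp) => y [q [cq dq] <-].
by rewrite /trans /= !chart_mapK.
Qed.

Lemma jacobian_trans_id c p : atlas c -> chart_dom c p ->
  'J (trans c c) (chart_map c p) = 1%:M.
Proof.
move=> ac cp; apply: (jacobian_near_id (overlap_open ac ac)).
- exact: (trans_smooth ac ac 1).
- exact: overlap_map.
apply: filterS (near_overlap ac ac cp cp) => y [q [cq _] <-].
by rewrite /trans /= chart_mapK.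
Qed.

Lemma jacobian_trans_unit c d p : atlas c -> atlas d ->
  chart_dom c p -> chart_dom d p -> 'J (trans c d) (chart_map c p) \in unitmx.
Proof.
move=> ac ad cp dp.
have := jacobian_cocycle ac ad ac cp dp cp; rewrite jacobian_trans_id//.
by move=> H; have [U _] := mulmx1_unit H; exact: U.
Qed.

End Transition.

(** * Christoffel symbols paired with the metric *)

Section ChristoffelAlgebra.
Variables (R : realType) (n : nat).

Lemma sym_entry (A : 'M[R]_n) i j : A^T = A -> A j i = A i j.
Proof. by move=> {2}<-; rewrite mxE. Qed.

Lemma christoffel_row (I : 'M[R]_n) (X : 'I_n -> 'I_n -> 'I_n -> R) (y : 'rV[R]_n) :
  \row_k (\sum_i \sum_j (2^-1 * \sum_l I k l * X i j l) * y 0 i * y 0 j) =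
  2^-1 *: (\row_l (\sum_i \sum_j X i j l * y 0 i * y 0 j) *m I^T).
Proof.
apply/rowP => k; rewrite !mxE mulr_sumr.
under [RHS]eq_bigr => l _ do rewrite !mxE mulr_suml mulr_sumr.
rewrite [RHS]exchange_big; apply: eq_bigr => i _ /=.
under [RHS]eq_bigr => l _ do rewrite mulr_suml mulr_sumr.
rewrite [RHS]exchange_big; apply: eq_bigr => j _ /=.
rewrite mulr_sumr !mulr_suml; apply: eq_bigr => l _; ring.
Qed.

Lemma bil_sum_dir (D : 'I_n -> 'M[R]_n) (w u v : 'rV[R]_n) :
  bil (\sum_i w 0 i *: D i) u v =
  \sum_l \sum_i \sum_j D i j l * w 0 i * u 0 j * v 0 l.
Proof.
rewrite bil_sum exchange_big; apply: eq_bigr => l _ /=.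
rewrite [RHS]exchange_big; apply: eq_bigr => j _ /=.
rewrite summxE mulr_sumr mulr_suml; apply: eq_bigr => i _; rewrite mxE; ring.
Qed.

(** With [D i] the partial derivatives of the metric, this is the lowered Christoffel term evaluated
    on [(y, y)]. The first two of its three terms coincide after the symmetric contraction, which
    cancels one half. *)
Lemma christoffel_pairing (D : 'I_n -> 'M[R]_n) (y v : 'rV[R]_n) :
  2^-1 * (\row_l (\sum_i \sum_j (D i j l + D j i l - D l i j) * y 0 i * y 0 j) *m v^T) 0 0 =
  bil (\sum_i y 0 i *: D i) y v - 2^-1 * bil (\sum_i v 0 i *: D i) y y.
Proof.
have E : (\row_l (\sum_i \sum_j (D i j l + D j i l - D l i j) * y 0 i * y 0 j) *m v^T) 0 0
    = bil (\sum_i y 0 i *: D i) y v + bil (\sum_i y 0 i *: D i) y v -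
      bil (\sum_i v 0 i *: D i) y y.
  have -> : bil (\sum_i v 0 i *: D i) y y =
      \sum_l \sum_i \sum_j D l i j * v 0 l * y 0 i * y 0 j.
    rewrite bil_sum_dir exchange_big; apply: eq_bigr => l _ /=.
    by rewrite exchange_big; apply: eq_bigr => i _.
  have S2 : \sum_l \sum_i \sum_j D j i l * y 0 j * y 0 i * v 0 l =
      bil (\sum_i y 0 i *: D i) y v.
    by rewrite bil_sum_dir; apply: eq_bigr => l _; rewrite exchange_big.
  rewrite -[X in _ = _ + X - _]S2 (bil_sum_dir D y y v) -big_split -sumrB mxE; apply: eq_bigr => l _ /=.
  rewrite !mxE mulr_suml -big_split -sumrB; apply: eq_bigr => i _ /=.
  rewrite mulr_suml -big_split -sumrB; apply: eq_bigr => j _ /=; ring.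
rewrite E; lra.
Qed.

End ChristoffelAlgebra.

Section Metric.
Variables (R : realType) (n : nat) (M : smoothManifold R n) (g : bilinear_field M).
Variable hg : lorentzian_metric g.
Implicit Types (c d e : chart R n M) (p : M) (x y v u : 'rV[R]_n).

Lemma gram_map c p : atlas c -> chart_dom c p ->
  gram g c (chart_map c p) = 'J (trans c (chart_at p)) (chart_map c p) *m g p *m
    ('J (trans c (chart_at p)) (chart_map c p))^T.
Proof. by move=> ac cp; rewrite /gram chart_mapK. Qed.

Lemma gram_trans c d p : atlas c -> atlas d -> chart_dom c p -> chart_dom d p ->
  gram g c (chart_map c p) = 'J (trans c d) (chart_map c p) *m
    gram g d (chart_map d p) *m ('J (trans c d) (chart_map c p))^T.
Proof.
move=> ac ad cp dp; rewrite (gram_map ac cp) (gram_map ad dp).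
have [ap pp] := chart_atP p.
by rewrite -(jacobian_cocycle ac ad ap cp dp pp) trmx_mul !mulmxA.
Qed.

Lemma gram_sym c x : (gram g c x)^T = gram g c x.
Proof.
have [gS _ _] := hg.
by rewrite /gram !trmx_mul trmxK gS mulmxA.
Qed.

Lemma minkowski_unit : minkowski_mx R n \in unitmx.
Proof.
rewrite unitmxE det_diag unitfE; apply/prodf_neq0 => i _; rewrite mxE.
by case: ifP => _; rewrite ?oner_eq0 // oppr_eq0 oner_eq0.
Qed.

Lemma gram_unit c x : atlas c -> chart_im c x -> gram g c x \in unitmx.
Proof.
move=> ac [p cp <-]; rewrite gram_map//.
have [ap pp] := chart_atP p.
have Tu := jacobian_trans_unit ac ap cp pp.
have [_ /(_ p) [P Pu PE] _] := hg.
have gu : g p \in unitmx.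
  have := minkowski_unit; rewrite -PE !unitmx_mul unitmx_tr Pu andbT; exact.
by rewrite !unitmx_mul Tu gu unitmx_tr Tu.
Qed.

Lemma gram_smooth c : atlas c -> smooth_on (chart_im c) (gram g c).
Proof. by have [_ _] := hg; exact. Qed.

Lemma christoffel_smooth c k l (i j : 'I_n) : atlas c ->
  Ck_on k (chart_im c) (christoffel g c l i j).
Proof.
move=> ac; have oc := chart_im_open ac.
have Gk m := gram_smooth ac m.
have Gij m a b := (Ck_on_mxP _ _ oc).1 (Gk m) a b.
have pk a b h : Ck_on k (chart_im c) (partial h (fun y => gram g c y a b)).
  exact: Ck_on_derive (Gij k.+1 a b).
have Ik := Ck_on_invmx oc (fun x cx => gram_unit ac cx) (Gk k).
have Iab a b := (Ck_on_mxP _ _ oc).1 Ik a b.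
apply: (@Ck_on_ext _ _ _ _ _ ((cst (2^-1) : _ -> R) * \sum_(l0 < n)
   ((fun x => invmx (gram g c x) l l0) *
    (partial i (fun y => gram g c y j l0) + partial j (fun y => gram g c y i l0) +
     cst (-1) * partial l0 (fun y => gram g c y i j))))) => //.
  move=> x cx; rewrite /christoffel; congr (_ * _); rewrite fct_sumE.
  apply: eq_bigr => l0 _; congr (_ * (_ + _)).
  exact: mulN1r.
apply: Ck_onM => //; first exact: Ck_on_cst.
apply: Ck_on_sum => // l0 _; apply: Ck_onM => //.
apply: Ck_onD => //; first exact: Ck_onD.
by apply: Ck_onM => //; exact: Ck_on_cst.
Qed.

Lemma metric_form_components c p (v u : tangent p) : atlas c -> chart_dom c p ->
  metric_form g v u = bil (gram g c (chart_map c p)) (components c v) (components c u).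
Proof.
move=> ac cp; have [ap pp] := chart_atP p.
rewrite gram_map// bilM /components -!mulmxA (jacobian_cocycle ap ac ap pp cp pp).
by rewrite jacobian_trans_id// !mulmx1.
Qed.

Definition chr c x u v : 'rV[R]_n :=
  \row_k \sum_i \sum_j christoffel g c k i j x * u 0 i * v 0 j.

Lemma derive_gram_entry c x v i j : atlas c -> chart_im c x ->
  ('D_v (gram g c) x) i j = 'D_v (fun y => gram g c y i j : R) x.
Proof.
move=> ac cx; rewrite derive_mx ?mxE//.
by have [] := Ck_on_derivable v (gram_smooth ac 1) cx.
Qed.

Lemma derive_gram_sum c x v : atlas c -> chart_im c x ->
  'D_v (gram g c) x = \sum_(i < n) v 0 i *: 'D_(delta_mx 0 i) (gram g c) x.
Proof.
move=> ac cx; apply: (derive_sum_delta v (chart_im_open ac)) => //.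
exact: (gram_smooth ac 1).
Qed.

(** A weak form of the geodesic term, free of the inverse matrix. It determines [chr g c x y y],
    since the Gram matrix is invertible, and everything about the spray is computed from it. *)
Lemma bil_chr c x y v : atlas c -> chart_im c x ->
  bil (gram g c x) (chr c x y y) v =
  bil ('D_y (gram g c) x) y v - 2^-1 * bil ('D_v (gram g c) x) y y.
Proof.
move=> ac cx.
pose D i := 'D_(delta_mx 0 i) (gram g c) x.
have E : chr c x y y = 2^-1 *: (\row_l (\sum_i \sum_j
    (D i j l + D j i l - D l i j) * y 0 i * y 0 j) *m (invmx (gram g c x))^T).
  rewrite -christoffel_row; apply/rowP => k; rewrite !mxE.
  apply: eq_bigr => i _; apply: eq_bigr => j _; congr (_ * _ * _).
  rewrite /christoffel; congr (_ * _); apply: eq_bigr => l _; congr (_ * _).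
  by congr (_ + _ - _); exact: (esym (derive_gram_entry _ _ _ ac cx)).
have IT : (invmx (gram g c x))^T *m gram g c x = 1%:M.
  apply: trmx_inj; rewrite trmx_mul trmxK (gram_sym c x) trmx1.
  exact: mulmxV (gram_unit ac cx).
rewrite (derive_gram_sum y ac cx) (derive_gram_sum v ac cx) -christoffel_pairing.
by rewrite /bil E -!scalemxAl -(mulmxA _ _ (gram g c x)) IT mulmx1 mxE.
Qed.

End Metric.

(** * Transport of linearized equations, maps of positions and velocities *)

Section Linearization.
Variables (R : realType).

(* A map intertwining two vector fields carries solutions of the linearized
   equation to solutions of the linearized equation; the second-order terms
   cancel by Schwarz's theorem. *)
Lemma linearized_push m k (A : set 'rV[R]_m) (B : set 'rV[R]_k)
    (F : 'rV[R]_m -> 'rV[R]_m) (F' : 'rV[R]_k -> 'rV[R]_k)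
    (phi : 'rV[R]_m -> 'rV[R]_k) (z w : R -> 'rV[R]_m) (t : R) :
  open A -> open B -> Ck_on 1 A F -> Ck_on 1 B F' -> Ck_on 2 A phi ->
  (forall x, A x -> B (phi x)) ->
  (forall x, A x -> F' (phi x) = F x *m 'J phi x) ->
  A (z t) -> is_derive t (1 : R) z (F (z t)) ->
  is_derive t (1 : R) w (w t *m 'J F (z t)) ->
  is_derive t (1 : R) (fun s => w s *m 'J phi (z s))
    (w t *m 'J phi (z t) *m 'J F' (phi (z t))).
Proof.
move=> oA oB FC FC' pC AB E Az zd wd.
have JC := Ck_on_jacobian oA pC.
have := is_derive_mulmx wd (C1_chain oA JC Az zd).
move=> /is_derive_eq; apply.
have p1 := Ck_onW pC.
have D1 := C1_chain oB FC' (AB _ Az) (Ck_on_derivable (w t) p1 Az).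
have D2 := is_derive_mulmx (Ck_on_derivable (w t) FC Az) (Ck_on_derivable (w t) JC Az).
have nE : \forall x \near z t, F x *m 'J phi x = (F' \o phi) x.
  by apply: filterS (open_nbhs_nbhs (conj oA Az)) => x Ax; rewrite /= E.
have := is_derive_unique (is_derive_ext nE D2) D1.
rewrite (C1_deriveE ('D_(w t) phi (z t)) oB FC' (AB _ Az)) (C1_deriveE (w t) oA p1 Az).
rewrite (C1_deriveE (w t) oA FC Az) => <-.
by rewrite (derive_jacobianC (w t) (F (z t)) oA pC Az).
Qed.

Lemma is_derive_mulmx_cst (V : normedModType R) m n p (a : 'M[R]_(m, n))
    (A : V -> 'M[R]_(n, p)) x v dA :
  is_derive x v A dA -> is_derive x v (fun y => a *m A y) (a *m dA).
Proof.
move=> D; have := is_derive_mulmx (is_derive_cst a x v) D.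
by rewrite mul0mx add0r.
Qed.

Lemma is_derive_bil_cst (V : normedModType R) n (a b : 'rV[R]_n)
    (G : V -> 'M[R]_n) x v dG :
  is_derive x v G dG -> is_derive x v (fun y => bil (G y) a b) (bil dG a b).
Proof.
move=> D; have := is_derive_bil D (is_derive_cst a x v) (is_derive_cst b x v).
by rewrite /bil !mul0mx trmx0 mulmx0 mxE mxE add0r addr0.
Qed.

Lemma is_derive_comp_lsub m k p q (B : set 'rV[R]_m) (f : 'rV[R]_m -> 'M[R]_(p, q))
    (z w : 'rV[R]_(m + k)) : open B -> Ck_on 1 B f -> B (lsubmx z) ->
  is_derive z w (fun y => f (lsubmx y)) ('D_(lsubmx w) f (lsubmx z)).
Proof.
move=> oB fC Bz.
have D := is_derive_lsubmx (is_derive_id z w).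
exact: (C1_chain oB fC Bz D).
Qed.

Lemma is_derive_rsub m k (z w : 'rV[R]_(m + k)) :
  is_derive z w (fun y : 'rV[R]_(m + k) => rsubmx y) (rsubmx w).
Proof. exact: is_derive_rsubmx (is_derive_id z w). Qed.

Lemma Ck_on_lsub_comp j m k p q (B : set 'rV[R]_m) (f : 'rV[R]_m -> 'M[R]_(p, q)) :
  open B -> Ck_on j B f ->
  Ck_on j [set z : 'rV[R]_(m + k) | B (lsubmx z)] (fun z => f (lsubmx z)).
Proof.
move=> oB fC; have oL := open_preimage_lsubmx (p := k) oB.
have L : Ck_on j [set z : 'rV[R]_(m + k) | B (lsubmx z)] (fun z => lsubmx z).
  by apply: Ck_on_lsubmx => //; exact: Ck_on_id.
exact: (Ck_on_comp oL oB _ L fC).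
Qed.

Lemma Ck_on_rsub j m k (A : set 'rV[R]_(m + k)) : open A ->
  Ck_on j A (fun z : 'rV[R]_(m + k) => rsubmx z).
Proof. by move=> oA; apply: Ck_on_rsubmx => //; exact: Ck_on_id. Qed.

(** Neighborhoods in the tangent bundle are described by pairs of row vectors, initial conditions of
    the flow by one row of double length. *)
Lemma near_lsub_rsub m (z0 : 'rV[R]_(m + m)) (N : set ('rV[R]_m * 'rV[R]_m)) :
  nbhs (lsubmx z0, rsubmx z0) N -> \forall z \near z0, N (lsubmx z, rsubmx z).
Proof.
move=> nN.
have lc : {for z0, continuous (fun z : 'rV[R]_(m + m) => lsubmx z)}.
  apply: (Ck_on_continuous (k := 0) (A := setT)) => //.
  exact: Ck_on_lsubmx openT (Ck_on_id 0 openT).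
have rc : {for z0, continuous (fun z : 'rV[R]_(m + m) => rsubmx z)}.
  by apply: (Ck_on_continuous (k := 0) (A := setT)) => //; exact: Ck_on_rsub openT.
exact: (cvg_pair lc rc) nN.
Qed.

End Linearization.

(** * The spray and the energy in bundle coordinates *)

Section Spray.
Variables (R : realType) (n : nat) (M : smoothManifold R n) (g : bilinear_field M).
Variable hg : lorentzian_metric g.
Implicit Types (c d e : chart R n M) (p : M) (x y v u : 'rV[R]_n)
  (z w : 'rV[R]_(n + n)).

Definition state_dom c : set 'rV[R]_(n + n) := [set z | chart_im c (lsubmx z)].

Definition state_overlap c d : set 'rV[R]_(n + n) := [set z | overlap c d (lsubmx z)].

Definition spray c z : 'rV[R]_(n + n) :=
  row_mx (rsubmx z) (- chr g c (lsubmx z) (rsubmx z) (rsubmx z)).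

(** The change of coordinates induced on the tangent bundle: velocities are carried by the
    differential of the transition map. *)
Definition tmap c d z : 'rV[R]_(n + n) :=
  row_mx (trans c d (lsubmx z)) (rsubmx z *m 'J (trans c d) (lsubmx z)).

(** This is [g(v, v)], without the customary factor one half. It is a 1 by 1 matrix so that the
    calculus of Jacobians applies to it. *)
Definition energy c z : 'rV[R]_1 := rsubmx z *m gram g c (lsubmx z) *m (rsubmx z)^T.

Lemma state_dom_open c : atlas c -> open (state_dom c).
Proof. by move=> ac; apply: open_preimage_lsubmx; exact: chart_im_open. Qed.

Lemma state_overlap_open c d : atlas c -> atlas d -> open (state_overlap c d).
Proof. by move=> ac ad; apply: open_preimage_lsubmx; exact: overlap_open. Qed.

Lemma spray_smooth c : atlas c -> smooth_on (state_dom c) (spray c).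
Proof.
move=> ac k; have oS := state_dom_open ac; have oc := chart_im_open ac.
apply: Ck_on_row_mx => //; first exact: Ck_on_rsub.
have rk i : Ck_on k (state_dom c) (fun z : 'rV[R]_(n + n) => rsubmx z 0 i : R).
  exact: ((Ck_on_mxP _ _ oS).1 (Ck_on_rsub k oS)).
have lk : Ck_on k (state_dom c) (fun z : 'rV[R]_(n + n) => lsubmx z : 'rV[R]_n).
  by apply: Ck_on_lsubmx => //; exact: Ck_on_id.
apply/Ck_on_mxP => // a l.
apply: (@Ck_on_ext _ _ _ _ _ ((cst (-1) : _ -> R) * \sum_i \sum_j
   ((fun z : 'rV[R]_(n + n) => christoffel g c l i j (lsubmx z)) *
    (fun z => rsubmx z 0 i) * (fun z => rsubmx z 0 j)))) => //.
  move=> z _; rewrite (ord1 a) !mxE; apply: (etrans (mulN1r _)); congr (- _).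
  rewrite fct_sumE; apply: eq_bigr => i _.
  by rewrite fct_sumE; apply: eq_bigr => j _.
apply: Ck_onM => //; first exact: Ck_on_cst.
apply: Ck_on_sum => // i _; apply: Ck_on_sum => // j _.
apply: Ck_onM => //; apply: Ck_onM => //.
by apply: (Ck_on_comp_scalar oS oc _ lk); [move=> z|exact: christoffel_smooth].
Qed.

Lemma tmap_smooth c d : atlas c -> atlas d -> smooth_on (state_overlap c d) (tmap c d).
Proof.
move=> ac ad k; have oO := state_overlap_open ac ad; have oV := overlap_open ac ad.
apply: Ck_on_row_mx => //.
  exact: (Ck_on_lsub_comp n oV (trans_smooth ac ad k)).
apply: Ck_on_mulmx => //; first exact: Ck_on_rsub.
exact: (Ck_on_lsub_comp n oV (Ck_on_jacobian oV (trans_smooth ac ad k.+1))).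
Qed.

Lemma energy_smooth c : atlas c -> smooth_on (state_dom c) (energy c).
Proof.
move=> ac k; have oS := state_dom_open ac.
apply: Ck_on_mulmx => //; last by apply: Ck_on_trmx => //; exact: Ck_on_rsub.
apply: Ck_on_mulmx => //; first exact: Ck_on_rsub.
exact: (Ck_on_lsub_comp n (chart_im_open ac) (gram_smooth hg ac k)).
Qed.

Lemma is_derive_tmap c d z w : atlas c -> atlas d -> state_overlap c d z ->
  is_derive z w (tmap c d)
    (row_mx (lsubmx w *m 'J (trans c d) (lsubmx z))
      (rsubmx w *m 'J (trans c d) (lsubmx z) +
       rsubmx z *m 'D_(lsubmx w) (jacobian (trans c d)) (lsubmx z))).
Proof.
move=> ac ad zO; have oV := overlap_open ac ad.
have s1 := trans_smooth ac ad 1.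
apply: is_derive_row_mx.
  rewrite -(C1_deriveE (lsubmx w) oV s1 zO).
  exact: is_derive_comp_lsub w oV s1 zO.
apply: is_derive_mulmx; first exact: is_derive_rsub.
exact: is_derive_comp_lsub w oV (Ck_on_jacobian oV (trans_smooth ac ad 2)) zO.
Qed.

Lemma tmap_overlap c d z : atlas c -> state_overlap c d z ->
  state_overlap d c (tmap c d z).
Proof. by move=> ac zO; rewrite /state_overlap /= row_mxKl; exact: trans_overlap. Qed.

Lemma state_overlapl c d z : atlas c -> state_overlap c d z -> state_dom c z.
Proof. by move=> ac /(overlapP _ _ ac) []. Qed.

Lemma bil_gram_trans c d x u v : atlas c -> atlas d -> overlap c d x ->
  bil (gram g c x) u v =
  bil (gram g d (trans c d x)) (u *m 'J (trans c d) x) (v *m 'J (trans c d) x).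
Proof.
move=> ac ad [p [cp dp] <-].
rewrite (trans_map d ac cp) (gram_trans g ac ad cp dp); exact: bilM.
Qed.

Lemma derive_gram_trans c d x v : atlas c -> atlas d -> overlap c d x ->
  forall a b, bil ('D_v (gram g c) x) a b =
  bil (gram g d (trans c d x)) (a *m 'D_v (jacobian (trans c d)) x) (b *m 'J (trans c d) x) +
  bil ('D_(v *m 'J (trans c d) x) (gram g d) (trans c d x))
    (a *m 'J (trans c d) x) (b *m 'J (trans c d) x) +
  bil (gram g d (trans c d x)) (a *m 'J (trans c d) x) (b *m 'D_v (jacobian (trans c d)) x).
Proof.
move=> ac ad xO a b; have oV := overlap_open ac ad.
have s1 := trans_smooth ac ad 1.
have cx : chart_im c x by case/(overlapP _ _ ac): xO.
have dx : chart_im d (trans c d x) by case/(overlapP _ _ ad): (trans_overlap ac xO).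
have Jd := Ck_on_derivable v (Ck_on_jacobian oV (trans_smooth ac ad 2)) xO.
have Gd := C1_chain (chart_im_open ad) (gram_smooth hg ad 1) dx (Ck_on_derivable v s1 xO).
have am := is_derive_mulmx_cst a Jd.
have bm := is_derive_mulmx_cst b Jd.
have D1 := is_derive_bil Gd am bm.
have D2 := is_derive_bil_cst a b (Ck_on_derivable v (gram_smooth hg ac 1) cx).
have nE : \forall y \near x, bil (gram g c y) a b =
   bil ((gram g d \o trans c d) y) (a *m 'J (trans c d) y) (b *m 'J (trans c d) y).
  apply: filterS (open_nbhs_nbhs (conj oV xO)) => y yO.
  exact: (bil_gram_trans a b ac ad yO).
have := is_derive_unique (is_derive_ext nE D2) D1.
by rewrite (C1_deriveE v oV s1 xO).
Qed.

(* The spray is intrinsic: this is the transformation law of the Christoffel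
   symbols. *)
Lemma spray_tmap c d z : atlas c -> atlas d -> state_overlap c d z ->
  spray d (tmap c d z) = spray c z *m 'J (tmap c d) z.
Proof.
move=> ac ad zO; have oV := overlap_open ac ad.
rewrite -(C1_deriveE (spray c z) (state_overlap_open ac ad) (tmap_smooth ac ad 1) zO).
have [_ ->] := is_derive_tmap (spray c z) ac ad zO.
rewrite /spray /tmap !row_mxKl !row_mxKr.
set x := lsubmx z; set y := rsubmx z; set T := 'J (trans c d) x.
have xO : overlap c d x by exact: zO.
have cx : chart_im c x by case/(overlapP _ _ ac): xO.
have dx : chart_im d (trans c d x) by case/(overlapP _ _ ad): (trans_overlap ac xO).
congr row_mx; apply: (bil_inj (gram_unit hg ad dx)) => v'.
have Tu : T \in unitmx.
  by case: xO => p [cp dp] px; rewrite /T -px; exact: jacobian_trans_unit.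
(* Every test vector in the chart [d] is the image of one in [c], so both sides can be compared
   through the metric in [c]. *)
pose v := v' *m invmx T; have -> : v' = v *m T by rewrite mulmxKV.
rewrite bilNl (bil_chr hg _ _ ad dx) mulNmx bilDl bilNl.
have -> : bil (gram g d (trans c d x)) (chr g c x y y *m T) (v *m T) =
    bil (gram g c x) (chr g c x y y) v.
  exact: (esym (bil_gram_trans _ v ac ad xO)).
(* Differentiating the transformation law of the metric along [y] and along [v] gives [Dy] and [Dv].
   Schwarz's theorem gives [U2 = W] and symmetry of the metric [U = U2], so all second derivatives
   of the transition map cancel except [N]. *)
have key (P Q C N Dy Dv W U U2 : R) : C = Dy - 2^-1 * Dv -> Dy = N + P + W ->
    Dv = U + Q + U2 -> U2 = W -> U = U2 -> - (P - 2^-1 * Q) = - C + N.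
  by move=> -> -> -> -> ->; lra.
have S := derive_jacobianC y v oV (trans_smooth ac ad 2) xO.
apply: (key _ _ _ _ _ _ _ _ _ (bil_chr hg y v ac cx) (derive_gram_trans y ac ad xO y v)
  (derive_gram_trans v ac ad xO y y)).
  by rewrite S.
exact: bilC (gram_sym hg d _).
Qed.

Lemma energy_tmap c d z : atlas c -> atlas d -> state_overlap c d z ->
  energy d (tmap c d z) = energy c z.
Proof.
move=> ac ad zO; apply/rowP => i; rewrite (ord1 i).
rewrite /energy /tmap row_mxKl row_mxKr.
exact: (esym (bil_gram_trans _ _ ac ad zO)).
Qed.

Lemma derive_energy c z w : atlas c -> state_dom c z ->
  ('D_w (energy c) z) 0 0 = bil ('D_(lsubmx w) (gram g c) (lsubmx z)) (rsubmx z) (rsubmx z)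
   + 2 * bil (gram g c (lsubmx z)) (rsubmx z) (rsubmx w).
Proof.
move=> ac cz.
have D := is_derive_bil (is_derive_comp_lsub w (chart_im_open ac) (gram_smooth hg ac 1) cz)
  (is_derive_rsub z w) (is_derive_rsub z w).
have E := (is_derive_mxP _ _ _ _).1 (Ck_on_derivable w (energy_smooth ac 1) cz) 0 0.
rewrite (is_derive_unique E D) (bilC (rsubmx w) (rsubmx z) (gram_sym hg c _)); ring.
Qed.

(** Conservation of energy at the infinitesimal level: [bil_chr] with [v] equal to [y] turns the
    acceleration term into half the derivative of the metric along [y], which enters twice and with
    a minus sign. *)
Lemma energy_spray c z : atlas c -> state_dom c z -> spray c z *m 'J (energy c) z = 0.
Proof.
move=> ac cz.
rewrite -(C1_deriveE (spray c z) (state_dom_open ac) (energy_smooth ac 1) cz).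
apply/rowP => i; rewrite (ord1 i) mxE derive_energy// /spray row_mxKl row_mxKr.
rewrite (bilC _ (- _) (gram_sym hg c _)) bilNl (bil_chr hg _ _ ac cz); lra.
Qed.

End Spray.

(** * Geodesics as germs of solutions of the spray equation *)

Section Curves.
Variables (R : realType) (n : nat) (M : smoothManifold R n) (g : bilinear_field M).
Variable hg : lorentzian_metric g.
Implicit Types (c d e : chart R n M) (p : M) (zeta : R -> M) (s t : R).

Definition lift c zeta t : 'rV[R]_(n + n) :=
  row_mx (chart_map c (zeta t)) (derive1 (chart_map c \o zeta) t).

(** Holding on a neighborhood of [t], the property depends on the germ of [zeta] only and can be
    moved between charts and glued. Continuity of [zeta] is a separate clause because chart maps are
    total functions, and coordinates outside the chart domain say nothing about [zeta]. *)
Definition geod_at c zeta t : Prop := \forall s \near t,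
  [/\ chart_dom c (zeta s), {for s, continuous zeta} &
      is_derive s (1 : R) (lift c zeta) (spray g c (lift c zeta s))].

Lemma near_near (T : topologicalType) (x : T) (P : T -> Prop) :
  (\forall y \near x, P y) -> \forall y \near x, \forall z \near y, P z.
Proof. by move=> /nbhs_interior. Qed.

Lemma near_and (T : topologicalType) (x : T) (P Q : T -> Prop) :
  (\forall y \near x, P y) -> (\forall y \near x, Q y) ->
  \forall y \near x, P y /\ Q y.
Proof. exact: filterI. Qed.

Lemma is_derive1E (V : normedModType R) (f : R -> V) t df :
  is_derive t (1 : R) f df -> derive1 f t = df.
Proof. by rewrite derive1E => -[]. Qed.

Lemma derive1_ext (V : normedModType R) (f h : R -> V) t :
  (\forall s \near t, f s = h s) -> derive1 f t = derive1 h t.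
Proof. by move=> E; rewrite !derive1E; exact: near_eq_derive. Qed.

Lemma lsub_lift c zeta t : lsubmx (lift c zeta t) = chart_map c (zeta t).
Proof. by rewrite row_mxKl. Qed.

Lemma rsub_lift c zeta t : rsubmx (lift c zeta t) = derive1 (chart_map c \o zeta) t.
Proof. by rewrite row_mxKr. Qed.

Lemma geod_derive c zeta s :
  is_derive s (1 : R) (lift c zeta) (spray g c (lift c zeta s)) ->
  is_derive s (1 : R) (chart_map c \o zeta) (derive1 (chart_map c \o zeta) s).
Proof.
move=> /is_derive_lsubmx; rewrite /spray row_mxKl rsub_lift.
have -> // : (fun y : R => lsubmx (lift c zeta y)) = chart_map c \o zeta.
by apply/funext => y; rewrite lsub_lift.
Qed.

Lemma near_dom c zeta s : atlas c -> chart_dom c (zeta s) ->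
  {for s, continuous zeta} -> \forall r \near s, chart_dom c (zeta r).
Proof.
move=> ac cs zc; apply: zc; apply: open_nbhs_nbhs; split => //.
exact: chart_dom_open.
Qed.

Lemma lift_trans c d zeta s (v : 'rV[R]_n) : atlas c -> atlas d ->
  chart_dom c (zeta s) -> chart_dom d (zeta s) -> {for s, continuous zeta} ->
  is_derive s (1 : R) (chart_map c \o zeta) v ->
  lift d zeta s = tmap c d (lift c zeta s).
Proof.
move=> ac ad cs ds zc xd; rewrite /tmap lsub_lift rsub_lift (is_derive1E xd).
congr row_mx; first by rewrite trans_map.
have oV := overlap_open ac ad.
rewrite -(C1_deriveE v oV (trans_smooth ac ad 1) (overlap_map cs ds)).
have D := C1_chain oV (trans_smooth ac ad 1) (overlap_map cs ds) xd.
rewrite -(is_derive1E D); apply: derive1_ext.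
by apply: filterS (near_dom ac cs zc) => r cr; rewrite /= trans_map.
Qed.

Lemma geod_at_trans c d zeta t : atlas c -> atlas d ->
  geod_at c zeta t -> chart_dom d (zeta t) -> geod_at d zeta t.
Proof.
move=> ac ad H dt; have [_ zc _] := nbhs_singleton H.
have E := near_near (near_and H (near_dom ad dt zc)).
apply: filterS E => s E; have [[cs zcs zd] ds] := nbhs_singleton E.
have nE : \forall r \near s, tmap c d (lift c zeta r) = lift d zeta r.
  apply: filterS E => r [[cr zcr zdr] dr].
  exact: (esym (lift_trans ac ad cr dr zcr (geod_derive zdr))).
split; [exact: ds|exact: zcs|].
have sO : state_overlap c d (lift c zeta s).
  by rewrite /state_overlap /= lsub_lift; exact: overlap_map.
have oO := state_overlap_open ac ad.
have := C1_chain oO (tmap_smooth ac ad 1) sO zd.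
rewrite (C1_deriveE _ oO (tmap_smooth ac ad 1) sO) -(spray_tmap hg ac ad sO).
rewrite (nbhs_singleton nE) => D.
exact: is_derive_ext nE D.
Qed.

Lemma geod_at_ext c zeta zeta' t : (\forall s \near t, zeta s = zeta' s) ->
  geod_at c zeta t -> geod_at c zeta' t.
Proof.
move=> E H; apply: filterS2 H (near_near E) => s [cs zc zd] Es.
have lE : \forall r \near s, lift c zeta r = lift c zeta' r.
  apply: filterS (near_near Es) => r Er; rewrite /lift (nbhs_singleton Er).
  by congr row_mx; apply: derive1_ext; apply: filterS Er => q /= ->.
split; first by rewrite -(nbhs_singleton Es).
  exact: near_continuous Es zc.
by rewrite -(nbhs_singleton lE); exact: is_derive_ext lE zd.
Qed.

(** A solution of the first-order system automatically carries, as its second half, the derivative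
    of its first half. *)
Lemma lift_of_solution c zeta (z : R -> 'rV[R]_(n + n)) t : atlas c ->
  (\forall s \near t, state_dom c (z s) /\ is_derive s (1 : R) z (spray g c (z s))) ->
  (\forall s \near t, zeta s = chart_inv c (lsubmx (z s))) ->
  \forall s \near t, lift c zeta s = z s.
Proof.
move=> ac H E; apply: filterS (near_near (near_and H E)) => s Hs.
have [[cs zd] Es] := nbhs_singleton Hs.
rewrite /lift Es chart_invK// -[RHS]hsubmxK; congr row_mx.
have D := is_derive_lsubmx zd; rewrite /spray row_mxKl in D.
rewrite -(is_derive1E D); apply: derive1_ext.
by apply: filterS Hs => r [[cr _] Er]; rewrite /= Er chart_invK.
Qed.

Lemma geod_of_solution c zeta (z : R -> 'rV[R]_(n + n)) t : atlas c ->
  (\forall s \near t, state_dom c (z s) /\ is_derive s (1 : R) z (spray g c (z s))) ->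
  (\forall s \near t, zeta s = chart_inv c (lsubmx (z s))) ->
  geod_at c zeta t.
Proof.
move=> ac H E; have L := lift_of_solution ac H E.
apply: filterS (near_near (near_and (near_and H E) L)) => s Hs.
have [[[cs zd] Es] Ls] := nbhs_singleton Hs.
have nE : \forall r \near s, chart_inv c (lsubmx (z r)) = zeta r.
  by apply: filterS Hs => r [[_ ->] _].
have nL : \forall r \near s, z r = lift c zeta r.
  by apply: filterS Hs => r [_ ->].
split; first by rewrite Es; exact: chart_im_inv.
  apply: (near_continuous nE).
  apply: (@continuous_comp _ _ _ (fun r => lsubmx (z r)) (chart_inv c)).
    exact: is_derive1_continuous (is_derive_lsubmx zd).
  exact: chart_inv_continuous.
by rewrite Ls; exact: is_derive_ext nL zd.
Qed.

Lemma geodesic_on_geod (I : set R) zeta t c : open I -> geodesic_on g I zeta ->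
  I t -> atlas c -> chart_dom c (zeta t) -> geod_at c zeta t.
Proof.
move=> oI [zc H] It ac ct; have [xs xg] := H c ac.
have zcI s : I s -> {for s, continuous zeta} by move=> Is; apply: zc; exact: mem_set.
have nI : \forall s \near t, I s by exact: open_nbhs_nbhs.
apply: filterS2 nI (near_dom ac ct (zcI t It)) => s Is cs.
split; [by []|exact: zcI|].
have Ics : (I `&` zeta @^-1` chart_dom c) s by [].
have d1 := Ck_on_derivable (1 : R) (xs 1) Ics.
have d2 := Ck_on_derivable (1 : R) (Ck_on_derive (1 : R) (xs 2)) Ics.
have E1 : 'D_1 (chart_map c \o zeta) = derive1 (chart_map c \o zeta).
  by apply/funext => r; rewrite derive1E.
rewrite E1 in d2; rewrite -derive1E in d1.
have := is_derive_row_mx d1 d2.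
rewrite -[X in row_mx _ X](derive1E (derive1 (chart_map c \o zeta)) s).
have := xg s Ics; rewrite /covariant_derivative => /eqP.
rewrite addr_eq0 => /eqP ->.
rewrite /spray lsub_lift rsub_lift; exact.
Qed.

Lemma lift_smooth d (A : set R) zeta : atlas d -> open A ->
  (forall t, A t -> geod_at d zeta t) -> smooth_on A (lift d zeta).
Proof.
move=> ad oA H.
have zd t : A t -> chart_dom d (zeta t) /\
    is_derive t (1 : R) (lift d zeta) (spray g d (lift d zeta t)).
  by move=> /H /nbhs_singleton [].
apply: (bootstrap oA (fun t At => (zd t At).2)) => k zk.
apply: (Ck_on_comp oA (state_dom_open ad) _ zk (spray_smooth hg ad k)).
by move=> t /zd [dt _]; rewrite /state_dom /= lsub_lift; exact: chart_im_map.
Qed.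

Lemma geod_geodesic_on (I : set R) zeta : open I ->
  (forall t, I t -> exists2 c, atlas c & geod_at c zeta t) -> geodesic_on g I zeta.
Proof.
move=> oI H.
have zc t : I t -> {for t, continuous zeta}.
  by move=> /H [c _ /nbhs_singleton []].
split; first by move=> t /set_mem; exact: zc.
move=> d ad /=; set Ic := _ `&` _.
have Hd t : Ic t -> geod_at d zeta t.
  by move=> [/H [c ac Hc] dt]; exact: geod_at_trans ac ad Hc dt.
have oIc : open Ic.
  rewrite openE => t [It dt].
  apply: filterI; first exact: open_nbhs_nbhs.
  exact: near_dom ad dt (zc t It).
have ls := lift_smooth ad oIc Hd.
split=> [k|t It].
  apply: Ck_on_ext (Ck_on_lsubmx oIc (ls k)) => // t _; exact: lsub_lift.
have [_ _ zd] := nbhs_singleton (Hd t It).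
have := is_derive_rsubmx zd; rewrite /spray row_mxKr lsub_lift rsub_lift.
have -> : (fun y : R => rsubmx (lift d zeta y)) = derive1 (chart_map d \o zeta).
  by apply/funext => y; rewrite rsub_lift.
by move=> /is_derive1E; rewrite /covariant_derivative => ->; rewrite addNr.
Qed.

Lemma velocityE zeta t : velocity zeta t = rsubmx (lift (chart_at (zeta t)) zeta t).
Proof. by rewrite rsub_lift. Qed.

Lemma components_velocity c zeta t : atlas c -> geod_at c zeta t ->
  components c (velocity zeta t) = rsubmx (lift c zeta t).
Proof.
move=> ac H; have [ap pp] := chart_atP (zeta t).
have [ct zc zd] := nbhs_singleton H.
have [_ _ zd'] := nbhs_singleton (geod_at_trans ac ap H pp).
rewrite (lift_trans ap ac pp ct zc (geod_derive zd')) /tmap row_mxKr lsub_lift.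
by rewrite velocityE.
Qed.

Lemma metric_form_energy c zeta t : atlas c -> geod_at c zeta t ->
  metric_form g (velocity zeta t) (velocity zeta t) = energy g c (lift c zeta t) 0 0.
Proof.
move=> ac H; have [ct _ _] := nbhs_singleton H.
rewrite (metric_form_components g _ _ ac ct) (components_velocity ac H).
by rewrite /energy lsub_lift.
Qed.

Lemma constant_of_derive0 (f : R -> R) (a b : R) : a <= b ->
  (forall t, a <= t <= b -> is_derive t (1 : R) f 0) -> f b = f a.
Proof.
move=> ab fd; have [||c cI] := @MVT_segment R f (fun=> 0) a b ab.
- by move=> t; rewrite in_itv /= => /andP[at_ tb]; apply: fd; rewrite !ltW.
- by apply: derivable_within_continuous => t; rewrite in_itv /= => /fd [].
by rewrite mul0r => /eqP; rewrite subr_eq0 => /eqP.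
Qed.

(** No single chart need cover the curve, but [metric_form] of the velocity is independent of
    charts, so its derivative at each time is computed in any chart around the current point. *)
Lemma energy_constant zeta (a b : R) : a <= b ->
  (forall t, a <= t <= b -> exists2 c, atlas c & geod_at c zeta t) ->
  metric_form g (velocity zeta b) (velocity zeta b) =
  metric_form g (velocity zeta a) (velocity zeta a).
Proof.
move=> ab H.
apply: (@constant_of_derive0 (fun t => metric_form g (velocity zeta t) (velocity zeta t))) => //.
move=> t tI; have [c ac Hc] := H t tI.
have [ct _ zd] := nbhs_singleton Hc.
have oS := state_dom_open ac.
have sS : state_dom c (lift c zeta t).
  by rewrite /state_dom /= lsub_lift; exact: chart_im_map.
have D := C1_chain oS (energy_smooth hg ac 1) sS zd.
rewrite (C1_deriveE _ oS (energy_smooth hg ac 1) sS) (energy_spray hg ac sS) in D.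
have := (is_derive_mxP _ _ _ _).1 D 0 0; rewrite mxE; apply: is_derive_ext.
by apply: filterS (near_near Hc) => s Hs; rewrite (metric_form_energy ac Hs).
Qed.

End Curves.

(** * Jacobi fields *)

Section ContractionAlgebra.
Variables (R : realType) (n : nat).
Implicit Types (G H : 'I_n -> 'I_n -> 'I_n -> R) (u v w : 'rV[R]_n).

Definition contract G u v : 'rV[R]_n := \row_k \sum_i \sum_j G k i j * u 0 i * v 0 j.

Lemma contractC G u v : (forall k i j, G k i j = G k j i) -> contract G u v = contract G v u.
Proof.
move=> GS; apply/rowP => k; rewrite !mxE exchange_big; apply: eq_bigr => i _.
by apply: eq_bigr => j _; rewrite GS; ring.
Qed.

Lemma contractDr G u v w : contract G u (v + w) = contract G u v + contract G u w.
Proof.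
apply/rowP => k; rewrite !mxE -big_split; apply: eq_bigr => i _ /=.
by rewrite -big_split; apply: eq_bigr => j _ /=; rewrite mxE mulrDr.
Qed.

Lemma contractNl G u v : contract G (- u) v = - contract G u v.
Proof.
apply/rowP => k; rewrite !mxE -sumrN; apply: eq_bigr => i _.
by rewrite -sumrN; apply: eq_bigr => j _; rewrite mxE; ring.
Qed.

Lemma is_derive_contract (V : normedModType R) (G : V -> 'I_n -> 'I_n -> 'I_n -> R)
    (u v : V -> 'rV[R]_n) x h dG du dv :
  (forall k i j, is_derive x h (fun y => G y k i j) (dG k i j)) ->
  is_derive x h u du -> is_derive x h v dv ->
  is_derive x h (fun y => contract (G y) (u y) (v y))
   (contract dG (u x) (v x) + contract (G x) du (v x) + contract (G x) (u x) dv).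
Proof.
move=> Gd /is_derive_mxP ud /is_derive_mxP vd; apply/is_derive_mxP => a k.
have -> : (fun y => contract (G y) (u y) (v y) a k) = \sum_i \sum_j
   ((fun y => G y k i j) * (fun y => u y 0 i) * (fun y => v y 0 j)).
  apply/funext => y; rewrite mxE fct_sumE; apply: eq_bigr => i _.
  by rewrite fct_sumE.
have -> : (contract dG (u x) (v x) + contract (G x) du (v x) + contract (G x) (u x) dv) a k =
  \sum_i \sum_j ((G x k i j * u x 0 i) *: dv 0 j + v x 0 j *: (G x k i j *: du 0 i + u x 0 i *: dG k i j)).
  rewrite !mxE -!big_split; apply: eq_bigr => i _ /=.
  rewrite -!big_split; apply: eq_bigr => j _ /=; rewrite /GRing.scale /=; ring.
apply: is_derive_sum => i; apply: is_derive_sum => j.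
exact: (is_deriveM (is_deriveM (Gd k i j) (ud 0 i)) (vd 0 j)).
Qed.

(** Sorts the curvature term into contractions, the form in which it meets the second covariant
    derivative. [dG i] stands for the partial derivatives of [G] in the direction [i]. *)
Lemma curvature_contract (G : 'I_n -> 'I_n -> 'I_n -> R)
    (dG : 'I_n -> 'I_n -> 'I_n -> 'I_n -> R) (J y : 'rV[R]_n) :
  \row_l \sum_i \sum_j \sum_k (dG i l j k - dG j l i k +
     \sum_m (G m j k * G l i m - G m i k * G l j m)) * J 0 i * y 0 j * y 0 k =
  contract (fun l j k => \sum_i J 0 i * dG i l j k) y y
  - contract (fun l i k => \sum_j y 0 j * dG j l i k) J y
  + contract G J (contract G y y) - contract G y (contract G J y).
Proof.
have T1 : contract (fun l j k => \sum_i J 0 i * dG i l j k) y y =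
   \row_l \sum_i \sum_j \sum_k dG i l j k * J 0 i * y 0 j * y 0 k.
  apply/rowP => l; rewrite !mxE [RHS]exchange_big; apply: eq_bigr => j _ /=.
  rewrite [RHS]exchange_big; apply: eq_bigr => k _ /=.
  by rewrite !mulr_suml; apply: eq_bigr => i _; ring.
have T2 : contract (fun l i k => \sum_j y 0 j * dG j l i k) J y =
   \row_l \sum_i \sum_j \sum_k dG j l i k * J 0 i * y 0 j * y 0 k.
  apply/rowP => l; rewrite !mxE; apply: eq_bigr => i _.
  rewrite [RHS]exchange_big; apply: eq_bigr => k _ /=.
  by rewrite !mulr_suml; apply: eq_bigr => j _; ring.
have T3 : contract G J (contract G y y) =
   \row_l \sum_i \sum_j \sum_k \sum_m G m j k * G l i m * J 0 i * y 0 j * y 0 k.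
  apply/rowP => l; rewrite !mxE; apply: eq_bigr => i _.
  under [RHS]eq_bigr => j _ do rewrite exchange_big.
  rewrite [RHS]exchange_big; apply: eq_bigr => m _ /=.
  rewrite !mxE mulr_sumr; apply: eq_bigr => j _; rewrite mulr_sumr.
  by apply: eq_bigr => k _; ring.
have T4 : contract G y (contract G J y) =
   \row_l \sum_i \sum_j \sum_k \sum_m G m i k * G l j m * J 0 i * y 0 j * y 0 k.
  apply/rowP => l; rewrite !mxE [RHS]exchange_big; apply: eq_bigr => j _ /=.
  under [RHS]eq_bigr => i _ do rewrite exchange_big.
  rewrite [RHS]exchange_big; apply: eq_bigr => m _ /=.
  rewrite !mxE mulr_sumr; apply: eq_bigr => i _; rewrite mulr_sumr.
  by apply: eq_bigr => k _; ring.
rewrite T1 T2 T3 T4; apply/rowP => l; rewrite !mxE -!(sumrB, big_split).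
apply: eq_bigr => i _ /=; rewrite -!(sumrB, big_split); apply: eq_bigr => j _ /=.
rewrite -!(sumrB, big_split); apply: eq_bigr => k _ /=.
rewrite sumrB -!mulr_suml; ring.
Qed.

(* [dJ], [ddJ] stand for the first two derivatives of the coordinates of the
   field, [ddJ] being given by the linearized geodesic equation. *)
Lemma jacobi_algebra (G GJ Gy : 'I_n -> 'I_n -> 'I_n -> R) (J dJ y : 'rV[R]_n) :
  (forall k i j, G k i j = G k j i) -> (forall k i j, Gy k i j = Gy k j i) ->
  - (contract GJ y y + contract G dJ y + contract G y dJ) +
  (contract Gy y J + contract G (- contract G y y) J + contract G y dJ) +
  contract G y (dJ + contract G y J) +
  (contract GJ y y - contract Gy J y + contract G J (contract G y y) -
   contract G y (contract G J y)) = 0.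
Proof.
move=> GS GyS; rewrite (contractC dJ y GS) (contractC J y GyS) (contractC J y GS).
rewrite (contractC J (contract G y y) GS) contractNl contractDr.
set a := contract GJ y y; set b := contract G y dJ; set c := contract Gy y J.
set d := contract G (contract G y y) J; set e := contract G y _.
by apply/rowP => i; rewrite !mxE; ring.
Qed.

End ContractionAlgebra.

Section ScalarChain.
Variables (R : realType).

Lemma Ck_on_scalar_mx (V : normedModType R) k (A : set V) (f : V -> R) : open A ->
  Ck_on k A f -> Ck_on k A (fun x => (f x)%:M : 'M[R]_1).
Proof.
move=> oA fC; apply/Ck_on_mxP => // i j; apply: Ck_on_ext fC => // x _.
by rewrite (ord1 i) (ord1 j) mxE eqxx.
Qed.

Lemma derive_scalar_mx (V : normedModType R) (f : V -> R) x v df :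
  is_derive x v (fun y => (f y)%:M : 'M[R]_1) df -> is_derive x v f (df 0 0).
Proof.
move=> /is_derive_mxP /(_ 0 0).
have -> // : (fun y => ((f y)%:M : 'M[R]_1) 0 0) = f.
by apply/funext => y; rewrite mxE eqxx.
Qed.

Lemma C1_chain_scalar (V : normedModType R) m (B : set 'rV[R]_m) (f : 'rV[R]_m -> R)
    (u : V -> 'rV[R]_m) x v du : open B -> Ck_on 1 B f -> B (u x) ->
  is_derive x v u du -> is_derive x v (fun y => f (u y)) ('D_du f (u x)).
Proof.
move=> oB fC Bx ud; have fC' := Ck_on_scalar_mx oB fC.
have := derive_scalar_mx (C1_chain oB fC' Bx ud) => /is_derive_eq; apply.
by have [_ <-] := derive_scalar_mx (Ck_on_derivable du fC' Bx).
Qed.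

Lemma derive_sum_delta_scalar m (B : set 'rV[R]_m) (f : 'rV[R]_m -> R) x v :
  open B -> Ck_on 1 B f -> B x ->
  'D_v f x = \sum_(i < m) v 0 i * 'D_(delta_mx 0 i) f x.
Proof.
move=> oB fC Bx; have fC' := Ck_on_scalar_mx oB fC.
have E w : 'D_w f x = ('D_w (fun y => (f y)%:M : 'M[R]_1) x) 0 0.
  by have [_ <-] := derive_scalar_mx (Ck_on_derivable w fC' Bx).
rewrite E (derive_sum_delta v oB fC' Bx) summxE; apply: eq_bigr => i _.
by rewrite mxE E.
Qed.

Lemma mulmx_jacobian_congr m p (F : 'rV[R]_m -> 'rV[R]_p) (a b z z' : 'rV[R]_m) :
  a = b -> z = z' -> a *m 'J F z = b *m 'J F z'.
Proof. by move=> -> ->. Qed.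

End ScalarChain.

(** * Jacobi fields as solutions of the linearized spray equation *)

Section JacobiFields.
Variables (R : realType) (n : nat) (M : smoothManifold R n) (g : bilinear_field M).
Variable hg : lorentzian_metric g.
Variables (gamma : R -> M) (I : set R).
Variable oI : open I.
Variable gI : forall t c, I t -> atlas c -> chart_dom c (gamma t) -> geod_at g c gamma t.
Implicit Types (c d e : chart R n M) (p : M) (s t : R) (J : forall t, tangent (gamma t)).

(** The second half is the plain coordinate derivative, not the covariant one: with this choice the
    equation in a chart is exactly the linearization of the spray along [lift c gamma]. *)
Definition jlift c J t : 'rV[R]_(n + n) :=
  row_mx (components c (J t)) (derive1 (fun s => components c (J s)) t).

Definition jac_at c J t : Prop := \forall s \near t,
  chart_dom c (gamma s) /\
  is_derive s (1 : R) (jlift c J) (jlift c J s *m 'J (spray g c) (lift c gamma s)).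

Lemma lsub_jlift c J t : lsubmx (jlift c J t) = components c (J t).
Proof. by rewrite row_mxKl. Qed.

Lemma rsub_jlift c J t : rsubmx (jlift c J t) = derive1 (fun s => components c (J s)) t.
Proof. by rewrite row_mxKr. Qed.

Lemma components_trans c d p (v : tangent p) : atlas c -> atlas d ->
  chart_dom c p -> chart_dom d p ->
  components d v = components c v *m 'J (trans c d) (chart_map c p).
Proof.
move=> ac ad cp dp; have [ap pp] := chart_atP p.
by rewrite /components -mulmxA (jacobian_cocycle ap ac ad pp cp dp).
Qed.

Lemma lift_dom c s : chart_dom c (gamma s) -> state_dom c (lift c gamma s).
Proof. by move=> cs; rewrite /state_dom /= lsub_lift; exact: chart_im_map. Qed.

Lemma lift_overlap c d s : chart_dom c (gamma s) -> chart_dom d (gamma s) ->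
  state_overlap c d (lift c gamma s).
Proof. by move=> cs ds; rewrite /state_overlap /= lsub_lift; exact: overlap_map. Qed.

Lemma lsub_linear_spray c (z w : 'rV[R]_(n + n)) : atlas c -> state_dom c z ->
  lsubmx (w *m 'J (spray g c) z) = rsubmx w.
Proof.
move=> ac cz; have oS := state_dom_open ac.
rewrite -(C1_deriveE w oS (spray_smooth hg ac 1) cz).
have D := is_derive_lsubmx (Ck_on_derivable w (spray_smooth hg ac 1) cz).
apply: is_derive_unique D _.
have -> : (fun y : 'rV[R]_(n + n) => lsubmx (spray g c y)) = (fun y => rsubmx y).
  by apply/funext => y; rewrite row_mxKl.
exact: is_derive_rsub.
Qed.

Lemma rsub_linear_spray c (z w : 'rV[R]_(n + n)) : atlas c -> state_dom c z ->
  rsubmx (w *m 'J (spray g c) z) =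
  - (contract (fun k i j => 'D_(lsubmx w) (christoffel g c k i j) (lsubmx z))
       (rsubmx z) (rsubmx z)
    + contract (fun k i j => christoffel g c k i j (lsubmx z)) (rsubmx w) (rsubmx z)
    + contract (fun k i j => christoffel g c k i j (lsubmx z)) (rsubmx z) (rsubmx w)).
Proof.
move=> ac cz; have oS := state_dom_open ac.
rewrite -(C1_deriveE w oS (spray_smooth hg ac 1) cz).
have D := is_derive_rsubmx (Ck_on_derivable w (spray_smooth hg ac 1) cz).
apply: is_derive_unique D _.
have -> : (fun y : 'rV[R]_(n + n) => rsubmx (spray g c y)) =
    - (fun y => contract (fun k i j => christoffel g c k i j (lsubmx y)) (rsubmx y) (rsubmx y)).
  by apply/funext => y; rewrite row_mxKr.
apply: is_deriveN; apply: (@is_derive_contract R n _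
   (fun y k i j => christoffel g c k i j (lsubmx y))); [|exact: is_derive_rsub|exact: is_derive_rsub].
move=> k i j.
have D0 := is_derive_lsubmx (is_derive_id z w).
exact: (C1_chain_scalar (chart_im_open ac) (christoffel_smooth hg 1 k i j ac) cz D0).
Qed.

Lemma rsub_linear_spray_row c (x y J dJ : 'rV[R]_n) : atlas c -> chart_im c x ->
  rsubmx (row_mx J dJ *m 'J (spray g c) (row_mx x y)) =
  - (contract (fun k i j => 'D_J (christoffel g c k i j) x) y y
    + contract (fun k i j => christoffel g c k i j x) dJ y
    + contract (fun k i j => christoffel g c k i j x) y dJ).
Proof.
move=> ac cx; rewrite rsub_linear_spray//; first by rewrite !row_mxKl !row_mxKr.
by rewrite /state_dom /= row_mxKl.
Qed.

Lemma jac_derive c J s : atlas c -> chart_dom c (gamma s) ->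
  is_derive s (1 : R) (jlift c J) (jlift c J s *m 'J (spray g c) (lift c gamma s)) ->
  is_derive s (1 : R) (fun r => components c (J r)) (rsubmx (jlift c J s)).
Proof.
move=> ac cs /is_derive_lsubmx; rewrite (lsub_linear_spray _ ac (lift_dom cs)).
have -> // : (fun y : R => lsubmx (jlift c J y)) = (fun r => components c (J r)).
by apply/funext => y; rewrite lsub_jlift.
Qed.

(** The pair formed by the field and its derivative is a tangent vector to the tangent bundle, so it
    changes by the differential of [tmap]. The product rule yields this up to the order of the two
    arguments of the second derivative of the transition map. *)
Lemma jlift_trans c d J s : atlas c -> atlas d -> I s ->
  chart_dom c (gamma s) -> chart_dom d (gamma s) ->
  is_derive s (1 : R) (fun r => components c (J r)) (rsubmx (jlift c J s)) ->
  jlift d J s = jlift c J s *m 'J (tmap c d) (lift c gamma s).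
Proof.
move=> ac ad Is cs ds Jd; have zO := lift_overlap cs ds.
rewrite -(C1_deriveE _ (state_overlap_open ac ad) (tmap_smooth ac ad 1) zO).
have [_ ->] := is_derive_tmap (jlift c J s) ac ad zO.
rewrite lsub_lift lsub_jlift rsub_lift [LHS]/jlift.
rewrite (components_trans _ ac ad cs ds); congr row_mx.
have [_ zc zd] := nbhs_singleton (gI Is ac cs).
have oV := overlap_open ac ad; have xO := overlap_map cs ds.
have JC := Ck_on_jacobian oV (trans_smooth ac ad 2).
have D := is_derive_mulmx Jd (C1_chain oV JC xO (geod_derive zd)).
rewrite (derive_jacobianC _ _ oV (trans_smooth ac ad 2) xO) -(is_derive1E D).
apply: derive1_ext.
apply: filterS2 (near_dom ac cs zc) (near_dom ad ds zc) => r cr dr.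
exact: components_trans.
Qed.

Lemma jac_at_trans c d J t : atlas c -> atlas d -> I t ->
  jac_at c J t -> chart_dom d (gamma t) -> jac_at d J t.
Proof.
move=> ac ad It H dt; have [ct _] := nbhs_singleton H.
have [_ zc _] := nbhs_singleton (gI It ac ct).
have nI : \forall s \near t, I s by exact: open_nbhs_nbhs.
have N := near_near (near_and (near_and H nI) (near_dom ad dt zc)).
apply: filterS N => s N; have [[[cs Jd] Is] ds] := nbhs_singleton N.
have nE : \forall r \near s, jlift c J r *m 'J (tmap c d) (lift c gamma r) = jlift d J r.
  apply: filterS N => r [[[cr Jr] Ir] dr].
  exact: (esym (jlift_trans ac ad Ir cr dr (jac_derive ac cr Jr))).
split; first exact: ds.
have [_ zcs zd] := nbhs_singleton (gI Is ac cs).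
have D := linearized_push (state_overlap_open ac ad) (state_dom_open ad)
  (Ck_on_sub (fun z => state_overlapl ac (z := z)) (spray_smooth hg ac 1))
  (spray_smooth hg ad 1) (tmap_smooth ac ad 2)
  (fun z zO => state_overlapl ad (tmap_overlap ac zO))
  (fun z => spray_tmap hg ac ad (z := z)) (lift_overlap cs ds) zd Jd.
have L := lift_trans ac ad cs ds zcs (geod_derive zd).
have E := mulmx_jacobian_congr (spray g d) (nbhs_singleton nE) (esym L).
exact: (is_derive_eq (is_derive_ext nE D) E).
Qed.

Lemma jac_at_ext c J J' t : (\forall s \near t, J s = J' s) ->
  jac_at c J t -> jac_at c J' t.
Proof.
move=> E H; apply: filterS2 H (near_near E) => s [cs Jd] Es.
have lE : \forall r \near s, jlift c J r = jlift c J' r.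
  apply: filterS (near_near Es) => r Er; rewrite /jlift (nbhs_singleton Er).
  by congr row_mx; apply: derive1_ext; apply: filterS Er => q /= ->.
split; first exact: cs.
by rewrite -(nbhs_singleton lE); exact: is_derive_ext lE Jd.
Qed.

Lemma jlift_of_solution c J (w : R -> 'rV[R]_(n + n)) t : atlas c ->
  (\forall s \near t, chart_dom c (gamma s) /\
     is_derive s (1 : R) w (w s *m 'J (spray g c) (lift c gamma s))) ->
  (\forall s \near t, components c (J s) = lsubmx (w s)) ->
  \forall s \near t, jlift c J s = w s.
Proof.
move=> ac H E; apply: filterS (near_near (near_and H E)) => s Hs.
have [[cs wd] Es] := nbhs_singleton Hs.
rewrite /jlift Es -[RHS]hsubmxK; congr row_mx.
have D := is_derive_lsubmx wd.
rewrite (lsub_linear_spray _ ac (lift_dom cs)) in D.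
by rewrite -(is_derive1E D); apply: derive1_ext; apply: filterS Hs => r [_ ->].
Qed.

Lemma jac_of_solution c J (w : R -> 'rV[R]_(n + n)) t : atlas c ->
  (\forall s \near t, chart_dom c (gamma s) /\
     is_derive s (1 : R) w (w s *m 'J (spray g c) (lift c gamma s))) ->
  (\forall s \near t, components c (J s) = lsubmx (w s)) ->
  jac_at c J t.
Proof.
move=> ac H E; have L := jlift_of_solution ac H E.
apply: filterS (near_near (near_and H L)) => s Hs.
have [[cs wd] Ls] := nbhs_singleton Hs.
have nL : \forall r \near s, w r = jlift c J r by apply: filterS Hs => r [_ ->].
by split; [exact: cs|rewrite Ls; exact: is_derive_ext nL wd].
Qed.

Lemma christoffelC c k i j : christoffel g c k i j = christoffel g c k j i.
Proof.
apply/funext => x; rewrite /christoffel; congr (_ * _); apply: eq_bigr => l _.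
have E : (fun y => gram g c y i j) = (fun y => gram g c y j i).
  by apply/funext => y; exact: sym_entry (gram_sym hg c y).
congr (_ * _); rewrite E; congr (_ - _); exact: addrC.
Qed.

(** Conjugacy asks for a field satisfying the covariant equation, while the flow produces solutions
    of the linearized equation in charts. After expansion in Christoffel symbols the two agree by
    [jacobi_algebra]. *)
Lemma jacobi_of_jac_at J (K : set R) : open K -> K `<=` I ->
  (forall t, K t -> exists2 c, atlas c & jac_at c J t) -> jacobi_field_on g K J.
Proof.
move=> oK KI H d ad /=; set Ic := _ `&` _.
have Hd t : Ic t -> [/\ I t, geod_at g d gamma t & jac_at d J t].
  move=> [Kt dt]; have [c ac Hc] := H t Kt; have It := KI t Kt.
  by split; [|exact: gI|exact: jac_at_trans ac ad It Hc dt].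
have oIc : open Ic.
  rewrite openE => t Ict; have [It Gt _] := Hd t Ict; have [Kt dt] := Ict.
  have [_ zc _] := nbhs_singleton Gt.
  by apply: filterI; [exact: open_nbhs_nbhs|exact: near_dom ad dt zc].
have oS := state_dom_open ad.
have ls := lift_smooth hg ad oIc (fun t h => let: And3 _ G _ := Hd t h in G).
have Jd t : Ic t -> chart_dom d (gamma t) /\
    is_derive t (1 : R) (jlift d J) (jlift d J t *m 'J (spray g d) (lift d gamma t)).
  by move=> /Hd [_ _ /nbhs_singleton].
have Jls : smooth_on Ic (jlift d J).
  apply: (bootstrap oIc (fun t h => (Jd t h).2)) => k wk.
  apply: Ck_on_mulmx => //.
  apply: (Ck_on_comp oIc oS _ (ls k) (Ck_on_jacobian oS (spray_smooth hg ad k.+1))).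
  by move=> t /Jd [dt _]; exact: lift_dom.
split=> [k|t Ict].
  by apply: Ck_on_ext (Ck_on_lsubmx oIc (Jls k)) => // t _; exact: lsub_jlift.
have [It Gt Jt] := Hd t Ict.
have [dt Jdt] := Jd t Ict; have [_ _ zd] := nbhs_singleton Gt.
pose x := chart_map d \o gamma; pose y := derive1 x.
pose Jc s := components d (J s); pose dJ := derive1 Jc.
pose G s k i j := christoffel g d k i j (x s).
have xd : is_derive t (1 : R) x (y t) by exact: geod_derive zd.
have yd : is_derive t (1 : R) y (- contract (G t) (y t) (y t)).
  have := is_derive_rsubmx zd; rewrite [spray _ _ _]/spray row_mxKr lsub_lift rsub_lift.
  have -> // : (fun s : R => rsubmx (lift d gamma s)) = y.
  by apply/funext => s; rewrite rsub_lift.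
have nJ : \forall s \near t, is_derive s (1 : R) Jc (dJ s).
  apply: filterS Jt => s [ds Js]; have := jac_derive ad ds Js.
  by rewrite rsub_jlift.
have Jcd := nbhs_singleton nJ.
pose GJ k i j : R := 'D_(Jc t) (christoffel g d k i j) (x t).
pose Gy k i j : R := 'D_(y t) (christoffel g d k i j) (x t).
have dx : chart_im d (x t) by exact: chart_im_map.
have dJd : is_derive t (1 : R) dJ
   (- (contract GJ (y t) (y t) + contract (G t) (dJ t) (y t) + contract (G t) (y t) (dJ t))).
  rewrite -(rsub_linear_spray_row (y t) (Jc t) (dJ t) ad dx).
  have := is_derive_rsubmx Jdt.
  have -> // : (fun s : R => rsubmx (jlift d J s)) = dJ.
  by apply/funext => s; rewrite rsub_jlift.
have cs k i j := christoffel_smooth hg 1 k i j ad.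
have Gd k i j : is_derive t (1 : R) (fun s => G s k i j) (Gy k i j).
  exact: (C1_chain_scalar (chart_im_open ad) (cs k i j) dx xd).
have D1 := is_deriveD dJd (is_derive_contract Gd yd Jcd).
have E1 : derive1 (covariant_derivative g d gamma Jc) t =
    - (contract GJ (y t) (y t) + contract (G t) (dJ t) (y t) + contract (G t) (y t) (dJ t)) +
    (contract Gy (y t) (Jc t) + contract (G t) (- contract (G t) (y t) (y t)) (Jc t) +
     contract (G t) (y t) (dJ t)) by exact: is_derive1E D1.
(* By conversion, both the outer and the inner covariant derivative are a coordinate derivative plus
   a [contract] term. *)
rewrite [X in X + _](_ : _ = derive1 (covariant_derivative g d gamma Jc) t +
   contract (G t) (y t) (dJ t + contract (G t) (y t) (Jc t))) //.
rewrite E1 [X in _ + X](_ : _ = contract GJ (y t) (y t) - contract Gy (Jc t) (y t) +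
   contract (G t) (Jc t) (contract (G t) (y t) (y t)) -
   contract (G t) (y t) (contract (G t) (Jc t) (y t))).
  apply: jacobi_algebra => k i j; first by rewrite /G christoffelC.
  by rewrite /Gy christoffelC.
have GE v k i j : 'D_v (christoffel g d k i j) (x t) =
    \sum_l v 0 l * partial l (christoffel g d k i j) (x t).
  exact: (derive_sum_delta_scalar v (chart_im_open ad) (cs k i j) dx).
have -> : GJ = fun k i j => \sum_l Jc t 0 l * partial l (christoffel g d k i j) (x t).
  by apply/funext => k; apply/funext => i; apply/funext => j; exact: GE.
have -> : Gy = fun k i j => \sum_l y t 0 l * partial l (christoffel g d k i j) (x t).
  by apply/funext => k; apply/funext => i; apply/funext => j; exact: GE.
by rewrite -(curvature_contract (G t) (fun l k i j => partial l (christoffel g d k i j) (x t))).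
Qed.

End JacobiFields.

(** * The geodesic flow and its differential *)

Section Glue.
Variables (R : realType).

Definition glue (X : Type) (t : R) (f1 f2 : R -> X) (s : R) : X :=
  if s <= t then f1 s else f2 s.

(** Agreement near [t], not merely at [t], gives the glued function at every time the germ of one of
    the two pieces, and at [t] the germ of both, so properties of germs pass through the joint. *)
Lemma glue_near (X : Type) (t : R) (f1 f2 : R -> X) :
  (\forall s \near t, f1 s = f2 s) -> forall s,
  (s <= t -> \forall r \near s, glue t f1 f2 r = f1 r) /\
  (t <= s -> \forall r \near s, glue t f1 f2 r = f2 r).
Proof.
move=> E s.
have nlt (u v : R) : u < v -> \forall r \near u, r < v.
  move=> uv; apply/near_RP; exists (v - u); first by rewrite subr_gt0.
  move=> y; rewrite ltr_norml => /andP[_ h]; lra.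
have ngt (u v : R) : u < v -> \forall r \near v, u < r.
  move=> uv; apply/near_RP; exists (v - u); first by rewrite subr_gt0.
  move=> y; rewrite ltr_norml => /andP[h _]; lra.
split=> [|]; rewrite le_eqVlt => /orP[/eqP st|st].
- rewrite st; apply: filterS E => r Er; rewrite /glue.
  by case: ifP.
- apply: filterS (nlt _ _ st) => r rt; rewrite /glue (ltW rt).
  by [].
- rewrite -st; apply: filterS E => r Er; rewrite /glue.
  by case: ifP.
- apply: filterS (ngt _ _ st) => r rt; rewrite /glue leNgt rt.
  by [].
Qed.

Lemma strict_diff_continuous m p (f : 'rV[R]_m -> 'rV[R]_p) x L :
  strict_diff f x L -> {for x, continuous f}.
Proof.
move=> /strict_diff_lipschitz [d [c [d0 c0 H]]]; apply: dist_continuous => e e0.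
apply/near_normP; exists (Num.min d (e / c)); first by rewrite lt_min d0 divr_gt0.
move=> y; rewrite lt_min => /andP[yd ye].
apply: le_lt_trans (H y x yd _) _; first by rewrite subrr normr0.
by rewrite mulrC -ltr_pdivlMr.
Qed.

Lemma strict_diff_ext m p (f h : 'rV[R]_m -> 'rV[R]_p) x L :
  (\forall y \near x, f y = h y) -> strict_diff f x L -> strict_diff h x L.
Proof.
move=> /near_normP [r r0 E] fL e e0; have [d d0 H] := fL e e0.
exists (Num.min r d); first by rewrite lt_min r0.
move=> u w; rewrite !lt_min => /andP[ur ud] /andP[wr wd].
by rewrite -(E u ur) -(E w wr); exact: H.
Qed.

(** Compactness of [[a, b]] for a relation that is local and transitive. The supremum of the
    reachable points is itself reachable, by composing with a short step across it, and it cannot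
    lie below [b]. *)
Lemma interval_induction (P : R -> R -> Prop) (a b : R) : a <= b ->
  (forall t, a <= t <= b -> exists2 d : R, 0 < d & forall s s', t - d < s ->
     s <= s' -> s' < t + d -> P s s') ->
  (forall s t s', s <= t -> t <= s' -> P s t -> P t s' -> P s s') ->
  P a b.
Proof.
move=> ab loc tr.
pose A : set R := [set x | a <= x <= b /\ P a x].
have Aa : A a.
  split; first by rewrite lexx ab.
  have [|d d0 H] := loc a; first by rewrite lexx ab.
  by apply: H; rewrite ?ltrDl// ltrBlDr ltrDl.
have Ab : has_sup A.
  by split; [exists a|exists b => x [/andP[]]].
pose s := sup A.
have as_ : a <= s by apply: ub_le_sup => //; case: Ab.
have sb : s <= b by apply: ge_sup; [exists a|move=> x [/andP[]]].
have [|d d0 H] := loc s; first by rewrite as_ sb.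
have [x [/andP[ax xb] Pax] sx] := sup_adherent d0 Ab.
have xs : x <= s by apply: ub_le_sup; [case: Ab|split; [rewrite ax xb|]].
have ext y : s <= y -> y < s + d -> P a y.
  move=> sy yd; apply: (tr a x y ax (le_trans xs sy) Pax).
  by apply: H; [exact: sx|exact: le_trans xs sy|exact: yd].
have [bd|bd] := ltP b (s + d); first exact: ext.
have sy : s <= s + d / 2 by rewrite lerDl divr_ge0// ltW.
have Py : A (s + d / 2).
  split; last by apply: ext => //; lra.
  by rewrite (le_trans as_ sy); lra.
have : s + d / 2 <= s by apply: ub_le_sup => //; case: Ab.
lra.
Qed.

End Glue.

(** * Uniqueness, gluing and composition of flows *)

Section Propagation.
Variables (R : realType) (n : nat) (M : smoothManifold R n) (g : bilinear_field M).
Variable hg : lorentzian_metric g.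
Variables (gamma : R -> M) (I : set R).
Variable oI : open I.
Variable gI : forall t c, I t -> atlas c -> chart_dom c (gamma t) -> geod_at g c gamma t.
Implicit Types (c d e : chart R n M) (p : M) (s t : R) (J : forall t, tangent (gamma t)).

(** The margin [e] beyond both ends makes the endpoints interior times, as in the definition of
    geodesic segments. *)
Definition geod_near a b (zeta : R -> M) : Prop := exists2 e : R, 0 < e &
  forall t, a - e < t < b + e -> exists2 c, atlas c & geod_at g c zeta t.

Definition jac_near a b J : Prop := exists2 e : R, 0 < e &
  forall t, a - e < t < b + e -> exists2 c, atlas c & jac_at g c J t.

Lemma lift_ext c (zeta zeta' : R -> M) t : (\forall s \near t, zeta s = zeta' s) ->
  lift c zeta t = lift c zeta' t.
Proof.
move=> E; rewrite /lift (nbhs_singleton E); congr row_mx; apply: derive1_ext.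
by apply: filterS E => s /= ->.
Qed.

Lemma jlift_ext c J J' t : (\forall s \near t, J s = J' s) ->
  jlift c J t = jlift c J' t.
Proof.
move=> E; rewrite /jlift (nbhs_singleton E); congr row_mx; apply: derive1_ext.
by apply: filterS E => s /= ->.
Qed.

Lemma geod_unique c (z1 z2 : R -> M) t : atlas c -> geod_at g c z1 t ->
  geod_at g c z2 t -> lift c z1 t = lift c z2 t -> \forall s \near t, z1 s = z2 s.
Proof.
move=> ac H1 H2 E; have [c1 _ _] := nbhs_singleton H1.
have O1 : state_dom c (lift c z1 t).
  by rewrite /state_dom /= lsub_lift; exact: chart_im_map.
have D1 : \forall s \near t, is_derive s (1 : R) (lift c z1) (spray g c (lift c z1 s)).
  by apply: filterS H1 => s [].
have D2 : \forall s \near t, is_derive s (1 : R) (lift c z2) (spray g c (lift c z2 s)).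
  by apply: filterS H2 => s [].
have U := ode_unique (state_dom_open ac) (spray_smooth hg ac 1) O1 E D1 D2.
apply: filterS (near_and U (near_and H1 H2)) => s [Es [[d1 _ _] [d2 _ _]]].
by rewrite -(chart_mapK ac d1) -(chart_mapK ac d2) -!lsub_lift Es.
Qed.

(** The linear equation has a coefficient matrix bounded near [t], hence a Lipschitz constant there.
    Equality of components in the chart then gives equality of tangent vectors, the change of
    components being invertible. *)
Lemma jac_unique c J1 J2 t : atlas c -> I t -> jac_at g c J1 t ->
  jac_at g c J2 t -> jlift c J1 t = jlift c J2 t -> \forall s \near t, J1 s = J2 s.
Proof.
move=> ac It H1 H2 E; have [ct _] := nbhs_singleton H1.
have [_ zc zd] := nbhs_singleton (gI It ac ct).
pose A s := 'J (spray g c) (lift c gamma s).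
have Ac : {for t, continuous A}.
  apply: (@continuous_comp _ _ _ (lift c gamma) (jacobian (spray g c))).
    exact: is_derive1_continuous zd.
  exact: Ck_on_continuous (Ck_on_jacobian (k := 0) (state_dom_open ac)
    (spray_smooth hg ac 1)) (lift_dom ct).
have nA : \forall s \near t, `|A s| <= `|A t| + 1.
  apply: filterS (continuous_dist Ac ltr01) => s h.
  by rewrite -(subrK (A t) (A s)) (le_trans (ler_normD _ _))// addrC lerD2l ltW.
pose C : R := (n + n)%:R * (`|A t| + 1) + 1.
have C0 : 0 < C by rewrite ltr_wpDl// mulr_ge0// addr_ge0.
have D1 : \forall s \near t, is_derive s (1 : R) (jlift c J1) (jlift c J1 s *m A s).
  by apply: filterS H1 => s [].
have D2 : \forall s \near t, is_derive s (1 : R) (jlift c J2) (jlift c J2 s *m A s).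
  by apply: filterS H2 => s [].
have L : \forall s \near t, `|jlift c J1 s *m A s - jlift c J2 s *m A s| <=
    C * `|jlift c J1 s - jlift c J2 s|.
  apply: filterS nA => s h; rewrite -mulmxBl (le_trans (ler_mulmx_norm _ h))//.
  by rewrite ler_wpM2r// lerDl.
have U := near_unique_lipschitz C0 E D1 D2 L.
apply: filterS (near_and U H1) => s [Es [cs _]].
have [as_ ss] := chart_atP (gamma s).
have Tu := jacobian_trans_unit as_ ac ss cs.
apply: (can_inj (mulmxK Tu)); have := congr1 lsubmx Es; rewrite !lsub_jlift.
exact.
Qed.

Lemma glue_geod_near a t b (z1 z2 : R -> M) : a <= t -> t <= b ->
  (\forall s \near t, z1 s = z2 s) -> geod_near a t z1 -> geod_near t b z2 ->
  geod_near a b (glue t z1 z2).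
Proof.
move=> at_ tb E [e1 e10 H1] [e2 e20 H2].
exists (Num.min e1 e2); first by rewrite lt_min e10.
move=> s /andP[s1 s2]; have [G1 G2] := glue_near E s.
have m1 : Num.min e1 e2 <= e1 by rewrite ge_min lexx.
have m2 : Num.min e1 e2 <= e2 by rewrite ge_min lexx orbT.
have [st|ts] := leP s t.
  have [|c ac Hc] := H1 s; first by apply/andP; split; lra.
  have G : \forall r \near s, z1 r = glue t z1 z2 r by apply: filterS (G1 st).
  exists c; [exact: ac | exact: geod_at_ext G Hc].
have [|c ac Hc] := H2 s; first by apply/andP; split; lra.
have G : \forall r \near s, z2 r = glue t z1 z2 r by apply: filterS (G2 (ltW ts)).
exists c; [exact: ac | exact: geod_at_ext G Hc].
Qed.

(** Tangent vectors at all points are row vectors of the same length, so dependent families can be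
    glued as ordinary functions. *)
Lemma glue_jac_near a t b J1 J2 : a <= t -> t <= b ->
  (\forall s \near t, J1 s = J2 s) -> jac_near a t J1 -> jac_near t b J2 ->
  jac_near a b (glue t (J1 : R -> 'rV[R]_n) J2).
Proof.
move=> at_ tb E [e1 e10 H1] [e2 e20 H2].
exists (Num.min e1 e2); first by rewrite lt_min e10.
move=> s /andP[s1 s2].
have [G1 G2] := @glue_near _ _ t (J1 : R -> 'rV[R]_n) J2 E s.
have m1 : Num.min e1 e2 <= e1 by rewrite ge_min lexx.
have m2 : Num.min e1 e2 <= e2 by rewrite ge_min lexx orbT.
have [st|ts] := leP s t.
  have [|c ac Hc] := H1 s; first by apply/andP; split; lra.
  have G : \forall r \near s, J1 r = glue t (J1 : R -> 'rV[R]_n) J2 r.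
    by apply: filterS (G1 st).
  exists c; [exact: ac | exact: jac_at_ext G Hc].
have [|c ac Hc] := H2 s; first by apply/andP; split; lra.
have G : \forall r \near s, J2 r = glue t (J1 : R -> 'rV[R]_n) J2 r.
  by apply: filterS (G2 (ltW ts)).
exists c; [exact: ac | exact: jac_at_ext G Hc].
Qed.

Lemma geod_near_at a b (z : R -> M) t e : geod_near a b z -> a <= t -> t <= b ->
  atlas e -> chart_dom e (z t) -> geod_at g e z t.
Proof.
move=> [e0 e00 H] at_ tb ae et; have [|c ac Hc] := H t.
  by apply/andP; split; lra.
exact: (geod_at_trans hg ac ae Hc et).
Qed.

Lemma jac_near_at a b J t e : jac_near a b J -> a <= t -> t <= b -> I t ->
  atlas e -> chart_dom e (gamma t) -> jac_at g e J t.
Proof.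
move=> [e0 e00 H] at_ tb It ae et; have [|c ac Hc] := H t.
  by apply/andP; split; lra.
exact: (jac_at_trans hg oI gI ac ae It Hc et).
Qed.

(* [Phi] is the differential at [gamma] of the geodesic flow from time [a] to
   time [b], and [S] a family of geodesics realizing this flow near [gamma]. *)
Definition propagates c d a b : Prop :=
  exists (Phi : 'M[R]_(n + n)) (S : 'rV[R]_(n + n) -> R -> M), [/\
    exists2 r : R, 0 < r & forall z : 'rV[R]_(n + n), `|z - lift c gamma a| < r ->
      [/\ geod_near a b (S z), chart_dom c (S z a), lift c (S z) a = z &
          chart_dom d (S z b)],
    lift d (S (lift c gamma a)) b = lift d gamma b,
    strict_diff (fun z => lift d (S z) b) (lift c gamma a) Phi &
    forall w, exists J, [/\ jac_near a b J, jlift c J a = w & jlift d J b = w *m Phi]].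

(** The geodesic issuing from [z] is continued by the member of the second family with the state
    [T z] reached at time [t]; by uniqueness the two agree near [t]. Strict differentials compose,
    and Jacobi fields are glued in the same way, with [Phi1 *m Phi2] as common matrix. *)
Lemma propagates_trans c e d a t b : a <= t -> t <= b -> I t ->
  atlas e -> chart_dom e (gamma t) ->
  propagates c e a t -> propagates e d t b -> propagates c d a b.
Proof.
move=> at_ tb It ae ee.
move=> [Phi1 [S1 [[r1 r10 H1] E1 D1 K1]]] [Phi2 [S2 [[r2 r20 H2] E2 D2 K2]]].
pose T z := lift e (S1 z) t.
have nT : \forall z \near lift c gamma a, `|T z - lift e gamma t| < r2.
  rewrite -E1; exact: continuous_dist (strict_diff_continuous D1) r20.
have nr : \forall z \near lift c gamma a, `|z - lift c gamma a| < r1.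
  by apply/near_normP; exists r1.
have [r r0 Hr] := (near_normP _ _).1 (near_and nr nT).
pose S z := glue t (S1 z) (S2 (T z)).
have SE z : `|z - lift c gamma a| < r -> \forall s \near t, S1 z s = S2 (T z) s.
  move=> /Hr [z1 z2]; have [N1 _ _ d1] := H1 z z1; have [N2 c2 L2 _] := H2 _ z2.
  apply: (geod_unique ae (geod_near_at N1 at_ (lexx t) ae d1)
    (geod_near_at N2 (lexx t) tb ae c2)).
  exact: esym L2.
have z0 : `|lift c gamma a - lift c gamma a| < r by rewrite subrr normr0.
have Sb z : `|z - lift c gamma a| < r -> lift d (S z) b = lift d (S2 (T z)) b.
  by move=> zr; apply: lift_ext; exact: (glue_near (SE z zr) b).2.
exists (Phi1 *m Phi2), S; split.
- exists r; first exact: r0.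
  move=> z zr; have [z1 z2] := Hr z zr.
  have [N1 c1 L1 d1] := H1 z z1; have [N2 c2 L2 d2] := H2 _ z2.
  have Ga := (glue_near (SE z zr) a).1 at_; have Gb := (glue_near (SE z zr) b).2 tb.
  split.
  + exact: glue_geod_near at_ tb (SE z zr) N1 N2.
  + exact: (eq_ind_r (chart_dom c) c1 (nbhs_singleton Ga)).
  + exact: (etrans (lift_ext c Ga) L1).
  + exact: (eq_ind_r (chart_dom d) d2 (nbhs_singleton Gb)).
- rewrite (Sb _ z0) /T E1; exact: E2.
- have nE : \forall z \near lift c gamma a,
      ((fun y => lift d (S2 y) b) \o T) z = lift d (S z) b.
    apply/near_normP; exists r; first exact: r0.
    by move=> z zr; rewrite (Sb _ zr).
  apply: strict_diff_ext nE _; apply: strict_diff_comp D1 _.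
  by rewrite E1.
- move=> w; have [J1 [N1 L1 M1]] := K1 w; have [J2 [N2 L2 M2]] := K2 (w *m Phi1).
  have JE : \forall s \near t, J1 s = J2 s.
    apply: (jac_unique ae It (jac_near_at N1 at_ (lexx t) It ae ee)
      (jac_near_at N2 (lexx t) tb It ae ee)).
    by rewrite L2.
  exists (glue t (J1 : R -> 'rV[R]_n) J2); split.
  + exact: glue_jac_near at_ tb JE N1 N2.
  + rewrite -L1; apply: jlift_ext.
    exact: ((@glue_near _ _ t (J1 : R -> 'rV[R]_n) J2 JE a).1 at_).
  + rewrite mulmxA -M2; apply: jlift_ext.
    exact: ((@glue_near _ _ t (J1 : R -> 'rV[R]_n) J2 JE b).2 tb).
Qed.

End Propagation.

(** * Propagation inside a chart, change of end charts, propagation along a segment *)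

Section LocalPropagation.
Variables (R : realType) (n : nat) (M : smoothManifold R n) (g : bilinear_field M).
Variable hg : lorentzian_metric g.
Variables (gamma : R -> M) (I : set R).
Variable oI : open I.
Variable gI : forall t c, I t -> atlas c -> chart_dom c (gamma t) -> geod_at g c gamma t.
Implicit Types (c d e : chart R n M) (p : M) (s t : R) (J : forall t, tangent (gamma t)).

Lemma components_from_chart e p (u : 'rV[R]_n) : atlas e -> chart_dom e p ->
  components e ((u *m 'J (trans e (chart_at p)) (chart_map e p)) : tangent p) = u.
Proof.
move=> ae ep; have [ap pp] := chart_atP p.
rewrite /components -mulmxA.
have -> : 'J (trans e (chart_at p)) (chart_map e p) *m
    'J (chart_map e \o chart_inv (chart_at p)) (chart_map (chart_at p) p) = 1%:M.
  by rewrite -(jacobian_trans_id ae ep); exact: (jacobian_cocycle ae ap ae ep pp ep).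
exact: mulmx1.
Qed.

Lemma near_itv (a b t : R) : a < t < b -> \forall s \near t, a < s < b.
Proof.
move=> /andP[at_ tb]; apply/near_RP; exists (Num.min (t - a) (b - t)).
  by rewrite lt_min !subr_gt0 at_.
by move=> s; rewrite lt_min => /andP[]; rewrite !ltr_norml => *; apply/andP; split; lra.
Qed.

Lemma propagates_chart e a b a' b' : atlas e -> a' < a -> a <= b -> b < b' ->
  (forall t, a' < t < b' -> I t /\ chart_dom e (gamma t)) ->
  propagates g gamma e e a b.
Proof.
move=> ae aa ab bb H.
(* Midpoints leave room on both sides: the flow lives on the compact [[al, be]] inside the given
   open interval, and [[a, b]] is interior to it. *)
pose al := (a' + a) / 2; pose be := (b + b') / 2.
have h1 : al <= a <= be by apply/andP; split; rewrite /al /be; lra.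
have h2 : al <= b <= be by apply/andP; split; rewrite /al /be; lra.
have hI t : al <= t <= be -> a' < t < b'.
  by rewrite /al /be => /andP[? ?]; apply/andP; split; lra.
have Od t : al <= t <= be -> state_dom e (lift e gamma t).
  by move=> /hI /H [_ et]; exact: lift_dom.
have Dd t : al <= t <= be ->
    is_derive t (1 : R) (lift e gamma) (spray g e (lift e gamma t)).
  by move=> /hI /H [It et]; have [] := nbhs_singleton (gI It ae et).
have [Phi [S [Pa PD [r r0 SH] Sb SD]]] :=
  flow_along (state_dom_open ae) (spray_smooth hg ae 1) h1 h2 Od Dd.
have albe t : al < t < be -> al <= t <= be by move=> /andP[/ltW -> /ltW ->].
pose ep := Num.min (a - al) (be - b).
have ep0 : 0 < ep by rewrite lt_min !subr_gt0 /al /be; apply/andP; split; lra.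
have ha' t : a - ep < t < b + ep -> al < t < be.
  have e1 : ep <= a - al by rewrite ge_min lexx.
  have e2 : ep <= be - b by rewrite ge_min lexx orbT.
  by move: e1 e2; clearbody ep al be => e1 e2 /andP[? ?]; apply/andP; split; lra.
have ia : a - ep < a < b + ep.
  by clear -ep0 ab; clearbody ep; apply/andP; split; lra.
have ib : a - ep < b < b + ep.
  by clear -ep0 ab; clearbody ep; apply/andP; split; lra.
pose T y s : M := chart_inv e (lsubmx (S y s)).
have Ty (y : 'rV[R]_(n + n)) t : `|y - lift e gamma a| < r -> a - ep < t < b + ep ->
    geod_at g e (T y) t /\ lift e (T y) t = S y t.
  move=> /SH [_ Hy] ht.
  have N : \forall s \near t, state_dom e (S y s) /\
      is_derive s (1 : R) (S y) (spray g e (S y s)).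
    by apply: filterS (near_itv (ha' t ht)) => s /albe /Hy.
  have E : \forall s \near t, T y s = chart_inv e (lsubmx (S y s)).
    by apply: filterS N.
  split; first exact: (geod_of_solution ae N E).
  exact: (nbhs_singleton (lift_of_solution ae N E)).
have z0 : `|lift e gamma a - lift e gamma a| < r by rewrite subrr normr0.
exists (Phi b), T; split.
- exists r; first exact: r0.
  move=> y yr; have [Sy Hy] := SH y yr; split.
  + exists ep; first exact: ep0.
    by move=> t /(Ty y t yr) [Gt _]; exists e.
  + by rewrite /T; apply: (chart_im_inv ae); exact: (Hy a h1).1.
  + by rewrite (Ty y a yr ia).2.
  + by rewrite /T; apply: (chart_im_inv ae); exact: (Hy b h2).1.
- by rewrite (Ty _ _ z0 ib).2.
- apply: strict_diff_ext SD; apply/near_normP; exists r; first exact: r0.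
  by move=> y yr; rewrite (Ty y b yr ib).2.
- move=> w; pose W s := w *m Phi s.
  (* The first half of [w *m Phi s] gives components in the chart [e], whereas a tangent vector is
     stored in the preferred chart of its base point. *)
  pose J s : tangent (gamma s) := lsubmx (W s) *m 'J (trans e (chart_at (gamma s))) (chart_map e (gamma s)).
  have N t : a - ep < t < b + ep -> \forall s \near t, chart_dom e (gamma s) /\
      is_derive s (1 : R) W (W s *m 'J (spray g e) (lift e gamma s)).
    move=> ht; apply: filterS (near_itv (ha' t ht)) => s /albe hs.
    split; first exact: (H s (hI s hs)).2.
    rewrite /W -mulmxA; exact: is_derive_mulmx_cst (PD s hs).
  have E t : a - ep < t < b + ep -> \forall s \near t, components e (J s) = lsubmx (W s).
    move=> ht; apply: filterS (near_itv (ha' t ht)) => s /albe hs.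
    exact: components_from_chart ae (H s (hI s hs)).2.
  have L t (ht : a - ep < t < b + ep) : jlift e J t = W t.
    have X := jlift_of_solution hg ae (N t ht) (E t ht).
    exact: (nbhs_singleton X).
  exists J; split.
  + exists ep; first exact: ep0.
    move=> t ht; exists e; first exact: ae.
    exact: (jac_of_solution hg ae (N t ht) (E t ht)).
  + by rewrite (L a ia) /W Pa mulmx1.
  + exact: (L b ib).
Qed.

Lemma tmapK c e z : atlas c -> atlas e -> state_overlap c e z ->
  tmap e c (tmap c e z) = z.
Proof.
move=> ac ae Oz; have [Ci Ei] := (overlapP _ _ ac).1 Oz.
have Ci' := chart_im_inv ac Ci; have xE := chart_invK ac Ci.
have tE := trans_map e ac Ci'; rewrite xE in tE.
rewrite /tmap row_mxKl row_mxKr -[RHS]hsubmxK -mulmxA tE.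
have JJ := jacobian_cocycle ac ae ac Ci' Ei Ci'.
rewrite xE (trans_map c ae Ei) xE in JJ *.
rewrite JJ -[in 'J _ _]xE (jacobian_trans_id ac Ci').
by rewrite mulmx1.
Qed.

Lemma jacobian_tmapK c e z : atlas c -> atlas e -> state_overlap c e z ->
  'J (tmap c e) z *m 'J (tmap e c) (tmap c e z) = 1%:M.
Proof.
move=> ac ae Oz; have oO := state_overlap_open ac ae.
have oO' := state_overlap_open ae ac.
have N : \forall y \near z, tmap e c (tmap c e y) = y.
  by apply: filterS (open_nbhs_nbhs (conj oO Oz)) => y; exact: tmapK.
rewrite (jacobian_comp oO oO' openT (tmap_smooth ac ae 1) (tmap_smooth ae ac 1)
  (@Ck_on_id _ _ 1 setT openT) Oz (tmap_overlap ac Oz) Logic.I N).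
by apply: (jacobian_near_id openT (@Ck_on_id _ _ 1 setT openT)); last exact: filterS N.
Qed.

(** Initial data read in [c] are fed to the family through [tmap c e], so the differential gains the
    Jacobian of [tmap c e] on the left. Conversely, Jacobi data at time [a] return to [c] by the
    inverse Jacobian. *)
Lemma propagates_left c e d a b : atlas c -> atlas e -> I a -> a <= b ->
  chart_dom c (gamma a) -> chart_dom e (gamma a) ->
  propagates g gamma e d a b -> propagates g gamma c d a b.
Proof.
move=> ac ae Ia ab ca ea [Phi [S [[r r0 SH] Sb SD SJ]]].
have [_ gc gd] := nbhs_singleton (gI Ia ac ca).
have La := lift_trans ac ae ca ea gc (geod_derive gd).
have Oa := lift_overlap ca ea.
have oO := state_overlap_open ac ae.
have Tc : strict_diff (tmap c e) (lift c gamma a) ('J (tmap c e) (lift c gamma a)).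
  exact: C1_strict_diff oO (tmap_smooth ac ae 1) Oa.
have nO : \forall z \near lift c gamma a, state_overlap c e z.
  exact: (open_nbhs_nbhs (conj oO Oa)).
have nr : \forall z \near lift c gamma a, `|tmap c e z - lift e gamma a| < r.
  by rewrite La; exact: continuous_dist (strict_diff_continuous Tc) r0.
have [r1 r10 Hr] := (near_normP _ _).1 (near_and nO nr).
exists ('J (tmap c e) (lift c gamma a) *m Phi), (fun z => S (tmap c e z)); split.
- exists r1; first exact: r10.
  move=> z /Hr [Oz zr]; have [G Ea Lz db] := SH _ zr.
  have Ga := geod_near_at hg G (lexx a) ab ae Ea.
  have Sa : S (tmap c e z) a = chart_inv c (lsubmx z).
    rewrite -(chart_mapK ae Ea) -lsub_lift Lz row_mxKl.
    have [Oi Oe] := (overlapP _ _ ac).1 Oz.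
    exact: (chart_mapK ae Oe).
  have Ca : chart_dom c (S (tmap c e z) a).
    rewrite Sa; exact: (chart_im_inv ac ((overlapP _ _ ac).1 Oz).1).
  have [_ zc zd] := nbhs_singleton Ga.
  have Lc := lift_trans ae ac Ea Ca zc (geod_derive zd).
  split; [exact: G|exact: Ca| |exact: db].
  rewrite Lc Lz; exact: tmapK ac ae Oz.
- by rewrite -La.
- apply: (strict_diff_comp (f := tmap c e) (g := fun y => lift d (S y) b) Tc).
  by rewrite -La.
- move=> w; have [J [JN JL JR]] := SJ (w *m 'J (tmap c e) (lift c gamma a)).
  exists J; split; [exact: JN| |by rewrite mulmxA].
  have Ja := jac_near_at hg oI gI JN (lexx a) ab Ia ae ea.
  have D := jac_derive hg ae ea (nbhs_singleton Ja).2.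
  rewrite (jlift_trans gI ae ac Ia ea ca D) JL La -mulmxA.
  by rewrite (jacobian_tmapK ac ae Oa) mulmx1.
Qed.

Lemma propagates_right c e d a b : atlas e -> atlas d -> I b -> a <= b ->
  chart_dom e (gamma b) -> chart_dom d (gamma b) ->
  propagates g gamma c e a b -> propagates g gamma c d a b.
Proof.
move=> ae ad Ib ab eb db [Phi [S [[r r0 SH] Sb SD SJ]]].
have [_ gc gd] := nbhs_singleton (gI Ib ae eb).
have Lb := lift_trans ae ad eb db gc (geod_derive gd).
have Ob := lift_overlap eb db.
have oO := state_overlap_open ae ad.
have Tc : strict_diff (tmap e d) (lift e gamma b) ('J (tmap e d) (lift e gamma b)).
  exact: C1_strict_diff oO (tmap_smooth ae ad 1) Ob.
have nO : \forall z \near lift c gamma a, state_overlap e d (lift e (S z) b).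
  have h : \forall y \near lift e gamma b, state_overlap e d y.
    exact: (open_nbhs_nbhs (conj oO Ob)).
  rewrite -Sb in h; exact: (strict_diff_continuous SD h).
have nr : \forall z \near lift c gamma a, `|z - lift c gamma a| < r.
  by apply/near_normP; exists r.
have [r1 r10 Hr] := (near_normP _ _).1 (near_and nO nr).
have SL (z : 'rV[R]_(n + n)) : `|z - lift c gamma a| < r1 ->
    chart_dom d (S z b) /\ lift d (S z) b = tmap e d (lift e (S z) b).
  move=> /Hr [Oz zr]; have [G _ _ Eb] := SH _ zr.
  have [_ zc zd] := nbhs_singleton (geod_near_at hg G ab (lexx b) ae Eb).
  have Db : chart_dom d (S z b).
    rewrite /state_overlap /= lsub_lift in Oz.
    by have := ((overlapP _ _ ae).1 Oz).2; rewrite (chart_mapK ae Eb).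
  split; first exact: Db.
  exact: lift_trans ae ad Eb Db zc (geod_derive zd).
have z0 : `|lift c gamma a - lift c gamma a| < r1 by rewrite subrr normr0.
exists (Phi *m 'J (tmap e d) (lift e gamma b)), S; split.
- exists r1; first exact: r10.
  move=> z zr; have [_ zr'] := Hr z zr; have [G ca Lz Eb] := SH _ zr'.
  split; [exact: G|exact: ca|exact: Lz|exact: (SL z zr).1].
- by rewrite (SL _ z0).2 Sb Lb.
- have E : \forall z \near lift c gamma a, (tmap e d \o (fun y => lift e (S y) b)) z = lift d (S z) b.
    apply/near_normP; exists r1; first exact: r10.
    by move=> z zr; exact: esym (SL z zr).2.
  apply: strict_diff_ext E _; apply: strict_diff_comp SD _.
  by rewrite Sb.
- move=> w; have [J [JN JL JR]] := SJ w.
  exists J; split; [exact: JN|exact: JL|].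
  have Jb := jac_near_at hg oI gI JN ab (lexx b) Ib ae eb.
  have D := jac_derive hg ae eb (nbhs_singleton Jb).2.
  by rewrite (jlift_trans gI ae ad Ib eb db D) JR mulmxA.
Qed.

Lemma propagates_local t : I t -> exists2 d : R, 0 < d & forall a b,
  t - d < a -> a <= b -> b < t + d ->
  propagates g gamma (chart_at (gamma a)) (chart_at (gamma b)) a b.
Proof.
move=> It; have [ae et] := chart_atP (gamma t); set e := chart_at _ in ae et.
have nI : \forall s \near t, I s by exact: (open_nbhs_nbhs (conj oI It)).
have [_ gc _] := nbhs_singleton (gI It ae et).
have [d d0 H] := (near_RP _ _).1 (near_and nI (near_dom ae et gc)).
have H' s : t - d < s < t + d -> I s /\ chart_dom e (gamma s).
  by move=> /andP[? ?]; apply: H; rewrite ltr_norml; apply/andP; split; lra.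
exists d; first exact: d0.
move=> a b ta ab bt.
have [Ia ea] : I a /\ chart_dom e (gamma a) by apply: H'; apply/andP; split; lra.
have [Ib eb] : I b /\ chart_dom e (gamma b) by apply: H'; apply/andP; split; lra.
have [aa ca] := chart_atP (gamma a); have [ab' db] := chart_atP (gamma b).
apply: (propagates_left aa ae Ia ab ca ea).
apply: (propagates_right ae ab' Ib ab eb db).
exact: (propagates_chart ae ta ab bt H').
Qed.

Lemma propagation a b : a <= b -> (forall t, a <= t <= b -> I t) ->
  propagates g gamma (chart_at (gamma a)) (chart_at (gamma b)) a b.
Proof.
move=> ab HI.
(* The bounds by [a] and [b] are premises of [P], so that the junction time in the transitivity step
   is known to lie in [I]. *)
pose P s s' := a <= s -> s' <= b ->
  propagates g gamma (chart_at (gamma s)) (chart_at (gamma s')) s s'.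
suff : P a b by apply.
apply: interval_induction ab _ _ => [t /HI /propagates_local [d d0 H]|s t s' st ts H1 H2 as_ sb].
  by exists d => // s s' h1 h2 h3 _ _; exact: H.
have [at_ tt] := chart_atP (gamma t).
have as' := le_trans as_ st; have sb' := le_trans ts sb.
have It : I t by apply: HI; rewrite as' sb'.
exact: (propagates_trans hg oI gI st ts It at_ tt (H1 as_ sb') (H2 as' sb)).
Qed.

End LocalPropagation.

(** * Families of loops *)

Section LoopEquation.
Variables (R : realType).

Lemma norm_lsubmx m p (x : 'rV[R]_(m + p)) : `|lsubmx x| <= `|x|.
Proof. by apply/mx_norm_leP => // i j; rewrite mxE ler_mx_norm. Qed.

Lemma norm_row_mx0 m p (v : 'rV[R]_p) : `|row_mx (0 : 'rV[R]_m) v| = `|v|.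
Proof.
apply/eqP; rewrite eq_le; apply/andP; split; apply/mx_norm_leP => // i j.
  rewrite mxE; case: splitP => k _; last exact: ler_mx_norm.
  by rewrite mxE normr0.
by rewrite -(row_mxEr (0 : 'rV[R]_m) v) ler_mx_norm.
Qed.

(** The contraction is known only on the ball of radius [2 * C]. The iterates from [0] stay there
    because the k-th one has norm at most [2 * C * (1 - 2^-1 ^+ k)]. *)
Lemma contraction_fixpoint m (T : 'rV[R]_m -> 'rV[R]_m) (C : R) : `|T 0| <= C ->
  (forall u v : 'rV[R]_m, `|u| <= 2 * C -> `|v| <= 2 * C ->
    `|T u - T v| <= 2^-1 * `|u - v|) ->
  exists2 y : 'rV[R]_m, `|y| <= 2 * C & T y = y.
Proof.
move=> T0 TL; have C0 : 0 <= C by apply: le_trans T0.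
pose x k := iter k T 0.
have half k : 0 <= (2^-1 : R) ^+ k <= 1.
  by apply/andP; split; [apply: exprn_ge0|apply: exprn_ile1]; lra.
have xb k : `|x k| <= 2 * C * (1 - 2^-1 ^+ k) /\ `|x k.+1 - x k| <= C * 2^-1 ^+ k.
  elim: k => [|k [IH1 IH2]].
    by rewrite expr0 subrr mulr0 normr0 mulr1 subr0.
  have e2 : (2^-1 : R) ^+ k.+1 = 2^-1 * 2^-1 ^+ k by rewrite exprS.
  have /andP[h0 h1] := half k.
  have xk1 : `|x k.+1| <= 2 * C * (1 - 2^-1 ^+ k.+1).
    have -> : x k.+1 = x k + (x k.+1 - x k) by rewrite addrCA subrr addr0.
    apply: le_trans (ler_normD _ _) _; apply: le_trans (lerD IH1 IH2) _.
    by rewrite e2; nra.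
  have b1 : `|x k| <= 2 * C by apply: le_trans IH1 _; nra.
  have b2 : `|x k.+1| <= 2 * C by apply: le_trans xk1 _; rewrite e2; nra.
  split; first exact: xk1.
  apply: le_trans (TL _ _ b2 b1) _.
  by rewrite e2; nra.
have [y Hy] := geometric_limit C0 (fun k => (xb k).2).
have yb : `|y| <= 2 * C.
  by have := Hy 0; rewrite expr0 mulr1 subr0.
exists y; first exact: yb.
have Ty k : `|T y - y| <= 2 * C * 2^-1 ^+ k.
  have xk : `|x k| <= 2 * C.
    by apply: le_trans (xb k).1 _; have /andP[] := half k; nra.
  have -> : T y - y = (T y - T (x k)) - (y - x k.+1).
    have -> : T (x k) = x k.+1 by [].
    by rewrite opprB addrA subrK.
  apply: le_trans (ler_normB _ _) _.
  have h1 := TL _ _ yb xk; have h2 := Hy k; have h3 := Hy k.+1.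
  rewrite exprS in h3; apply: le_trans (lerD h1 h3) _.
  lra.
apply/eqP; rewrite -subr_eq0 -normr_le0; apply/ler_addgt0Pr => e e0; rewrite add0r.
have [k hk] := half_pow_small (2 * C) e0.
exact: le_trans (Ty k) hk.
Qed.

Lemma strict_diffN m p (f : 'rV[R]_m -> 'rV[R]_p) x L :
  strict_diff f x L -> strict_diff (fun y => - f y) x (- L).
Proof.
move=> fL e e0; have [d d0 H] := fL e e0; exists d => // u w ux wx.
by rewrite mulmxN -!opprD normrN; exact: H.
Qed.

(* With [E] the time-one geodesic flow, the solutions [z] are the initial
   conditions of loops. For a given base point near the one of [z0], a chord
   iteration in the velocity finds such a [z] because the partial differential
   of [lsubmx \o E] in the velocities is invertible. *)
Lemma loop_equation m (E : 'rV[R]_(m + m) -> 'rV[R]_(m + m)) z0 Phi (h : 'rV[R]_(m + m)) :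
  strict_diff E z0 Phi -> lsubmx (E z0) = lsubmx z0 -> dlsubmx Phi \in unitmx ->
  lsubmx (h *m Phi) = lsubmx h ->
  forall e : R, 0 < e -> exists2 d : R, 0 < d & forall s : R, `|s| < d ->
    exists2 z : 'rV[R]_(m + m), `|z - z0 - s *: h| <= e * `|s| & lsubmx (E z) = lsubmx z.
Proof.
move=> ED E0 Bu hP e e0.
pose B := invmx (dlsubmx Phi); pose K : R := m%:R * `|B| + 1.
have K0 : 0 < K by rewrite ltr_wpDl// mulr_ge0.
have KB (u : 'rV[R]_m) : `|u *m B| <= K * `|u|.
  apply: le_trans (ler_mulmx_norm _ (lexx _)) _.
  by rewrite ler_wpM2r// lerDl.
pose k : R := `|h| + 1; have k0 : 0 < k by rewrite ltr_wpDl.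
(* The first bound makes the iteration contract by one half; the second makes its first step at most
   [e / 2 * |s|], so that the fixed point has norm at most [e * |s|]. *)
pose eta : R := Num.min (2^-1 / K) (e / 2 / (K * k)).
have eta0 : 0 < eta by rewrite lt_min !divr_gt0// mulr_gt0.
have eta1 : K * eta <= 2^-1.
  by rewrite mulrC -ler_pdivlMr// ge_min lexx.
have eta2 : K * eta * k <= e / 2.
  by rewrite mulrAC mulrC -ler_pdivlMr ?mulr_gt0// ge_min lexx orbT.
have [d d0 Hd] := ED eta eta0.
have ke0 : 0 < k + e by rewrite addr_gt0.
exists (d / (k + e)); first by rewrite divr_gt0.
move=> s; rewrite (ltr_pdivlMr _ _ ke0) => sd.
pose p := z0 + s *: h.
pose zz (v : 'rV[R]_m) : 'rV[R]_(m + m) := p + row_mx 0 v.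
have zd (v : 'rV[R]_m) : `|v| <= e * `|s| -> `|zz v - z0| < d.
  move=> vs; apply: le_lt_trans sd.
  have -> : zz v - z0 = s *: h + row_mx 0 v by rewrite /zz /p addrAC [z0 + _]addrC addrK.
  apply: le_trans (ler_normD _ _) _; rewrite normrZ norm_row_mx0.
  rewrite mulrDr /k mulrDr mulr1 [`|s| * e]mulrC; apply: lerD; last exact: vs.
  by rewrite lerDl.
have zz0 : zz 0 = p by rewrite /zz row_mx0 addr0.
have lzz v : lsubmx (zz v) = lsubmx p by rewrite /zz linearD /= row_mxKl addr0.
have lsubB (a b : 'rV[R]_(m + m)) : lsubmx (a - b) = lsubmx a - lsubmx b.
  exact: linearB.
(* Newton's iteration with the inverse [B] frozen at [z0]. A fixed point makes the final position
   equal to the base position of [p], which the correction [row_mx 0 v] does not change. *)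
pose T (v : 'rV[R]_m) := v - (lsubmx (E (zz v)) - lsubmx p) *m B.
have lB (v : 'rV[R]_m) : lsubmx (row_mx 0 v *m Phi) *m B = v.
  rewrite -[Phi]submxK mul_row_block !mul0mx !add0r row_mxKl /B.
  exact: mulmxK.
have TE (u v : 'rV[R]_m) : T u - T v =
    - (lsubmx (E (zz u) - E (zz v) - (zz u - zz v) *m Phi) *m B).
  have -> : zz u - zz v = row_mx 0 (u - v).
    by rewrite /zz opprD addrACA subrr add0r opp_row_mx add_row_mx subrr.
  rewrite !lsubB mulmxBl lB mulmxBl.
  have zE (a b c : 'rV[R]_m) : u - (a - c) - (v - (b - c)) = - (a - b - (u - v)).
    rewrite [RHS]opprB [- (v - _)]opprD addrACA opprK; congr (_ + _).
    by rewrite !opprB addrC addrA subrK.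
  by rewrite /T !mulmxBl zE.
have sE : 0 <= e * `|s| by rewrite mulr_ge0// ltW.
have dec (x : 'rV[R]_(m + m)) (y : R) : `|x| <= eta * y -> `|lsubmx x *m B| <= K * eta * y.
  move=> xy; apply: le_trans (KB _) _; rewrite -mulrA (ler_pM2l K0).
  exact: le_trans (norm_lsubmx _) xy.
have TL (u v : 'rV[R]_m) : `|u| <= e * `|s| -> `|v| <= e * `|s| ->
    `|T u - T v| <= 2^-1 * `|u - v|.
  move=> us vs; rewrite TE normrN.
  apply: le_trans (dec _ _ (Hd _ _ (zd u us) (zd v vs))) _.
  have -> : zz u - zz v = row_mx 0 (u - v).
    by rewrite /zz opprD addrACA subrr add0r opp_row_mx add_row_mx subrr.
  by rewrite norm_row_mx0 ler_wpM2r.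
have T0 : `|T 0| <= e / 2 * `|s|.
  have z0d : `|z0 - z0| < d by rewrite subrr normr0.
  have pd : `|p - z0| < d by rewrite -zz0; apply: zd; rewrite normr0.
  have -> : T 0 = - (lsubmx (E p - E z0 - (p - z0) *m Phi) *m B).
    have -> : p - z0 = s *: h by rewrite /p addrC addKr.
    have lZ (x : 'rV[R]_(m + m)) : lsubmx (s *: x) = s *: lsubmx x by exact: linearZ.
    have lp : lsubmx p = lsubmx z0 + s *: lsubmx h by rewrite -lZ; exact: linearD.
    by rewrite /T zz0 sub0r -scalemxAl !lsubB lZ hP E0 lp opprD addrA.
  rewrite normrN; apply: le_trans (dec _ _ (Hd _ _ pd z0d)) _.
  have -> : p - z0 = s *: h by rewrite /p addrC addKr.
  rewrite normrZ [`|s| * _]mulrC mulrA ler_wpM2r//.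
  apply: le_trans eta2; rewrite ler_wpM2l ?lerDl//.
  by rewrite ltW// mulr_gt0.
have e2 : 2 * (e / 2 * `|s|) = e * `|s| by lra.
have [y yb Ty] : exists2 y : 'rV[R]_m, `|y| <= 2 * (e / 2 * `|s|) & T y = y.
  by apply: contraction_fixpoint T0 _ => u v; rewrite e2; exact: TL.
exists (zz y).
  have -> : zz y - z0 - s *: h = row_mx 0 y.
    by rewrite /zz /p -addrA -opprD addrAC subrr add0r.
  by rewrite norm_row_mx0 -e2.
rewrite lzz; apply/eqP; rewrite -subr_eq0; apply/eqP.
have X : (lsubmx (E (zz y)) - lsubmx p) *m B = 0.
  by have := congr1 (fun v => y - v) Ty; rewrite /T subrr opprB addrC subrK.
by rewrite -(mulmxKV Bu (lsubmx (E (zz y)) - lsubmx p)) -/B X mul0mx.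
Qed.

(** If the derivative [D] along [h] were nonzero, taking [s] with the sign of [D] would raise [f] by
    about [|s| * |D|]. The strict differential and the deviation of [z] from [z0 + s *: h] cost at
    most a quarter of this each, which leaves a strict increase. *)
Lemma extremal_direction m (f : 'rV[R]_m -> 'rV[R]_1) z0 L (h : 'rV[R]_m) :
  strict_diff f z0 L ->
  (forall e : R, 0 < e -> exists2 d : R, 0 < d & forall s : R, `|s| < d ->
    exists2 z : 'rV[R]_m, `|z - z0 - s *: h| <= e * `|s| & f z 0 0 <= f z0 0 0) ->
  (h *m L) 0 0 = 0.
Proof.
move=> fL H; apply/eqP; apply: contraT => D0.
set D : R := (h *m L) 0 0 in D0 *; pose A : R := `|D|.
have A0 : 0 < A by rewrite normr_gt0.
pose k : R := `|h| + 1; have k0 : 0 < k by rewrite ltr_wpDl.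
pose l : R := m%:R * `|L| + 1; have l0 : 0 < l by rewrite ltr_wpDl// mulr_ge0.
pose eta := A / (4 * k); have eta0 : 0 < eta by rewrite divr_gt0// mulr_gt0.
pose e := Num.min 1 (A / (4 * l)).
have e0 : 0 < e by rewrite lt_min ltr01 divr_gt0// mulr_gt0.
have e1 : e <= 1 by rewrite ge_min lexx.
have el : e * l <= A / 4.
  have : e <= A / (4 * l) by rewrite ge_min lexx orbT.
  by rewrite ler_pdivlMr ?mulr_gt0//; lra.
have ek : eta * k = A / 4 by rewrite /eta; field; rewrite gt_eqF.
have [d d0 Hd] := fL eta eta0; have [r r0 Hr] := H e e0.
pose t := Num.min (d / k) r / 2.
have t0 : 0 < t by rewrite divr_gt0// lt_min r0 divr_gt0.
have tr : t < r.
  have : Num.min (d / k) r <= r by rewrite ge_min lexx orbT.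
  by rewrite /t; lra.
have td : t * k < d.
  have : Num.min (d / k) r <= d / k by rewrite ge_min lexx.
  rewrite ler_pdivlMr// => X; apply: lt_le_trans X; rewrite ltr_pM2r//.
  by move: t0; rewrite /t; lra.
pose s := Num.sg D * t.
have sn : `|s| = t by rewrite normrM normr_sg D0 mul1r gtr0_norm.
have [z zs fz] : exists2 z : 'rV[R]_m, `|z - z0 - s *: h| <= e * t & f z 0 0 <= f z0 0 0.
  by have := Hr s; rewrite sn; apply.
pose q := z - z0 - s *: h.
have zE : z - z0 = s *: h + q by rewrite /q [RHS]addrC subrK.
have zn : `|z - z0| <= t * k.
  rewrite zE; apply: le_trans (ler_normD _ _) _; rewrite normrZ sn.
  apply: le_trans (lerD (lexx _) zs) _; rewrite /k mulrDr mulr1 lerD2l.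
  by rewrite ger_pMl.
have z0d : `|z0 - z0| < d by rewrite subrr normr0.
have X := Hd z z0 (le_lt_trans zn td) z0d.
have Y : `|(f z - f z0 - (z - z0) *m L) 0 0| <= t * (A / 4).
  apply: le_trans (ler_mx_norm _ _ _) _; apply: le_trans X _.
  by rewrite -ek mulrCA ler_wpM2l// ltW.
have Z : `|(q *m L) 0 0| <= t * (A / 4).
  apply: le_trans (ler_mx_norm _ _ _) _.
  apply: le_trans (ler_mulmx_norm _ (lexx _)) _.
  apply: le_trans (ler_wpM2l _ zs) _; first by rewrite mulr_ge0.
  rewrite mulrA [t * _]mulrC ler_pM2r//; apply: le_trans el.
  by rewrite mulrC ler_pM2l// lerDl.
have sD : ((z - z0) *m L) 0 0 = t * A + (q *m L) 0 0.
  rewrite zE mulmxDl -scalemxAl; transitivity (s * D + (q *m L) 0 0).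
    by rewrite /D !mxE.
  by rewrite /s mulrAC -normrEsg mulrC.
have Y' : (f z - f z0 - (z - z0) *m L) 0 0 = f z 0 0 - f z0 0 0 - (t * A + (q *m L) 0 0).
  by rewrite -sD !mxE.
move: Y Z; rewrite Y' !ler_norml => /andP[y1 _] /andP[z1 _].
have tA : 0 < t * A by rewrite mulr_gt0.
have : t * A <= t * (A / 4) + t * (A / 4) by lra.
have -> : t * (A / 4) = t * A / 4 by rewrite mulrA.
lra.
Qed.

(** The lower left block of [Phi] is the derivative of the final position in the initial velocity.
    Its inverse yields the velocity variation that brings the end of the variation back to [w]. *)
Lemma loop_direction m (Phi : 'M[R]_(m + m)) (w : 'rV[R]_m) :
  dlsubmx Phi \in unitmx ->
  exists2 h : 'rV[R]_(m + m), lsubmx h = w & lsubmx (h *m Phi) = w.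
Proof.
move=> Bu; exists (row_mx w ((w - w *m ulsubmx Phi) *m invmx (dlsubmx Phi))).
  exact: row_mxKl.
by rewrite -{3}[Phi]submxK mul_row_block row_mxKl mulmxKV// addrC subrK.
Qed.

Lemma extremal_loop m (E : 'rV[R]_(m + m) -> 'rV[R]_(m + m)) z0 Phi
    (f : 'rV[R]_(m + m) -> 'rV[R]_1) L (h : 'rV[R]_(m + m)) (r : R) : 0 < r ->
  strict_diff E z0 Phi -> lsubmx (E z0) = lsubmx z0 -> dlsubmx Phi \in unitmx ->
  lsubmx (h *m Phi) = lsubmx h -> strict_diff f z0 L ->
  (forall z, `|z - z0| < r -> lsubmx (E z) = lsubmx z -> f z 0 0 <= f z0 0 0) ->
  (h *m L) 0 0 = 0.
Proof.
move=> r0 ED E0 Bu hP fL H; apply: (extremal_direction fL) => e e0.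
have [d d0 Hd] := loop_equation ED E0 Bu hP e0.
have k0 : 0 < e + `|h| by rewrite ltr_wpDr.
exists (Num.min d (r / (e + `|h|))); first by rewrite lt_min d0 divr_gt0.
move=> s; rewrite lt_min (ltr_pdivlMr _ _ k0) => /andP[sd sr].
have [z zs Ez] := Hd s sd; exists z; first exact: zs.
apply: H Ez; apply: le_lt_trans sr.
have -> : z - z0 = (z - z0 - s *: h) + s *: h by rewrite subrK.
apply: le_trans (ler_normD _ _) _; rewrite normrZ mulrDr lerD2r mulrC.
by rewrite mulrC [`|s| * e]mulrC.
Qed.

End LoopEquation.

Section RightDerivative.
Variables (R : realType).

(** The two-sided derivative at [0] is determined by the right-hand difference quotients. It is used
    for fields known to vanish on [[0, 1]] only, at the endpoint [0]. *)
Lemma is_derive_zero_right (V : normedModType R) (f : R -> V) df :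
  is_derive (0 : R) (1 : R) f df -> (forall t : R, 0 <= t <= 1 -> f t = 0) -> df = 0.
Proof.
move=> [fd <-] f0.
have /cvgrPdist_lt H : h^-1 *: (f (h *: (1 : R) + 0) - f 0) @[h --> (0 : R)^'] --> 'D_1 f 0.
  exact: fd.
apply/eqP; rewrite -normr_le0; apply/ler_addgt0Pr => e e0; rewrite add0r.
have := H e e0; rewrite near_withinE => /near_RP [d d0 Hd].
pose h := Num.min d 1 / 2.
have h0 : 0 < h by rewrite divr_gt0// lt_min d0 ltr01.
have m1 : Num.min d 1 <= d by rewrite ge_min lexx.
have m2 : Num.min d 1 <= 1 by rewrite ge_min lexx orbT.
have hd : `|h - 0| < d by rewrite subr0 gtr0_norm// /h; move: h0; rewrite /h; lra.
have hn : h != 0 by rewrite gt_eqF.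
have := Hd h hd hn; rewrite addr0 [h *: 1]mulr1 !f0 ?lexx ?ler01//.
  by rewrite subrr scaler0 subr0 => /ltW.
by rewrite ltW//= /h; lra.
Qed.

Lemma jacobian_zero m p (x : 'rV[R]_m) : 'J (fun=> 0 : 'rV[R]_p) x = 0.
Proof.
apply/matrixP => i j.
rewrite (jacobian_entry i j openT (Ck_on_cst 1 0 openT)) // mxE.
by rewrite derive_cst mxE.
Qed.

End RightDerivative.

(** * Energy and length of geodesics on the unit interval *)

Section Loops.
Variables (R : realType) (n : nat) (M : smoothManifold R n) (g : bilinear_field M).
Variable hg : lorentzian_metric g.
Implicit Types (c d e : chart R n M) (s t : R).

Lemma geod_near_energy (zeta : R -> M) t : geod_near g 0 1 zeta -> 0 <= t <= 1 ->
  metric_form g (velocity zeta t) (velocity zeta t) =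
  metric_form g (velocity zeta 0) (velocity zeta 0).
Proof.
move=> [e e0 H] /andP[t0 t1]; apply: (energy_constant hg t0) => s /andP[s0 st].
by apply: H; apply/andP; split; lra.
Qed.

Lemma ler_sqrt_neg (x y : R) : x < 0 -> y < 0 ->
  Num.sqrt `|x| <= Num.sqrt `|y| -> y <= x.
Proof. by move=> x0 y0; rewrite ler_sqrt ?normr_ge0// !ltr0_norm// lerN2. Qed.

Lemma arc_length_constant (zeta : R -> M) (K : R) :
  (forall t, 0 <= t <= 1 -> metric_form g (velocity zeta t) (velocity zeta t) = K) ->
  arc_length g 0 1 zeta = Num.sqrt `|K|.
Proof.
move=> H; rewrite /arc_length.
rewrite (@eq_Rintegral _ _ _ _ _ (fun=> Num.sqrt `|K|)); last first.
  by move=> t /set_mem; rewrite /= in_itv /= => /H ->.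
rewrite Rintegral_cst; last exact: measurable_itv.
have L : fine (lebesgue_measure (`[0, 1]%classic : set R)) = 1.
  by rewrite lebesgue_measure_itv /= lte_fin ltr01 oppr0 adde0.
exact: etrans (congr1 (fun l => Num.sqrt `|K| * l) L) (mulr1 _).
Qed.

(** Being timelike at time [0] persists, since the energy is constant along the geodesic. *)
Lemma geod_near_timelike (zeta : R -> M) : geod_near g 0 1 zeta ->
  metric_form g (velocity zeta 0) (velocity zeta 0) < 0 -> timelike_geodesic g 0 1 zeta.
Proof.
move=> G neg; have [e e0 H] := G; split; first exact: ltr01.
- exists e; first exact: e0.
  apply: (geod_geodesic_on hg); first exact: interval_open.
  by move=> t; rewrite /= in_itv /=; exact: H.
- move=> t; rewrite in_itv /= => ht; by rewrite (geod_near_energy G ht).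
Qed.

End Loops.

(** * Variation of the energy along a Jacobi field *)

Section ClosedGeodesic.
Variables (R : realType) (n : nat) (M : smoothManifold R n) (g : bilinear_field M).
Variable hg : lorentzian_metric g.
Variables (gamma : R -> M) (I : set R).
Variable oI : open I.
Variable gI : forall t c, I t -> atlas c -> chart_dom c (gamma t) -> geod_at g c gamma t.
Variable I01 : forall t, 0 <= t <= 1 -> I t.
Implicit Types (c d e : chart R n M) (s t : R) (J : forall t, tangent (gamma t)).

Lemma jlift_zero J c : atlas c -> chart_dom c (gamma 0) -> jac_at g c J 0 ->
  (forall t, 0 <= t <= 1 -> J t = 0) -> jlift c J 0 = 0.
Proof.
move=> ac c0 Jc J0; have D := jac_derive hg ac c0 (nbhs_singleton Jc).2.
have C0 t : 0 <= t <= 1 -> components c (J t) = 0.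
  by move=> /J0 ->; exact: mul0mx.
have E := is_derive_zero_right D C0.
rewrite -[LHS]hsubmxK E lsub_jlift C0 ?lexx ?ler01//; exact: row_mx0.
Qed.

Definition energy_variation c J t : 'rV[R]_1 :=
  jlift c J t *m 'J (energy g c) (lift c gamma t).

Lemma energy_variation_chart c d J t : atlas c -> atlas d -> I t ->
  chart_dom c (gamma t) -> chart_dom d (gamma t) -> jac_at g c J t ->
  energy_variation d J t = energy_variation c J t.
Proof.
move=> ac ad It ct dt Jc.
have [_ gc gd] := nbhs_singleton (gI It ac ct).
have D := jac_derive hg ac ct (nbhs_singleton Jc).2.
have L := jlift_trans gI ac ad It ct dt D.
have Lt := lift_trans ac ad ct dt gc (geod_derive gd).
have Ot := lift_overlap ct dt.
have oO := state_overlap_open ac ad.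
have N : \forall z \near lift c gamma t, energy g d (tmap c d z) = energy g c z.
  by apply: filterS (open_nbhs_nbhs (conj oO Ot)) => z; exact: energy_tmap.
have sub z : state_overlap c d z -> state_dom d (tmap c d z).
  by move=> Oz; exact: state_overlapl ad (tmap_overlap ac Oz).
have JJ := jacobian_comp oO (state_dom_open ad) (state_dom_open ac)
  (tmap_smooth ac ad 1) (energy_smooth hg ad 1) (energy_smooth hg ac 1)
  Ot (sub _ Ot) (lift_dom ct) N.
have X := mulmx_jacobian_congr (energy g d) L Lt.
rewrite -mulmxA JJ in X.
exact: X.
Qed.

(** Conservation of energy says that [energy g c] intertwines the spray with the zero vector field
    on the line. Solutions of the linearized equation are therefore pushed to solutions with zero
    derivative. *)
Lemma is_derive_energy_variation c J t : atlas c -> I t -> chart_dom c (gamma t) ->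
  jac_at g c J t -> is_derive t (1 : R) (energy_variation c J) 0.
Proof.
move=> ac It ct Jc.
have [_ gc gd] := nbhs_singleton (gI It ac ct).
have [_ Jd] := nbhs_singleton Jc.
have Z x : state_dom c x -> (0 : 'rV[R]_1) = spray g c x *m 'J (energy g c) x.
  by move=> cx; exact: esym (energy_spray hg ac cx).
have D := linearized_push (state_dom_open ac) openT (spray_smooth hg ac 1)
  (Ck_on_cst 1 0 openT) (energy_smooth hg ac 2) (fun _ _ => Logic.I) Z (lift_dom ct) gd Jd.
rewrite jacobian_zero mulmx0 in D.
exact: D.
Qed.

(** In a chart the acceleration is removed by [bil_chr]: one derivative of the metric cancels, and
    what remains is half the derivative of the energy along the lifted field. *)
Lemma is_derive_velocity_pairing c J t : atlas c -> I t -> chart_dom c (gamma t) ->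
  jac_at g c J t ->
  is_derive t (1 : R) (fun s => metric_form g (velocity gamma s) (J s))
    (2^-1 * energy_variation c J t 0 0).
Proof.
move=> ac It ct Jc.
have [_ gc gd] := nbhs_singleton (gI It ac ct).
have [_ Jd] := nbhs_singleton Jc.
have zO := lift_dom ct.
have oi := chart_im_open ac.
have zi : chart_im c (lsubmx (lift c gamma t)) by exact: zO.
set z := lift c gamma t in gd Jd zO zi *; set w := jlift c J t in Jd *.
have d1 := is_derive_lsubmx gd; have d2 := is_derive_rsubmx gd.
rewrite [spray g c z]/spray row_mxKl in d1; rewrite [spray g c z]/spray row_mxKr in d2.
have d3 := is_derive_lsubmx Jd; rewrite (lsub_linear_spray hg _ ac zO) in d3.
have dG := C1_chain (f := fun s => lsubmx (lift c gamma s)) oi (gram_smooth hg ac 1) zi d1.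
have D := is_derive_bil dG d2 d3.
have nI : \forall s \near t, I s by exact: (open_nbhs_nbhs (conj oI It)).
have E : \forall s \near t, bil ((gram g c \o (fun r => lsubmx (lift c gamma r))) s)
    (rsubmx (lift c gamma s)) (lsubmx (jlift c J s)) =
    metric_form g (velocity gamma s) (J s).
  apply: filterS (near_and nI (near_dom ac ct gc)) => s [Is cs].
  rewrite (metric_form_components g _ _ ac cs) (components_velocity hg ac (gI Is ac cs)).
  by rewrite /= lsub_lift lsub_jlift.
apply: is_derive_ext E _; apply: is_derive_eq D _.
rewrite /energy_variation -/z -/w -(C1_deriveE w (state_dom_open ac) (energy_smooth hg ac 1) zO).
rewrite (derive_energy hg w ac zO) bilNl (bil_chr hg _ _ ac zi) /= -/z -/w.
have key (p q r : R) : - (p - 2^-1 * q) + p + r = 2^-1 * (q + 2 * r) by field.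
exact: key.
Qed.

Lemma velocity_pairing_constant J : jac_near g 0 1 J ->
  energy_variation (chart_at (gamma 0)) J 0 = 0 ->
  metric_form g (velocity gamma 1) (J 1) = metric_form g (velocity gamma 0) (J 0).
Proof.
move=> JN V0.
have near01 t : 0 <= t <= 1 -> [/\ atlas (chart_at (gamma t)),
    chart_dom (chart_at (gamma t)) (gamma t) & jac_at g (chart_at (gamma t)) J t].
  move=> ht; have It := I01 ht; have [ac ct] := chart_atP (gamma t).
  have /andP[t0 t1] := ht; have Jt := jac_near_at hg oI gI JN t0 t1 It ac ct.
  by [].
(* The chart varies with [t], possibly discontinuously, but the value is independent of the chart,
   so near each time [V] agrees with its expression in one fixed chart. *)
pose V t := energy_variation (chart_at (gamma t)) J t.
have VD t : 0 <= t <= 1 -> is_derive t (1 : R) V 0.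
  move=> ht; have [ac ct Jc] := near01 t ht; have It := I01 ht.
  have D := is_derive_energy_variation ac It ct Jc.
  apply: is_derive_ext D.
  have nI : \forall s \near t, I s by exact: (open_nbhs_nbhs (conj oI It)).
  have [_ gc _] := nbhs_singleton (gI It ac ct).
  apply: filterS (near_and nI (near_and (near_dom ac ct gc) (near_near Jc))).
  move=> s [Is [cs Js]]; have [as_ ss] := chart_atP (gamma s).
  exact: esym (energy_variation_chart ac as_ Is cs ss Js).
have V1 t : 0 <= t <= 1 -> V t = 0.
  move=> /andP[t0 t1]; rewrite -[RHS]V0; apply/rowP => j.
  apply: (constant_of_derive0 t0 (f := fun s => V s 0 j)) => s /andP[s0 st].
  have Vs : is_derive s (1 : R) V 0 by apply: VD; rewrite s0 (le_trans st t1).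
  by apply: is_derive_eq ((is_derive_mxP _ _ _ _).1 Vs 0 j) _; rewrite mxE.
apply: (constant_of_derive0 (ler01 : 0 <= 1 :> R)
  (f := fun s => metric_form g (velocity gamma s) (J s))) => t ht.
have [ac ct Jc] := near01 t ht.
apply: is_derive_eq (is_derive_velocity_pairing ac (I01 ht) ct Jc) _.
by have := V1 t ht; rewrite /V => ->; rewrite mxE mulr0.
Qed.

End ClosedGeodesic.

(** * Invertibility of the velocity block *)

Section NonConjugacy.
Variables (R : realType) (n : nat) (M : smoothManifold R n) (g : bilinear_field M).
Variable hg : lorentzian_metric g.
Implicit Types (c d : chart R n M) (s t : R).

Lemma components_eq0 c p (v : tangent p) : atlas c -> chart_dom c p ->
  components c v = 0 -> v = 0.
Proof.
move=> ac cp vE; have [ap pp] := chart_atP p.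
apply: (can_inj (mulmxK (jacobian_trans_unit ap ac pp cp))).
rewrite mul0mx; exact: vE.
Qed.

(** A nonzero vector [v] in the kernel of the block, taken as initial derivative of a Jacobi field
    vanishing at [0], makes the field vanish at [1] too. It is not identically zero on [[0, 1]],
    since otherwise its derivative [v] at [0] would vanish. *)
Lemma nonconjugate_unit (gamma : R -> M) (I : set R) c Phi (e : R) : open I ->
  (forall t c, I t -> atlas c -> chart_dom c (gamma t) -> geod_at g c gamma t) ->
  0 < e -> (forall t, 0 - e < t < 1 + e -> I t) ->
  atlas c -> chart_dom c (gamma 0) -> chart_dom c (gamma 1) ->
  ~ conjugate_along g 0 1 gamma ->
  (forall w, exists J : forall t, tangent (gamma t),
     [/\ jac_near g 0 1 J, jlift c J 0 = w & jlift c J 1 = w *m Phi]) ->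
  dlsubmx Phi \in unitmx.
Proof.
move=> oI gI e0 eI ac c0 c1 nc HJ; rewrite unitmxE unitfE; apply/negP => /det0P [v v0 vB].
apply: nc; have [J [JN L0 L1]] := HJ (row_mx 0 v).
have I0 : I 0 by apply: eI; apply/andP; split; lra.
have Jc0 := jac_near_at hg oI gI JN (lexx 0) ler01 I0 ac c0.
exists J; split.
- have [e1 e10 H1] := JN; exists (Num.min e e1); first by rewrite lt_min e0.
  have m1 : Num.min e e1 <= e by rewrite ge_min lexx.
  have m2 : Num.min e e1 <= e1 by rewrite ge_min lexx orbT.
  apply: (jacobi_of_jac_at hg oI gI); first exact: interval_open.
    move=> t; rewrite /= in_itv /= => /andP[? ?]; apply: eI; apply/andP; split; lra.
  move=> t; rewrite /= in_itv /= => /andP[? ?]; apply: H1; apply/andP; split; lra.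
- apply: (components_eq0 ac c0); by rewrite -lsub_jlift L0 row_mxKl.
- apply: (components_eq0 ac c1); rewrite -lsub_jlift L1 -[Phi]submxK mul_row_block.
  by rewrite !mul0mx !add0r row_mxKl.
- apply: contrapT => nz; case/negP: v0; apply/eqP.
  have Z t : 0 <= t <= 1 -> J t = 0.
    move=> ht; apply: contrapT => /eqP Jt; apply: nz; exists t => //.
  have := jlift_zero hg ac c0 Jc0 Z; rewrite L0 => /(congr1 rsubmx).
  by rewrite row_mxKr => ->; apply/matrixP => i j; rewrite !mxE.
Qed.

End NonConjugacy.

(** * Criticality of the energy among nearby loops *)

Theorem corollary3p4 (R : realType) (n : nat) (hn : (2 <= n)%N)
    (M : smoothManifold R n) (g : bilinear_field M) (hg : lorentzian_metric g)
    (gamma : R -> M) (hloop : timelike_geodesic_loop g 0 1 gamma)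
    (hext : locally_extremal g gamma)
    (hconj : ~ self_conjugate g 0 1 gamma) :
  closed_timelike_geodesic g 0 1 gamma.
Proof.
split; first exact: hloop.
have [[_ [e e0 geo] neg] loop] := hloop.
pose I : set R := `]0 - e, 1 + e[%classic.
have oI : open I by exact: interval_open.
have eI t : 0 - e < t < 1 + e -> I t by rewrite /I /= in_itv.
have gI t c : I t -> atlas c -> chart_dom c (gamma t) -> geod_at g c gamma t.
  exact: geodesic_on_geod oI geo.
have I01 t : 0 <= t <= 1 -> I t.
  by move=> /andP[? ?]; apply: eI; apply/andP; split; lra.
have h0 : 0 <= (0 : R) <= (1 : R) by apply/andP; split; lra.
have h1 : 0 <= (1 : R) <= (1 : R) by apply/andP; split; lra.
have P := propagation hg oI gI ler01 I01.
have [ac c0] := chart_atP (gamma 0).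
(* Both ends are read in the same chart, so that closing up is an equation between coordinates and
   the two velocities can be compared. *)
have cE : chart_at (gamma 1) = chart_at (gamma 0) by rewrite -loop.
rewrite cE in P; set c := chart_at (gamma 0) in ac c0 cE P.
have c1 : chart_dom c (gamma 1) by rewrite -loop.
have G0 := gI _ _ (I01 _ h0) ac c0; have G1 := gI _ _ (I01 _ h1) ac c1.
have [Phi [S [[r r0 HS] Sb SD SJ]]] := P.
set z0 := lift c gamma 0 in HS Sb SD.
have Bu := nonconjugate_unit hg oI gI e0 eI ac c0 c1 hconj SJ.
have zO : state_dom c z0 by exact: lift_dom.
have l01 : lsubmx (lift c gamma 1) = lsubmx z0 by rewrite /z0 !lsub_lift loop.
have E0 : lsubmx (lift c (S z0) 1) = lsubmx z0 by rewrite Sb.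
pose en (z : 'rV[R]_(n + n)) : R := energy g c z 0 0.
have gN : geod_near g 0 1 gamma.
  exists e; first exact: e0.
  move=> t ht; have [at_ tt] := chart_atP (gamma t).
  exists (chart_at (gamma t)); first exact: at_.
  exact: gI (eI t ht) at_ tt.
have en0 : metric_form g (velocity gamma 0) (velocity gamma 0) = en z0.
  by rewrite (metric_form_energy hg ac G0).
have neg0 : en z0 < 0 by rewrite -en0; apply: neg; rewrite in_itv.
have arc0 : arc_length g 0 1 gamma = Num.sqrt `|en z0|.
  apply: arc_length_constant => t ht; rewrite -en0; exact: geod_near_energy.
have eD := C1_strict_diff (state_dom_open ac) (energy_smooth hg ac 1) zO.
have sub1 (A B : 'rV[R]_1) : (A - B) 0 0 = A 0 0 - B 0 0 by rewrite !mxE.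
have opp1 (A : 'rV[R]_1) : (- A) 0 0 = - A 0 0 by rewrite mxE.
have nen : \forall z \near z0, en z < 0.
  have cn := strict_diff_continuous eD.
  have n0 : 0 < - en z0 by rewrite oppr_gt0.
  apply: filterS (continuous_dist cn n0) => z zz.
  have := le_lt_trans (ler_mx_norm (energy g c z - energy g c z0) 0 0) zz.
  have -> : (energy g c z - energy g c z0) 0 0 = en z - en z0 by exact: sub1.
  by rewrite ltr_norml => /andP[_]; rewrite ltrBlDr addNr.
(* Near [z0], a solution of the coordinate loop equation gives a timelike geodesic loop admissible
   in the extremality condition: the energy remains negative, and [U] pulls back to a neighborhood
   of [z0]. *)
have loops U : bundle_nbhs (initial_condition gamma) U ->
    exists2 r1 : R, 0 < r1 & forall z : 'rV[R]_(n + n), `|z - z0| < r1 ->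
      lsubmx (lift c (S z) 1) = lsubmx z ->
      [/\ timelike_geodesic_loop g 0 1 (S z), U (initial_condition (S z)),
          arc_length g 0 1 (S z) = Num.sqrt `|en z| & en z < 0].
  move=> [N nN HN].
  have nN' : \forall z \near z0, N (lsubmx z, rsubmx z).
    apply: near_lsub_rsub; rewrite /z0 lsub_lift -(components_velocity hg ac G0).
    exact: nN.
  have nr : \forall z \near z0, `|z - z0| < r by apply/near_normP; exists r.
  have [r1 r10 Hr] := (near_normP _ _).1 (near_and nr (near_and nN' nen)).
  exists r1; first exact: r10.
  move=> z /Hr [zr [zN zn]] Ez; have [GN d0 Lz d1] := HS z zr.
  have Gz := geod_near_at hg GN (lexx 0) ler01 ac d0.
  have enz : metric_form g (velocity (S z) 0) (velocity (S z) 0) = en z.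
    by rewrite (metric_form_energy hg ac Gz) Lz.
  split; [split| | |exact: zn].
  - by apply: (geod_near_timelike hg GN); rewrite enz.
  - rewrite -Lz !lsub_lift Lz in Ez.
    by rewrite -(chart_mapK ac d0) -(chart_mapK ac d1) Ez.
  - apply: HN; first exact: d0.
    rewrite /bundle_chart /= (components_velocity hg ac Gz) Lz.
    by rewrite -(lsub_lift c (S z) 0) Lz.
  - by apply: arc_length_constant => t ht; rewrite -enz; exact: geod_near_energy.
have critical (h : 'rV[R]_(n + n)) : lsubmx (h *m Phi) = lsubmx h ->
    h *m 'J (energy g c) z0 = 0.
  move=> hP; apply/rowP => j; rewrite [j]ord1 [RHS]mxE.
  case: hext => [[U /loops [r1 r10 Hl] HU]|[U /loops [r1 r10 Hl] HU]].
  (* Energies are negative, so a longer loop has a smaller energy: maximal length means minimal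
     energy, and the criterion is applied to minus the energy. *)
  - have X (z : 'rV[R]_(n + n)) : `|z - z0| < r1 ->
        lsubmx (lift c (S z) 1) = lsubmx z ->
        (- energy g c z) 0 0 <= (- energy g c z0) 0 0.
      move=> zr Ez; have [Tl Uz az nz] := Hl z zr Ez.
      have := HU _ Tl Uz; rewrite az arc0 !opp1 lerN2; exact: ler_sqrt_neg.
    apply/eqP; rewrite -oppr_eq0 -opp1 -mulmxN; apply/eqP.
    exact: extremal_loop r10 SD E0 Bu hP (strict_diffN eD) X.
  - apply: (extremal_loop r10 SD E0 Bu hP eD) => z zr Ez.
    have [Tl Uz az nz] := Hl z zr Ez.
    have := HU _ Tl Uz; rewrite az arc0; exact: ler_sqrt_neg.
(* An arbitrary [w] is realized as the common value at both ends of a Jacobi field with zero energy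
   variation; its pairing with the velocity is the same at [0] and [1]. *)
have veq : rsubmx (lift c gamma 1) = rsubmx z0.
  apply: (bil_inj (gram_unit hg ac zO)) => w.
  have [h lh hP] := loop_direction w Bu.
  have [J [JN L0 L1]] := SJ h.
  have V0 : energy_variation g c J 0 = 0.
    by rewrite /energy_variation L0; apply: critical; rewrite hP lh.
  have := velocity_pairing_constant hg oI gI I01 JN V0.
  rewrite (metric_form_components g _ _ ac c1) (metric_form_components g _ _ ac c0).
  rewrite (components_velocity hg ac G0) (components_velocity hg ac G1).
  by rewrite -!lsub_jlift L0 L1 hP lh -!lsub_lift l01.
exists 1; first exact: ltr01.
rewrite scale1r !velocityE cE; exact: esym veq.
Qed.
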